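(* Let $T\in\Omega$ be a substitution tiling of dimension 1, or of dimension 2 with $H^1(C_S^\bullet)$ torsion free. Then for each $k\in\{0,1,2\}$ there are a nonnegative integer $n$ (depending on $k$) with $H^k(C_S^\bullet)\cong\mathbb Z^n$ and isomorphisms $$H_k^{ST}\cong\varinjlim\big(\mathbb Z^n\xrightarrow{A_k^t}\mathbb Z^n\xrightarrow{A_k^t}\mathbb Z^n\xrightarrow{A_k^t}\cdots\big),\qquad H_S^k\cong\varinjlim\big(\mathbb Z^n\xrightarrow{A_k}\mathbb Z^n\xrightarrow{A_k}\mathbb Z^n\xrightarrow{A_k}\cdots\big),$$ where $A_k\in M_n(\mathbb Z)$ is the matrix of $H^k(W^\bullet)$ with respect to a fixed basis of $H^k(C_S^\bullet)$ and $A_k^t$ is the transpose of $A_k$.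
   Context: Tilings. A tiling $T$ of $\mathbb R^d$ is a CW-structure on $\mathbb R^d$ whose closed $d$-cells (the tiles) are homeomorphic to the closed unit disk; tiles may carry labels; $T$ is also regarded as the collection of its tiles, which cover $\mathbb R^d$ and meet only along boundaries. Cells are closed; $\mathring\sigma$ is the interior of a cell $\sigma$ (for a vertex $\mathring v=v$; for an edge, the edge minus its two vertices). A patch is a finite set of tiles. For $X\subset\mathbb R^d$, $T(X)$ is the set of tiles of $T$ meeting $X$; $T(x):=T(\{x\})$; tilings agree on $X$ if $T(X)=T'(X)$. Fix prototiles $t_1,\dots,t_N$, $\lambda>1$, and a substitution $\omega$: $\omega(t_i)$ is a patch of translates of prototiles with union $\lambda t_i$, $\omega(t_i+x)=\omega(t_i)+\lambda x$, $\omega(P)=\bigcup_{t\in P}\omega(t)$ (the cells of $\omega(T)$ subdivide those of $\lambda T$). $\Omega$ is the set of tilings by translates of prototiles all of whose patches lie in a translate of some $\omega^k(t_j)$, with metric $d(T,T')=\inf(\{1/\sqrt2\}\cup\{\varepsilon>0:\exists |x|,|x'|<\varepsilon,\ T+x,T'+x'\text{ agree on }B_{1/\varepsilon}(0)\})$. Standing assumptions: finite local complexity, $\omega$ primitive, $\omega:\Omega\to\Omega$ injective (hence $\Omega$ is compact, without periodic tilings, and $\omega$ is a homeomorphism). Stable cells. For cells $\sigma,\sigma'$ of $T$ of equal dimension, $\sigma\sim\sigma'$ iff there is $x\in\mathbb R^d$ with $\sigma'=\sigma+x$ and $T(\mathring\sigma')=T(\mathring\sigma)+x$. The classes $[v],[e],[f]$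 of vertices, edges, faces are the stable vertices, edges, faces; their finite numbers are $sV,sE,sF$ ($sF=0$ if $d=1$). Since all tilings in $\Omega$ have the same patches up to translation, stable cells of $\omega(T)$ are identified with those of $T$. Choose orientations of stable edges and (counterclockwise) of faces, transported by translation. Put $\delta_{e,v}=-1,1,0$ if $v$ is the initial vertex of $e$, the final vertex of $e$, or neither; $\delta_{f,e}=1,-1,0$ if $e\subset\partial f$ with same orientation, opposite orientation, or $e\not\subset\partial f$. Define $\delta^0:\mathbb Z^{sV}\to\mathbb Z^{sE}$, $\delta^0([v])=\sum_{e\in T(v)}\delta_{e,v}[e]$ (sum over edges of the patch $T(v)$), and $\delta^1:\mathbb Z^{sE}\to\mathbb Z^{sF}$, $\delta^1([e])=\sum_{f\in T(\mathring e)}\delta_{f,e}[f]$ (zero if $d=1$). Homotopy. Let $T_0=T$, $T_1=\frac1\lambda\omega(T)$. It is assumed that there is a homotopy $h:\mathbb R^d\times[0,1]\to\mathbb R^d$, $h_s=h(\cdot,s)$, such that (ignoring orientations): (1) $h_0=\mathrm{id}$. (2) For $0<s<1$, $h_s$ is a homeomorphism, and for each prototile $t_i$, $h_s:t_i\to t_i$ is a cellular homeomorphism, with $h_s(v)=v$ and $h_s(e)=e$ for vertices $v$ and edges $e$ of $t_i$. (3) For each prototile $t_i$: (i) $h_1:\frac1\lambda\omega(t_i)\to t_i$ is cellular and surjective, and if $e\subset h_1(e')$ for edges $e$ of $t_i$, $e'$ of $\frac1\lambda\omega(t_i)$ then $h_1(e')=e$; (ii) there is a unique tile $t_i'\in\frac1\lambda\omega(t_i)$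 with $h_1(t'_i)=t_i$, and $h_1:\mathring t_i'\to\mathring t_i$ is a homeomorphism; (iii) $h_1(v)=v$ for vertices $v$ of $t_i$, and for each edge $e\subset\partial t_i$ there is a unique edge $e'$ of $\frac1\lambda\omega(\partial t_i)$ with $h_1(e')=e$, and moreover $e'\subset e$ and $h_1:\mathring e'\to\mathring e$ is a homeomorphism; (iv) for each tile $t''\in\frac1\lambda\omega(t_i)$ and edge $e$ of $t_i$ with $e\subset h_1(t'')$, exactly two edges of $t''$ are mapped by $h_1$ onto $e$ if $t''\ne t_i'$, and exactly one if $t''=t_i'$; moreover $h_1^{-1}(e)$ is connected. (4) Items (2),(3) hold for all tiles of $T$ by translation. (For $d=1$ items (iii),(iv) can be ignored.) Connecting maps. $W_F([f])=\sum_{f'\in\omega(f),\,h_1(\frac1\lambda f')=f}[f']$; $W_E([e])=\sum_{e'\in\omega(T(\mathring e)),\,h_1(\frac1\lambda e')=e}\delta_{e,e'}[e']$; $W_V([v])=\sum_{v'\in\omega(T(v)),\,h_1(\frac1\lambda v')=v}[v']$, summing over faces, edges, vertices of the indicated patches, with $\delta_{e,e'}=\pm1$ according to whether $h_1(\frac1\lambda e')=e$ matches or reverses orientation. These form a cochain endomorphism $W^\bullet=(W_V,W_E,W_F)$ of $C_S^\bullet:\ 0\to\mathbb Z^{sV}\xrightarrow{\delta^0}\mathbb Z^{sE}\xrightarrow{\delta^1}\mathbb Z^{sF}\to0$ (degrees $0,1,2$). Groups. $\varinjlim(X,\alpha)$ denotes the direct limit of $X\xrightarrow{\alpha}X\xrightarrow{\alpha}\cdots$.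 $C_\bullet^{ST}$ is the transpose chain complex $0\to\mathbb Z^{sF}\xrightarrow{(\delta^1)^t}\mathbb Z^{sE}\xrightarrow{(\delta^0)^t}\mathbb Z^{sV}\to0$ with chain map $(W^\bullet)^t$. $H_S^k=\varinjlim(H^k(C_S^\bullet),H^k(W^\bullet))$ and $H_k^{ST}=\varinjlim(H_k(C_\bullet^{ST}),H_k((W^\bullet)^t))$. *)

(* Defs.v *)
From HB Require Import structures.
From mathcomp Require Import all_boot all_order all_algebra finmap.
From mathcomp Require Import zify.
From mathcomp Require Import all_classical all_reals all_analysis.

Set Implicit Arguments.
Unset Strict Implicit.
Unset Printing Implicit Defensive.

Import Order.TTheory GRing.Theory Num.Theory numFieldNormedType.Exports.
Import Quotient.

Local Open Scope classical_set_scope.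
Local Open Scope ring_scope.
Local Open Scope quotient_scope.

(** * Homology of integer matrices and direct limits of abelian groups *)

Definition zmod_iso (A B : zmodType) : Prop :=
  exists f : {additive A -> B}, bijective f.

Definition torsion_free (A : zmodType) : Prop :=
  forall (x : A) (m : nat), (0 < m)%N -> x *+ m = 0 -> x = 0.

Definition is_basis (M : zmodType) (n : nat) (b : 'I_n -> M) : Prop :=
  bijective (fun c : 'cV[int]_n => \sum_i b i *~ c i 0).

Definition is_matrix_of (M : zmodType) (n : nat) (b : 'I_n -> M) (f : M -> M)
    (A : 'M[int]_n) : Prop :=
  forall j, f (b j) = \sum_i b i *~ A i j.

Section Homology.
(* Z^m --B--> Z^n --A--> Z^p *)
Variables (p n m : nat) (A : 'M[int]_(p, n)) (B : 'M[int]_(n, m)).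

Definition is_cycle : {pred 'cV[int]_n} := [pred x | A *m x == 0].

Lemma is_cycle_zmod_closed : zmod_closed is_cycle.
Proof.
split=> [|x y]; first by rewrite inE mulmx0.
by rewrite !inE => /eqP Ax /eqP Ay; rewrite mulmxBr Ax Ay subr0.
Qed.
HB.instance Definition _ :=
  GRing.isZmodClosed.Build 'cV[int]_n is_cycle is_cycle_zmod_closed.

Definition cycles := {x : 'cV[int]_n | x \in is_cycle}.
HB.instance Definition _ := SubChoice.on cycles.
HB.instance Definition _ := [SubChoice_isSubZmodule of cycles by <:].

Definition is_boundary : {pred cycles} :=
  [pred z : cycles | `[< exists y, val z = B *m y >]].

Lemma is_boundary_zmod_closed : zmod_closed is_boundary.
Proof.
split=> [|x y]; first by apply/asboolP; exists 0; rewrite mulmx0.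
move=> /asboolP[u xu] /asboolP[v yv]; apply/asboolP; exists (u - v).
by rewrite mulmxBr -xu -yv raddfB.
Qed.
HB.instance Definition _ :=
  GRing.isZmodClosed.Build cycles is_boundary is_boundary_zmod_closed.

Definition homology : zmodType := quot is_boundary.

End Homology.

Section HomologyMap.
Variables (p n m : nat) (A : 'M[int]_(p, n)) (B : 'M[int]_(n, m)).
Variables (Up : 'M[int]_p) (Un : 'M[int]_n) (Um : 'M[int]_m).

Definition is_endo : Prop :=
  [/\ A *m B = 0, A *m Un = Up *m A & Un *m B = B *m Um].

(* The map induced on ker A / im B by an endomorphism (Um, Un, Up) of the
   complex Z^m --B--> Z^n --A--> Z^p.  The function is total: it is 0 by
   convention if these data do not form an endomorphism of a complex, which
   never happens for the connecting maps of a substitution tiling. *)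
Definition homology_map (x : homology A B) : homology A B :=
  if `[< is_endo >]
  then \pi_(homology A B) (insubd (0 : cycles A) (Un *m val (repr x)))
  else 0.

Lemma homology_map_pi (z : cycles A) : is_endo ->
  homology_map (\pi z) = \pi_(homology A B) (insubd (0 : cycles A) (Un *m val z)).
Proof.
move=> endo; rewrite /homology_map asboolT //.
case: endo => AB AU UB.
have cyc (w : cycles A) : Un *m val w \in is_cycle A.
  by have /eqP Aw := valP w; rewrite inE mulmxA AU -mulmxA Aw mulmx0.
apply/eqP; rewrite -idealrBE.
have /eqP : repr (\pi_(homology A B) z) = z %[mod homology A B] by rewrite reprK.
rewrite -idealrBE => /asboolP[y yE]; apply/asboolP; exists (Um *m y).
rewrite raddfB /= !insubdK ?cyc //; move: yE; rewrite raddfB /= => yE.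
by rewrite -mulmxBr yE !mulmxA UB.
Qed.

Lemma homology_map_is_zmod_morphism : zmod_morphism homology_map.
Proof.
move=> x y; have [endo|nendo] := asboolP is_endo; last first.
  by rewrite /homology_map asboolF // subr0.
have piB (u v : cycles A) :
    \pi_(homology A B) u - \pi v = \pi_(homology A B) (u - v).
  by rewrite [RHS]pi_is_zmod_morphism.
rewrite -[x]reprK -[y]reprK piB !homology_map_pi // piB.
case: endo => AB AU UB.
have cyc (w : cycles A) : Un *m val w \in is_cycle A.
  by have /eqP Aw := valP w; rewrite inE mulmxA AU -mulmxA Aw mulmx0.
have valM (w : cycles A) :
    val (insubd (0 : cycles A) (Un *m val w)) = Un *m val w.
  by rewrite insubdK ?cyc.
congr (\pi _); apply: val_inj; rewrite valM.
have valB (u v : cycles A) : val (u - v) = val u - val v by exact: raddfB.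
by rewrite [RHS]valB !valM valB mulmxBr.
Qed.
HB.instance Definition _ := GRing.isZmodMorphism.Build (homology A B)
  (homology A B) homology_map homology_map_is_zmod_morphism.

End HomologyMap.

Section DirectLimit.
Variables (X : zmodType) (alpha : {additive X -> X}).

(* (i, x) is the element x of the i-th copy of X in X -> X -> X -> ... *)
Definition lim_eq : rel (nat * X) := fun u v =>
  `[< exists k, iter (k + v.1) alpha u.2 = iter (k + u.1) alpha v.2 >].

Let iter_add k (x y : X) :
  iter k alpha (x + y) = iter k alpha x + iter k alpha y.
Proof. by elim: k => //= k ->; rewrite raddfD. Qed.

Let iter_opp k (x : X) : iter k alpha (- x) = - iter k alpha x.
Proof. by elim: k => //= k ->; rewrite raddfN. Qed.

Lemma lim_eq_is_equiv : equiv_class_of lim_eq.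
Proof.
split=> [u|u v|v u w]; first by apply/asboolP; exists 0%N.
  by apply/asboolP/asboolP=> -[k e]; exists k.
move=> /asboolP[k e] /asboolP[l f]; apply/asboolP; exists (k + l + v.1)%N.
have -> : (k + l + v.1 + w.1)%N = ((l + w.1) + (k + v.1))%N by lia.
rewrite iterD e -iterD.
have -> : (l + w.1 + (k + u.1))%N = ((k + u.1) + (l + w.1))%N by lia.
by rewrite iterD f -iterD; congr (iter _ _ _); lia.
Qed.

Canonical lim_eq_equiv := EquivRelPack lim_eq_is_equiv.
Canonical lim_eq_encModRel := defaultEncModRel lim_eq.

Definition dirlim := {eq_quot lim_eq}.
HB.instance Definition _ : EqQuotient (nat * X)%type lim_eq dirlim :=
  EqQuotient.on dirlim.
HB.instance Definition _ := Choice.on dirlim.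

Definition lim_add (u v : nat * X) : nat * X :=
  ((u.1 + v.1)%N, iter v.1 alpha u.2 + iter u.1 alpha v.2).

Definition dirlim0 : dirlim := \pi_dirlim (0%N, 0).
Definition dirlimN (a : dirlim) : dirlim := \pi_dirlim ((repr a).1, - (repr a).2).
Definition dirlimD (a b : dirlim) : dirlim := \pi_dirlim (lim_add (repr a) (repr b)).

Let piP u v : lim_eq u v -> \pi_dirlim u = \pi_dirlim v.
Proof. by move=> uv; apply/eqP; rewrite piE. Qed.

Let repr_pi u : lim_eq (repr (\pi_dirlim u)) u.
Proof.
have /eqP : \pi_dirlim (repr (\pi_dirlim u)) = \pi_dirlim u by rewrite reprK.
by rewrite piE.
Qed.

Lemma dirlimN_pi u : dirlimN (\pi u) = \pi_dirlim (u.1, - u.2).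
Proof.
have /asboolP[k e] := repr_pi u; apply/piP/asboolP; exists k => /=.
by rewrite !iter_opp e.
Qed.

Let lim_add_compat u u' v v' : lim_eq u' u -> lim_eq v' v ->
  lim_eq (lim_add u' v') (lim_add u v).
Proof.
move=> /asboolP[k e] /asboolP[l f].
apply/asboolP; exists (k + l)%N => /=; rewrite !iter_add -!iterD.
congr (_ + _).
  have -> : (k + l + (u.1 + v.1) + v'.1)%N = ((l + v.1 + v'.1) + (k + u.1))%N by lia.
  by rewrite iterD e -iterD; congr (iter _ _ _); lia.
have -> : (k + l + (u.1 + v.1) + u'.1)%N = ((k + u.1 + u'.1) + (l + v.1))%N by lia.
by rewrite iterD f -iterD; congr (iter _ _ _); lia.
Qed.

Lemma dirlimD_pi u v : dirlimD (\pi u) (\pi v) = \pi_dirlim (lim_add u v).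
Proof. by apply: piP; apply: lim_add_compat; exact: repr_pi. Qed.

Lemma dirlimDA : associative dirlimD.
Proof.
move=> a b c; rewrite -[a]reprK -[b]reprK -[c]reprK !dirlimD_pi; congr (\pi _).
rewrite /lim_add /= addnA !iter_add -!iterD addrA.
by congr (_, iter _ _ _ + iter _ _ _ + _); lia.
Qed.

Lemma dirlimDC : commutative dirlimD.
Proof.
move=> a b; rewrite -[a]reprK -[b]reprK !dirlimD_pi; congr (\pi _).
by rewrite /lim_add addnC addrC.
Qed.

Lemma dirlim0D : left_id dirlim0 dirlimD.
Proof.
move=> a; rewrite -[a]reprK dirlimD_pi; congr (\pi _); rewrite /lim_add /=.
have -> : iter (repr a).1 alpha 0 = 0 by elim: (_.1) => //= k ->; rewrite raddf0.
by rewrite add0r; case: (repr a).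
Qed.

Lemma dirlimND : left_inverse dirlim0 dirlimN dirlimD.
Proof.
move=> a; rewrite -[a]reprK dirlimN_pi dirlimD_pi; apply/piP/asboolP; exists 0%N.
by rewrite /lim_add /= iter_opp addNr; elim: (_ + _)%N => //= k <-; rewrite raddf0.
Qed.

HB.instance Definition _ :=
  GRing.isZmodule.Build dirlim dirlimDA dirlimDC dirlim0D dirlimND.

End DirectLimit.

Section CochainComplex.
(* The cochain complex Z^(s 0) --> Z^(s 1) --> Z^(s 2) --> ... with
   differentials D and a graded endomorphism W; the degree k - 1 data are 0
   for k = 0. *)
Variables (s : nat -> nat) (D : forall k, 'M[int]_(s k.+1, s k)).
Variable W : forall k, 'M[int]_(s k).

Definition s_pred (k : nat) : nat := if k is k'.+1 then s k' else 0%N.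

Definition D_pred (k : nat) : 'M[int]_(s k, s_pred k) :=
  match k with 0%N => 0 | k'.+1 => D k' end.

Definition W_pred (k : nat) : 'M[int]_(s_pred k) :=
  match k with 0%N => 0 | k'.+1 => W k' end.

Definition cohomology (k : nat) : zmodType := homology (D k) (D_pred k).

Definition cohomology_map (k : nat) :
    {additive cohomology k -> cohomology k} :=
  homology_map (A := D k) (B := D_pred k) (W k.+1) (W k) (W_pred k).

Definition transpose_homology (k : nat) : zmodType :=
  homology (D_pred k)^T (D k)^T.

Definition transpose_homology_map (k : nat) :
    {additive transpose_homology k -> transpose_homology k} :=
  homology_map (A := (D_pred k)^T) (B := (D k)^T)
    (W_pred k)^T (W k)^T (W k.+1)^T.

End CochainComplex.

(** * Cell complexes in R^d *)

Definition homeo (U V : topologicalType) (A : set U) (B : set V) (f : U -> V) :=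
  exists g : V -> U,
    [/\ {within A, continuous f}, {within B, continuous g},
        (forall x, A x -> B (f x) /\ g (f x) = x) &
        (forall y, B y -> A (g y) /\ f (g y) = y)].

Section CellComplex.
Variables (R : realType) (d : nat).
Implicit Types (s t X : set 'rV[R]_d) (x y : 'rV[R]_d).

(* The cells are closed, and vertices are singletons: K k is the set of the
   cells of dimension k. *)
Implicit Type K : nat -> set (set 'rV[R]_d).

Definition translate x s : set 'rV[R]_d := [set y + x | y in s].
Definition dilate (c : R) s : set 'rV[R]_d := [set c *: y | y in s].

Definition unit_disk k : set 'rV[R]_k := [set x | \sum_i x 0 i ^+ 2 <= 1].
Definition unit_sphere k : set 'rV[R]_k := [set x | \sum_i x 0 i ^+ 2 = 1].

(* Union of the cells of dimension < k. *)
Definition skeleton K (k : nat) : set 'rV[R]_d :=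
  \bigcup_(j in [set j | (j < k)%N]) \bigcup_(s in K j) s.

(* A vertex is its own interior, an edge loses its two vertices, a face loses
   its edges and vertices. *)
Definition cell_interior K k s : set 'rV[R]_d := s `\` skeleton K k.
Definition cell_boundary K k s : set 'rV[R]_d := s `&` skeleton K k.

(* K is a CW-structure on the closed set X, with closed cells homeomorphic to
   closed disks. *)
Definition is_CW K X : Prop :=
  [/\ \bigcup_k \bigcup_(s in K k) s = X,
      forall k s, K k s -> exists phi : 'rV[R]_k -> 'rV[R]_d,
        homeo (@unit_disk k) s phi /\
        phi @` (@unit_sphere k) = cell_boundary K k s,
      forall k s j t, K k s -> K j t ->
        cell_interior K k s `&` cell_interior K j t !=set0 -> k = j /\ s = t,
      (* closure-finiteness *)
      forall k s, K k s ->
        finite_set [set t | exists2 j, K j t & cell_interior K j t `&` s !=set0] &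
      (* weak topology *)
      forall A, A `<=` X -> (forall k s, K k s -> closed (A `&` s)) -> closed A].

(* The k-th coordinate (0 if k >= d). *)
Definition crd x (k : nat) : R := oapp (x 0) 0 (insub k).

(* For d = 2: the closed curve gamma on [0, 1] avoids p and has winding number
   w about p, as measured by a continuous choice theta of the argument. *)
Definition has_winding (gamma : R -> 'rV[R]_d) (p : 'rV[R]_d) (w : R) : Prop :=
  exists theta rho : R -> R,
    [/\ {within `[0, 1]%classic, continuous theta},
        forall u, 0 <= u <= 1 ->
          [/\ 0 < rho u,
              crd (gamma u) 0 = crd p 0 + rho u * cos (theta u) &
              crd (gamma u) 1 = crd p 1 + rho u * sin (theta u)] &
        theta 1 = theta 0 + 2 * pi * w].

(* gamma runs once, counterclockwise, around the boundary of the face f. *)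
Definition counterclockwise K (f : set 'rV[R]_d) (gamma : R -> 'rV[R]_d) : Prop :=
  [/\ {within `[0, 1]%classic, continuous gamma},
      gamma 0 = gamma 1,
      (forall u v, 0 <= u < 1 -> 0 <= v < 1 -> gamma u = gamma v -> u = v),
      gamma @` `[0, 1]%classic = cell_boundary K 2 f &
      (forall p, cell_interior K 2 f p -> has_winding gamma p 1) /\
      (forall p, ~ f p -> has_winding gamma p 0)].

(* Walking counterclockwise around f, one traverses e from x to y. *)
Definition traverses K (f e : set 'rV[R]_d) x y : Prop :=
  exists gamma u, [/\ counterclockwise K f gamma, 0 < u < 1, gamma 0 = x,
    gamma u = y & gamma @` `[0, u]%classic = e].

End CellComplex.

(** * Substitution tilings *)

(* Prototile i is the set proto i, with its k-cells proto_cells i k; a tile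
   (i, x) is the translate of prototile i by x, so that the index i plays the
   role of the label of the tile. *)
Record substitution (R : realType) (d : nat) := Substitution {
  nproto : nat;
  proto : 'I_nproto -> set 'rV[R]_d;
  proto_cells : 'I_nproto -> nat -> set (set 'rV[R]_d);
  expansion : R;
  subst_rule : 'I_nproto -> set ('I_nproto * 'rV[R]_d)
}.

Section Tilings.
Variables (R : realType) (d : nat) (S : substitution R d).

Definition tile : Type := 'I_(nproto S) * 'rV[R]_d.

Implicit Types (t : tile) (P T : set tile) (X : set 'rV[R]_d) (x : 'rV[R]_d).

Local Notation lam := (expansion S).

Definition tile_set t : set 'rV[R]_d := translate t.2 (proto t.1).

Definition tile_cells t (k : nat) : set (set 'rV[R]_d) :=
  [set translate t.2 s | s in proto_cells t.1 k].

Definition cells P (k : nat) : set (set 'rV[R]_d) :=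
  \bigcup_(t in P) tile_cells t k.

Definition support P : set 'rV[R]_d := \bigcup_(t in P) tile_set t.

Definition shift x P : set tile := [set (t.1, t.2 + x) | t in P].

(* T(X) *)
Definition meeting T X : set tile :=
  [set t | T t /\ tile_set t `&` X !=set0].

Definition is_tiling_of X P : Prop :=
  is_CW (cells P) X /\
  forall t t', P t -> P t' -> t <> t' ->
    tile_set t `&` tile_set t' `<=` skeleton (cells P) d.

Definition omega_tile t : set tile :=
  [set (u.1, u.2 + lam *: t.2) | u in subst_rule t.1].

Definition omega P : set tile := \bigcup_(t in P) omega_tile t.

Definition Omega : set (set tile) :=
  [set T | is_tiling_of setT T /\
    forall P, finite_set P -> P `<=` T ->
      exists m j x, P `<=` shift x (iter m omega [set (j, 0)])].

Definition finite_local_complexity : Prop :=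
  forall r : R, exists F : set (set tile), finite_set F /\
    forall T P, Omega T -> finite_set P -> P `<=` T ->
      (forall a b, support P a -> support P b -> `|a - b| <= r) ->
      exists Q x, F Q /\ P = shift x Q.

Definition primitive : Prop :=
  exists2 m, (0 < m)%N &
    forall i j, exists x, iter m omega [set (i, 0)] (j, x).

Definition is_substitution : Prop :=
  [/\ 1 < lam,
      forall i,
        [/\ is_CW (@proto_cells _ _ S i) (proto i),
            proto_cells i d = [set proto i] &
            forall k, (d < k)%N -> proto_cells i k = set0] &
      forall i : 'I_(nproto S),
        finite_set (subst_rule i) /\ is_tiling_of (dilate lam (proto i)) (subst_rule i)].

(* The last clause: the cells of omega T subdivide those of lam T. *)
Definition standing_assumptions : Prop :=
  [/\ finite_local_complexity, primitive,
      forall T, Omega T -> Omega (omega T),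
      forall T T', Omega T -> Omega T' -> omega T = omega T' -> T = T' &
      forall T k s, Omega T -> cells T k s ->
        dilate lam s =
        \bigcup_(c in [set c | (exists j, cells (omega T) j c) /\
                               c `<=` dilate lam s]) c].

(** ** Stable cells *)

(* T(s°) *)
Definition star T (k : nat) (s : set 'rV[R]_d) : set tile :=
  meeting T (cell_interior (cells T) k s).

Definition equiv_by x (k : nat) T s T' s' : Prop :=
  s' = translate x s /\ star T' k s' = shift x (star T k s).

(* Used with T' = T to define the stable cells of T, and with T' = omega T to
   identify the stable cells of omega T with those of T. *)
Definition cell_equiv (k : nat) T s T' s' : Prop :=
  exists x, equiv_by x k T s T' s'.

Definition stable_cells T (k : nat) : set (set (set 'rV[R]_d)) :=
  [set [set s' | cells T k s' /\ cell_equiv k T s T s'] | s in cells T k].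

(* sV, sE, sF are stable_num T k for k = 0, 1, 2. *)
Definition stable_num T (k : nat) : nat := #|` fset_set (stable_cells T k)|%fset.

(* A representative of the i-th stable k-cell. *)
Definition stable_rep T (k : nat) (i : 'I_(stable_num T k)) : set 'rV[R]_d :=
  xget set0 (nth set0 (fset_set (stable_cells T k)) i).

(* An orientation o T e of the edge e of T is the pair consisting of its initial
   and final vertices.  It only depends on the stable edge of e, up to
   translation, and stable edges are shared by all the tilings in Omega. *)
Definition is_orientation
    (o : set tile -> set 'rV[R]_d -> 'rV[R]_d * 'rV[R]_d) : Prop :=
  (forall T e, Omega T -> cells T 1 e ->
     [/\ cells T 0 [set (o T e).1], cells T 0 [set (o T e).2],
         e (o T e).1, e (o T e).2 & (o T e).1 <> (o T e).2]) /\
  (forall T e T' e' x, Omega T -> Omega T' -> cells T 1 e -> cells T' 1 e' ->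
     equiv_by x 1 T e T' e' ->
     o T' e' = ((o T e).1 + x, (o T e).2 + x)).

(** ** The homotopy *)

Section Collapse.
Variable (h : R -> 'rV[R]_d -> 'rV[R]_d).

(* Image under h_1 of the rescaling by 1/lam of a cell of omega T. *)
Definition collapse (s : set 'rV[R]_d) : set 'rV[R]_d :=
  h 1 @` dilate lam^-1 s.

(* For 0 < s < 1. *)
Definition isotopy_on t (s : R) : Prop :=
  [/\ homeo (tile_set t) (tile_set t) (h s),
      forall k, h s @` skeleton (tile_cells t) k `<=` skeleton (tile_cells t) k,
      forall v, tile_cells t 0 [set v] -> h s v = v &
      forall e, tile_cells t 1 e -> h s @` e = e].

Definition collapse_cellular t : Prop :=
  [/\ forall k, collapse (skeleton (cells (omega_tile t)) k)
        `<=` skeleton (tile_cells t) k,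
      collapse (support (omega_tile t)) = tile_set t &
      forall e e', tile_cells t 1 e -> cells (omega_tile t) 1 e' ->
        e `<=` collapse e' -> collapse e' = e].

Definition collapse_tile t : Prop :=
  exists t', [/\ omega_tile t t', collapse (tile_set t') = tile_set t,
    forall t'', omega_tile t t'' -> collapse (tile_set t'') = tile_set t ->
      t'' = t' &
    homeo (dilate lam^-1 (cell_interior (tile_cells t') d (tile_set t')))
          (cell_interior (tile_cells t) d (tile_set t)) (h 1)].

Definition collapse_boundary t : Prop :=
  let bd := cell_boundary (tile_cells t) d (tile_set t) in
  (forall v, tile_cells t 0 [set v] -> h 1 v = v) /\
  (forall e, tile_cells t 1 e -> e `<=` bd ->
     exists e',
       [/\ cells (omega_tile t) 1 e' /\ e' `<=` dilate lam bd, collapse e' = e,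
           forall e'', cells (omega_tile t) 1 e'' -> e'' `<=` dilate lam bd ->
             collapse e'' = e -> e'' = e',
           dilate lam^-1 e' `<=` e &
           homeo (dilate lam^-1 (cell_interior (cells (omega_tile t)) 1 e'))
                 (cell_interior (tile_cells t) 1 e) (h 1)]).

Definition collapse_fibers t : Prop :=
  forall e, tile_cells t 1 e ->
    (forall t'', omega_tile t t'' -> e `<=` collapse (tile_set t'') ->
       let over := [set c | tile_cells t'' 1 c /\ collapse c = e] in
       (collapse (tile_set t'') <> tile_set t -> (over #= `I_2)%card) /\
       (collapse (tile_set t'') = tile_set t -> (over #= `I_1)%card)) /\
    connected [set y | tile_set t y /\ e (h 1 y)].

(* The conditions hold on every tile of T, and h is the translate of the same
   homotopy on the tiles that are translates of the same prototile (last clause);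
   every prototile occurs in T by primitivity. *)
Definition is_homotopy T : Prop :=
  [/\ {within [set p : 'rV[R]_d * R | 0 <= p.2 <= 1],
        continuous (fun p => h p.2 p.1)},
      (forall x, h 0 x = x),
      (forall s, 0 < s < 1 -> homeo setT setT (h s) /\
         forall t, T t -> isotopy_on t s),
      (forall t, T t ->
         [/\ collapse_cellular t, collapse_tile t &
             d = 2%N -> collapse_boundary t /\ collapse_fibers t]) &
      (forall i x x' y s, T (i, x) -> T (i, x') -> proto i y -> 0 <= s <= 1 ->
         h s (y + x) - x = h s (y + x') - x')].

End Collapse.

(** ** The complex of stable cells *)

Section StableComplex.
Variables (T : set tile) (o : set tile -> set 'rV[R]_d -> 'rV[R]_d * 'rV[R]_d).
Variable h : R -> 'rV[R]_d -> 'rV[R]_d.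

Definition incidence_ev (e v : set 'rV[R]_d) : int :=
  if `[< v = [set (o T e).1] >] then -1
  else if `[< v = [set (o T e).2] >] then 1 else 0.

Definition incidence_fe (f e : set 'rV[R]_d) : int :=
  if `[< traverses (cells T) f e (o T e).1 (o T e).2 >] then 1
  else if `[< traverses (cells T) f e (o T e).2 (o T e).1 >] then -1 else 0.

Definition incidence (k : nat) (s' s : set 'rV[R]_d) : int :=
  match k with
  | 0%N => incidence_ev s' s
  | 1%N => incidence_fe s' s
  | _ => 0
  end.

(* The matrix of delta^k: its i-th column is the image of the i-th stable k-cell. *)
Definition delta (k : nat) :
    'M[int]_(stable_num T k.+1, stable_num T k) :=
  \matrix_(j, i)
    \sum_(s' \in [set s' | cells (star T k (stable_rep i)) k.+1 s' /\
                           cell_equiv k.+1 T (stable_rep j) T s'])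
      incidence k s' (stable_rep i).

(* delta_(e,e') for an edge e of T and an edge e' of omega T. *)
Definition orientation_sign (e e' : set 'rV[R]_d) : int :=
  let a := h 1 (lam^-1 *: (o (omega T) e').1) in
  let b := h 1 (lam^-1 *: (o (omega T) e').2) in
  if `[< a = (o T e).1 /\ b = (o T e).2 >] then 1
  else if `[< a = (o T e).2 /\ b = (o T e).1 >] then -1 else 0.

(* The matrices of W_V, W_E, W_F for k = 0, 1, 2.  For a face f, the patch T(f°)
   consists of the tile f alone. *)
Definition connecting (k : nat) : 'M[int]_(stable_num T k) :=
  \matrix_(j, i)
    \sum_(s' \in [set s' | [/\ cells (omega (star T k (stable_rep i))) k s',
                               collapse h s' = stable_rep i &
                               cell_equiv k T (stable_rep j) (omega T) s']])
      (if k == 1%N then orientation_sign (stable_rep i) s' else 1).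

Definition stable_cohomology (k : nat) : zmodType := cohomology delta k.

Definition stable_cohomology_map (k : nat) :
    {additive stable_cohomology k -> stable_cohomology k} :=
  cohomology_map delta connecting k.

Definition H_S (k : nat) : zmodType := dirlim (stable_cohomology_map k).

Definition H_ST (k : nat) : zmodType :=
  dirlim (transpose_homology_map delta connecting k).

End StableComplex.

End Tilings.

(* The direct limit of Z^n --A--> Z^n --A--> Z^n --A--> ... *)
Definition matrix_limit (n : nat) (A : 'M[int]_n) : zmodType :=
  dirlim (mulmx A : {additive 'cV[int]_n -> 'cV[int]_n}).

(* Main.v *)
From HB Require Import structures.
From mathcomp Require Import all_boot all_order all_algebra finmap.
From mathcomp Require Import zify ring lra.
From mathcomp Require Import all_classical all_reals all_analysis.
Require Import Defs.

(** Call an integer matrix saturated if its cokernel is torsion free. The theorem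
    is a universal coefficient theorem in which no torsion occurs, because all
    the coboundary matrices of the complex of stable cells are saturated.

    Algebra. By the Smith normal form, a saturated matrix M has an integral
    generalized inverse N, with M N M = M. Suppose that the coboundaries B into
    and D out of degree k are saturated and D B = 0. The idempotent
    (1 - B C)(1 - N D), where C and N are generalized inverses of B and D,
    projects onto a complement of im B in ker D; splitting it as G E with
    E G = 1 shows that ker D / im B is free, the columns of G being cycles that
    represent a basis and the rows of E the coordinates
    ([split_homology_exists]). The pair (E^T, G^T) plays the same role for the
    transposed complex ([split_homology_tr]). So an endomorphism U of the
    complex induces E U G on cohomology and the transposed matrix on the
    homology of the transposed complex, and the statements about direct limits
    follow ([split_homology_limits]).

    Geometry. In the top degree, the columns of the coboundary are, up to signs,
    differences of two basis vectors that may be absent: a vertex of the line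
    has at most one edge on each side, and an edge in the plane has at most one
    face on its left and at most one on its right ([same_side_eq]). The
    incidence matrix of a graph is saturated ([saturated_graph]). In the plane,
    delta^0 is saturated because H^1 is torsion free and delta^1 delta^0 = 0.
    This last identity says that the boundary of a face enters each of its
    vertices by one edge and leaves it by another ([face_vertex_sum],
    [delta_delta]).

    The plane topology rests on winding numbers. Two counterclockwise
    parametrizations of the same boundary differ by an increasing change of
    parameter, as a decreasing one would change the winding number about an
    interior point from 1 to -1 ([ccw_reparam]); so it makes sense to speak of
    the edge that leaves a vertex. If two faces were on the same side of an edge
    e, consider the closed path that remains when e is removed from the two
    boundaries: its winding numbers about two points of the two faces near an
    inner point of e would be 1 and -1, although the path does not pass near
    that point. *)

Set Implicit Arguments.
Unset Strict Implicit.
Unset Printing Implicit Defensive.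

Import Order.TTheory GRing.Theory Num.Theory numFieldNormedType.Exports.
Import Quotient.

Local Open Scope classical_set_scope.
Local Open Scope ring_scope.
Local Open Scope quotient_scope.

(** * Integer matrices with torsion-free cokernel *)

(** Torsion-freeness of the cokernel of [M], in the form in which it is used. *)
Definition saturated (m n : nat) (M : 'M[int]_(m, n)) : Prop :=
  forall (x : 'cV[int]_m) (k : nat), (0 < k)%N ->
    (exists y, x *+ k = M *m y) -> exists y, x = M *m y.

Lemma saturated_no_row (n : nat) (M : 'M[int]_(0, n)) : saturated M.
Proof. by move=> x k _ _; exists 0; apply/matrixP => -[]. Qed.

Lemma colZ_mulrn_eq0 (m : nat) (x : 'cV[int]_m) (k : nat) :
  (0 < k)%N -> x *+ k = 0 -> x = 0.
Proof.
move=> k0 xk; apply/colP => i; have : x i 0 *+ k = 0.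
  by rewrite -mulmxnE xk mxE.
by move/eqP; rewrite mulrn_eq0 eqn0Ngt k0 /= => /eqP->; rewrite mxE.
Qed.

Lemma saturated_no_col (m : nat) (M : 'M[int]_(m, 0)) : saturated M.
Proof.
move=> x k k0 [y]; rewrite [y]flatmx0 mulmx0 => /(colZ_mulrn_eq0 k0) ->.
by exists 0; rewrite mulmx0.
Qed.

(** In Smith normal form every nonzero diagonal entry d of a saturated matrix
    is a unit, because d times a basis vector lies in the image. Hence the rows
    with a nonzero entry give a factorization through Z^q with both factors
    split. *)
Lemma saturated_rank_factorization (m n : nat) (M : 'M[int]_(m, n)) :
  saturated M ->
  exists q (G : 'M[int]_(m, q)) (E : 'M[int]_(q, n))
           (G' : 'M[int]_(q, m)) (E' : 'M[int]_(n, q)),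
    [/\ M = G *m E, G' *m G = 1%:M & E *m E' = 1%:M].
Proof.
have [L Lu [R Ru [d _ ME]]] := int_Smith_normal_form M => satM.
set S := (X in L *m X *m R) in ME.
have S0 (i : 'I_m) (j : 'I_n) : i != j :> nat -> S i j = 0 by rewrite mxE => /negbTE->.
clearbody S.
have Sunit (i : 'I_m) (j : 'I_n) : S i j != 0 -> S i j * S i j = 1.
  move=> Sij; have ij : i = j :> nat by apply: contraNeq Sij => /S0->.
  have [||y /(congr1 (mulmx (invmx L)))] :=
    satM (L *m delta_mx i 0) `|S i j|%N; rewrite ?absz_gt0 //.
    have Sj : S *m delta_mx j 0 = S i j *: delta_mx i (0 : 'I_1).
      rewrite -colE; apply/colP => k; rewrite !mxE eqxx andbT.
      have [->|ki] := eqVneq k i; first by rewrite mulr1.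
      by rewrite mulr0 S0 // -ij.
    exists (invmx R *m (sgz (S i j) *: delta_mx j 0)).
    rewrite ME -!mulmxA (mulmxA R) mulmxV // mul1mx -!scalemxAr Sj.
    by rewrite -scalemxAr scalerA -scaler_nat; congr (_ *: _); lia.
  rewrite mulKmx // ME -!mulmxA mulKmx //; set z := R *m y.
  move=> /colP /(_ i); rewrite mxE !eqxx mxE (bigD1 j) //= big1 ?addr0.
    move: (S i j) (z j 0) => a b /(congr1 absz); rewrite abszM => /esym/eqP.
    by rewrite muln_eq1 => /andP[/eqP a1 _]; lia.
  by move=> k kj; rewrite S0 ?mul0r // ij eq_sym.
pose A := [set i | [exists j, S i j != 0]]%SET.
pose J := \matrix_(i < m, k < #|A|) (i == enum_val k)%:R : 'M[int]_(m, #|A|).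
have JS i k : (J^T *m S) k i = S (enum_val k) i.
  rewrite mxE (bigD1 (enum_val k)) //= big1 ?addr0 => [|l /negPf lk].
    by rewrite !mxE eqxx mul1r.
  by rewrite !mxE lk mul0r.
exists #|A|, (L *m J), (J^T *m S *m R), (J^T *m invmx L), (invmx R *m (J^T *m S)^T).
split.
- rewrite ME !mulmxA; congr (_ *m R); rewrite -!mulmxA; congr (L *m _).
  apply/matrixP => i j; rewrite mxE.
  under eq_bigr do rewrite JS.
  have [iA|iA] := boolP (i \in A).
    rewrite (bigD1 (enum_rank_in iA i)) //= big1 ?addr0.
      by rewrite !mxE enum_rankK_in // eqxx mul1r.
    move=> k; rewrite mxE; have [ik|] := eqVneq i (enum_val k); last by rewrite mul0r.
    by rewrite -[k in k != _](enum_valK_in iA) -ik eqxx.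
  rewrite big1 => [|k _].
    by move: iA; rewrite inE negb_exists => /forallP/(_ j)/negPn/eqP.
  rewrite mxE; have [ik|] := eqVneq i (enum_val k); last by rewrite mul0r.
  by rewrite ik enum_valP in iA.
- rewrite mulmxA -(mulmxA _ _ L) mulVmx // mulmx1.
  apply/matrixP => k l; rewrite mxE (bigD1 (enum_val k)) //= big1 ?addr0.
    by rewrite !mxE eqxx mul1r (inj_eq enum_val_inj).
  by move=> i /negPf ik; rewrite !mxE ik mul0r.
- rewrite mulmxA -(mulmxA _ R) mulmxV // mulmx1.
  apply/matrixP => k l; rewrite mxE.
  under eq_bigr do rewrite [X in _ * X]mxE !JS.
  have := enum_valP k; rewrite inE => /existsP[j Sj].
  have kj : enum_val k = j :> nat by apply: contraNeq Sj => /S0->.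
  rewrite (bigD1 j) //= big1 ?addr0; last first.
    by move=> i ij; rewrite S0 ?mul0r // kj eq_sym.
  rewrite mxE; have [<-|kl] := eqVneq k l; first by rewrite Sunit.
  rewrite [X in _ * X]S0 ?mulr0 // -kj; apply: contraNneq kl => /ord_inj/enum_val_inj->.
  by [].
Qed.

Lemma saturated_pinv (m n : nat) (M : 'M[int]_(m, n)) : saturated M ->
  exists N : 'M[int]_(n, m), M *m N *m M = M.
Proof.
move=> /saturated_rank_factorization[q [G [E [G' [E' [-> GG EE]]]]]].
exists (E' *m G'); rewrite -!mulmxA (mulmxA G') GG mul1mx.
by rewrite (mulmxA E) EE mul1mx.
Qed.

Lemma idempotent_split (n : nat) (e : 'M[int]_n) : e *m e = e ->
  exists q (G : 'M[int]_(n, q)) (E : 'M[int]_(q, n)), e = G *m E /\ E *m G = 1%:M.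
Proof.
move=> ee.
have /saturated_rank_factorization[q [G [E [G' [E' [eE GG EE]]]]]] : saturated e.
  move=> x k k0 [y xy]; exists x; apply/subr0_eq/(colZ_mulrn_eq0 k0).
  by rewrite mulrnBl -raddfMn /= xy mulmxA ee subrr.
exists q, G, E; split=> //.
have := ee; rewrite eE -mulmxA => /(congr1 (mulmx G')).
rewrite !mulmxA GG !mul1mx => /(congr1 (mulmx^~ E')).
by rewrite -!mulmxA EE !mulmx1.
Qed.

(** The value [None] gives the zero column; it stands for an absent end of an
    edge of a graph. *)
Definition opt_delta (m : nat) (a : option 'I_m) : 'cV[int]_m :=
  \col_i (Some i == a)%:R.

(** Up to the signs of the rows, [M] is the incidence matrix of a graph whose
    vertices are the indices of the rows and [None], with the vertex [None]
    deleted. An integer vector lies in its image exactly when its coefficients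
    add up to 0 on every component that does not contain [None], and this
    condition has no torsion. *)
Lemma saturated_graph (m n : nat) (M : 'M[int]_(m, n)) (s : 'I_m -> int) :
  (forall i, s i * s i = 1) ->
  (forall l, exists a b : option 'I_m,
     forall i, s i * M i l = opt_delta a i 0 - opt_delta b i 0) ->
  saturated M.
Proof.
move=> ss Mab.
pose inM (x : 'cV[int]_m) := exists y, (\col_i (s i * x i 0)) = M *m y.
have inM0 : inM 0 by exists 0; rewrite mulmx0; apply/colP => i; rewrite !mxE mulr0.
have inMD x y : inM x -> inM y -> inM (x + y).
  move=> [x' xE] [y' yE]; exists (x' + y'); rewrite mulmxDr -xE -yE.
  by apply/colP => i; rewrite !mxE mulrDr.
have inMZ c x : inM x -> inM (c *: x).
  move=> [x' xE]; exists (c *: x'); rewrite -scalemxAr -xE.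
  by apply/colP => i; rewrite !mxE mulrCA.
pose e : rel (option 'I_m) := fun a b => `[< inM (opt_delta a - opt_delta b) >].
have e_sym : connect_sym e.
  apply: symmetric_from_pre => a b /connectP[p + ->].
  elim: p a => //= c p IH a /andP[/asboolP eac /IH lc].
  apply: (connect_trans lc); apply: connect1; apply/asboolP.
  by rewrite -opprB -scaleN1r; apply: inMZ.
have connect_inM a b : connect e a b -> inM (opt_delta a - opt_delta b).
  move=> /connectP[p + ->]; elim: p a => [|c p IH] a /=; first by rewrite subrr.
  by move=> /andP[/asboolP eac /IH ecp]; rewrite -(subrKA (opt_delta c)); apply: inMD.
(* On a component that avoids None the total weight of every column of M is 0,
   hence also that of x, as integers have no torsion. *)
pose w (x : 'cV[int]_m) (c : option 'I_m) := \sum_(i | connect e c (Some i)) x i 0.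
have wM l c : ~~ connect e c None -> w (\col_i (s i * M i l)) c = 0.
  move=> cN; have [a [b abE]] := Mab l; rewrite /w.
  under eq_bigr do rewrite mxE abE.
  have sumE a' : \sum_(i | connect e c (Some i)) opt_delta a' i 0
      = (connect e c a')%:R.
    case: a' => [a'|]; last first.
      by rewrite (negPf cN) big1 // => i _; rewrite mxE.
    rewrite big_mkcond (bigD1 a') //= big1 ?addr0 => [|i ia'].
      by rewrite mxE eqxx; case: connect.
    rewrite mxE; case: ifP => // _; case: eqP => // -[ia]; by rewrite ia eqxx in ia'.
  rewrite sumrB !sumE; suff -> : connect e c a = connect e c b by rewrite subrr.
  apply: same_connect_r => //; apply: connect1; apply/asboolP.
  exists (delta_mx l 0); rewrite -colE; apply/colP => i; rewrite !mxE.
  by have := abE i; rewrite !mxE => <-; rewrite mulrA ss mul1r.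
move=> x k k0 [y xy].
pose x' : 'cV[int]_m := \col_i (s i * x i 0).
suff : inM x'.
  move=> [z zE]; exists z; rewrite -zE; apply/colP => i.
  by rewrite !mxE mulrA ss mul1r.
have wx c : ~~ connect e c None -> w x' c = 0.
  move=> cN; have : w x' c *+ k = 0.
    rewrite -sumrMnl.
    have -> : \sum_(i | connect e c (Some i)) x' i 0 *+ k =
        \sum_(i | connect e c (Some i)) \sum_l y l 0 * (s i * M i l).
      apply: eq_bigr => i _; rewrite mxE -mulrnAr.
      have := congr1 (fun v : 'cV[int]_m => v i 0) xy; rewrite mulmxnE => ->.
      by rewrite mxE mulr_sumr; apply: eq_bigr => l _; ring.
    rewrite exchange_big big1 // => l _; rewrite -mulr_sumr.
    have := wM l c cN; rewrite /w; under eq_bigr do rewrite mxE.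
    by move->; rewrite mulr0.
  by move/eqP; rewrite mulrn_eq0 eqn0Ngt k0 => /eqP.
clearbody x'.
pose r (i : 'I_m) := opt_delta (fingraph.root e (Some i)).
rewrite -(subrK (\sum_i x' i 0 *: r i) x'); apply inMD.
  have -> : x' = \sum_i x' i 0 *: opt_delta (Some i).
    apply/colP => j; rewrite summxE (bigD1 j) //= big1 ?addr0 => [|i ij].
      by rewrite !mxE eqxx mulr1.
    rewrite !mxE; case: eqP => [[ji]|_]; last by rewrite mulr0n mulr0.
      by rewrite ji eqxx in ij.
  have -> : \sum_i (\sum_i0 x' i0 0 *: opt_delta (Some i0)) i 0 *: r i =
      \sum_i x' i 0 *: r i.
    apply: eq_bigr => j _; congr (_ *: _).
    rewrite summxE (bigD1 j) //= big1 ?addr0 => [|i ij].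
      by rewrite !mxE eqxx mulr1.
    rewrite !mxE; case: eqP => [[ji]|_]; last by rewrite mulr0n mulr0.
      by rewrite ji eqxx in ij.
  rewrite -sumrB; apply: (big_ind inM inM0 inMD) => i _; rewrite -scalerBr.
  by apply: inMZ; apply: connect_inM; exact: connect_root.
rewrite (partition_big (fun i => fingraph.root e (Some i)) predT) //=.
apply: (big_ind inM inM0 inMD) => c _.
under eq_bigr => i /eqP ic do rewrite /r ic.
rewrite -scaler_suml; have [cN|cN] := boolP (connect e c None).
  apply: inMZ; have <- : opt_delta c - opt_delta None = opt_delta c.
    by rewrite -[RHS]subr0; congr (_ - _); apply/colP => i; rewrite !mxE.
  exact: connect_inM.
have [i /eqP ic|noc] := pickP (fun i => fingraph.root e (Some i) == c); last first.
  by rewrite big_pred0 // scale0r.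
rewrite [X in X *: _](_ : _ = 0) ?scale0r //.
rewrite -[RHS](wx c cN); apply: eq_bigl => j; rewrite -ic root_connect //.
by rewrite -[in RHS](same_connect e_sym (connect_root e (Some i))) e_sym.
Qed.

(** * Direct limits *)

Lemma dirlim_iso (X Y : zmodType) (alpha : {additive X -> X})
    (beta : {additive Y -> Y}) (f : {additive X -> Y}) :
  bijective f -> (forall x, f (alpha x) = beta (f x)) ->
  zmod_iso (dirlim alpha) (dirlim beta).
Proof.
move=> [g fK gK] fab.
have iter_f k x : f (iter k alpha x) = iter k beta (f x).
  by elim: k => //= k <-; rewrite fab.
have g_iter k y : g (iter k beta y) = iter k alpha (g y).
  by apply: (can_inj fK); rewrite iter_f !gK.
have repr_pi (Z : zmodType) (c : {additive Z -> Z}) (u : nat * Z) :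
    exists k, iter (k + u.1) c (repr (\pi_(dirlim c) u)).2
            = iter (k + (repr (\pi_(dirlim c) u)).1) c u.2.
  have /eqP : \pi_(dirlim c) (repr (\pi_(dirlim c) u)) = \pi_(dirlim c) u.
    by rewrite reprK.
  by rewrite piE => /asboolP.
have eq_pi (Z : zmodType) (c : {additive Z -> Z}) (u v : nat * Z) k :
    iter (k + v.1) c u.2 = iter (k + u.1) c v.2 ->
    \pi_(dirlim c) u = \pi_(dirlim c) v.
  by move=> e; apply/eqP; rewrite piE; apply/asboolP; exists k.
have piS (Z : zmodType) (c : {additive Z -> Z}) (a : dirlim c) :
    exists u, a = \pi_(dirlim c) u by exists (repr a); rewrite reprK.
pose F (a : dirlim alpha) : dirlim beta := \pi_(dirlim beta) ((repr a).1, f (repr a).2).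
pose F' (a : dirlim beta) : dirlim alpha :=
  \pi_(dirlim alpha) ((repr a).1, g (repr a).2).
have F_pi (u : nat * X) : F (\pi_(dirlim alpha) u) = \pi_(dirlim beta) (u.1, f u.2).
  by have [k e] := repr_pi _ alpha u; apply: (eq_pi _ _ _ _ k) => /=; rewrite -!iter_f e.
have F'_pi (u : nat * Y) : F' (\pi_(dirlim beta) u) = \pi_(dirlim alpha) (u.1, g u.2).
  by have [k e] := repr_pi _ beta u; apply: (eq_pi _ _ _ _ k) => /=; rewrite -!g_iter e.
have FD : {morph F : x y / x + y}.
  move=> a b; have [u aE] := piS _ _ a; have [v bE] := piS _ _ b.
  transitivity (F (\pi_(dirlim alpha) (lim_add alpha u v))).
    by rewrite aE bE; congr F; exact: dirlimD_pi.
  transitivity (\pi_(dirlim beta) (lim_add beta (u.1, f u.2) (v.1, f v.2))).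
    by rewrite F_pi /lim_add /= raddfD !iter_f.
  by rewrite aE bE !F_pi; apply/esym; exact: dirlimD_pi.
have F0 : F 0 = 0.
  by apply: (addrI (F 0)); rewrite -FD !addr0.
pose Fm := GRing.isNmodMorphism.Build _ _ F (conj F0 FD).
pose FA : {additive dirlim alpha -> dirlim beta} := HB.pack F Fm.
exists FA; exists F' => a; have [u ->] := piS _ _ a; rewrite /=.
  by rewrite F_pi F'_pi /= fK -surjective_pairing.
by rewrite F'_pi F_pi /= gK -surjective_pairing.
Qed.


(** * Complexes with free homology *)

(** The columns of [G] are cycles whose classes form a basis of the homology
    ker D / im B, and the rows of [E] are the dual coordinates. Written with
    matrices, the condition can be transposed. *)
Definition split_homology (p n m q : nat) (D : 'M[int]_(p, n)) (B : 'M[int]_(n, m))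
    (G : 'M[int]_(n, q)) (E : 'M[int]_(q, n)) : Prop :=
  [/\ D *m G = 0, E *m B = 0, E *m G = 1%:M &
      forall x : 'cV[int]_n, D *m x = 0 -> exists z, x = G *m (E *m x) + B *m z].

(** With generalized inverses N of D and C of B, the matrix
    (1 - B C)(1 - N D) is an idempotent that kills im B and projects onto a
    complement of it in ker D. *)
Lemma split_homology_exists (p n m : nat) (D : 'M[int]_(p, n)) (B : 'M[int]_(n, m)) :
  D *m B = 0 -> saturated D -> saturated B ->
  exists q (G : 'M[int]_(n, q)) (E : 'M[int]_(q, n)), split_homology D B G E.
Proof.
move=> DB /saturated_pinv[N DN] /saturated_pinv[C BC].
pose e := (1%:M - B *m C) *m (1%:M - N *m D).
have NB : (1%:M - N *m D) *m B = B.
  by rewrite mulmxBl mul1mx -mulmxA DB mulmx0 subr0.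
have eB : e *m B = 0.
  by rewrite /e -mulmxA NB mulmxBl mul1mx BC subrr.
have D1 : D *m (1%:M - N *m D) = 0 by rewrite mulmxBr mulmx1 mulmxA DN subrr.
have De : D *m e = 0.
  rewrite /e mulmxA (_ : D *m (1%:M - B *m C) = D) //.
  by rewrite mulmxBr mulmx1 mulmxA DB mul0mx subr0.
have ee : e *m e = e.
  rewrite {2}/e mulmxA (_ : e *m (1%:M - B *m C) = e); last first.
    by rewrite mulmxBr mulmx1 mulmxA eB mul0mx subr0.
  have D2 : (1%:M - N *m D) *m (N *m D) = 0.
    by rewrite mulmxBl mul1mx -mulmxA (mulmxA D) DN subrr.
  by rewrite /e -mulmxA [in LHS]mulmxBr mulmx1 D2 subr0.
have [q [G [E [eE EG]]]] := idempotent_split ee.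
exists q, G, E; split=> //.
- by rewrite -[G]mulmx1 -EG (mulmxA G) -eE mulmxA De mul0mx.
- by rewrite -[E]mul1mx -EG -(mulmxA E) -eE -mulmxA eB mulmx0.
- move=> x Dx; exists (C *m x); rewrite mulmxA -eE /e -mulmxA.
  rewrite (_ : (1%:M - N *m D) *m x = x); last first.
    by rewrite mulmxBl mul1mx -mulmxA Dx mulmx0 subr0.
  by rewrite mulmxBl mul1mx -mulmxA subrK.
Qed.

(** The universal coefficient theorem, without its Ext term: a functional that
    vanishes on im B and on the columns of [G] vanishes on ker D, so it factors
    through D over the rationals, and over the integers since the cokernel of D
    is torsion free. *)
Lemma split_homology_tr (p n m q : nat) (D : 'M[int]_(p, n)) (B : 'M[int]_(n, m))
    (G : 'M[int]_(n, q)) (E : 'M[int]_(q, n)) :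
  saturated D -> split_homology D B G E -> split_homology B^T D^T E^T G^T.
Proof.
move=> /saturated_pinv[N DN] [DG EB EG sp]; split.
- by rewrite -trmx_mul EB trmx0.
- by rewrite -trmx_mul DG trmx0.
- by rewrite -trmx_mul EG trmx1.
move=> y By; exists (N^T *m (y - E^T *m (G^T *m y))).
set z := y - _.
rewrite (_ : D^T *m _ = z); first by rewrite addrC subrK.
rewrite mulmxA -[LHS]trmxK -[RHS]trmxK; congr (_^T); rewrite !trmx_mul !trmxK.
(* A functional that kills ker D is a rational combination of the rows of D, and
   an integral one by means of the generalized inverse N. *)
have zker (x : 'cV[int]_n) : D *m x = 0 -> z^T *m x = 0.
  move=> /sp[w xE]; have yB : y^T *m B = 0 by rewrite -[B]trmxK -trmx_mul By trmx0.
  rewrite /z linearB /= !trmx_mul !trmxK mulmxBl {1}xE mulmxDr (mulmxA _ B) yB.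
  by rewrite mul0mx addr0 !mulmxA subrr.
suff : z^T *m (1%:M - N *m D) = 0.
  by rewrite mulmxBr mulmx1 mulmxA => /subr0_eq <-.
apply/matrixP => i j.
have /(congr1 (fun v : 'cV_1 => v i 0)) : col j (z^T *m (1%:M - N *m D)) = 0.
  rewrite colE -mulmxA; apply: zker.
  by rewrite mulmxA mulmxBr mulmx1 mulmxA DN subrr mul0mx.
by rewrite [col _ _ _ _]mxE => ->; rewrite !mxE.
Qed.

Lemma split_homology_change (p n m q : nat) (D : 'M[int]_(p, n)) (B : 'M[int]_(n, m))
    (G : 'M[int]_(n, q)) (E : 'M[int]_(q, n)) (P P' : 'M[int]_q) :
  P' *m P = 1%:M -> P *m P' = 1%:M ->
  split_homology D B G E -> split_homology D B (G *m P) (P' *m E).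
Proof.
move=> P'P PP' [DG EB EG sp]; split.
- by rewrite mulmxA DG mul0mx.
- by rewrite -mulmxA EB mulmx0.
- by rewrite mulmxA -(mulmxA P') EG mulmx1 P'P.
- by move=> x /sp[z xE]; exists z; rewrite -!mulmxA (mulmxA P) PP' mul1mx.
Qed.

Section SplitHomology.
Variables (p n m q : nat) (D : 'M[int]_(p, n)) (B : 'M[int]_(n, m)).
Variables (G : 'M[int]_(n, q)) (E : 'M[int]_(q, n)).
Hypothesis sp : split_homology D B G E.

Lemma homology_eqP (z w : cycles D) :
  reflect (exists y, val z - val w = B *m y)
          (\pi_(homology D B) z == \pi_(homology D B) w).
Proof.
rewrite -idealrBE; apply: (iffP (asboolP _)) => -[y yE]; exists y.
  by rewrite -yE raddfB.
by rewrite raddfB.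
Qed.

Definition homology_class (c : 'cV[int]_q) : homology D B :=
  \pi_(homology D B) (insubd (0 : cycles D) (G *m c)).

(** The functional [E] vanishes on boundaries, so it does not matter which cycle
    represents the class. *)
Definition homology_coord (x : homology D B) : 'cV[int]_q := E *m val (repr x).

Lemma homology_coord_pi (z : cycles D) :
  homology_coord (\pi_(homology D B) z) = E *m val z.
Proof.
have /homology_eqP[y yE] : repr (\pi_(homology D B) z) == z %[mod homology D B].
  by rewrite reprK.
case: sp => _ EB _ _; apply/subr0_eq; rewrite /homology_coord -mulmxBr.
by rewrite (_ : _ - _ = B *m y) // mulmxA EB mul0mx.
Qed.

Lemma val_cycle (x : 'cV[int]_n) : D *m x = 0 -> val (insubd (0 : cycles D) x) = x.
Proof. by move=> Dx; rewrite insubdK // inE Dx. Qed.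

Lemma cycleP (z : cycles D) : D *m val z = 0.
Proof. exact/eqP/(valP z). Qed.

Lemma homology_classK : cancel homology_class homology_coord.
Proof.
case: (sp) => DG _ EG _ c; rewrite homology_coord_pi val_cycle.
  by rewrite mulmxA EG mul1mx.
by rewrite mulmxA DG mul0mx.
Qed.

Lemma homology_coordK : cancel homology_coord homology_class.
Proof.
case: (sp) => DG _ EG xE x; rewrite -[in RHS](reprK x); apply/eqP/homology_eqP.
rewrite val_cycle; last by rewrite mulmxA DG mul0mx.
have [z zE] := xE _ (cycleP (repr x)); exists (- z).
by rewrite [X in _ - X]zE opprD addrA subrr sub0r mulmxN.
Qed.

Lemma homology_coord_is_additive : zmod_morphism homology_coord.
Proof.
move=> x y; rewrite -[x]reprK -[y]reprK.
have -> : \pi_(homology D B) (repr x) - \pi_(homology D B) (repr y) =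
    \pi_(homology D B) (repr x - repr y) by rewrite [RHS]pi_is_zmod_morphism.
by rewrite !homology_coord_pi -mulmxBr; congr (_ *m _); exact: raddfB.
Qed.

HB.instance Definition _ := GRing.isZmodMorphism.Build (homology D B)
  'cV[int]_q homology_coord homology_coord_is_additive.

Lemma homology_coord_comb (b : 'I_q -> homology D B) (c : 'cV[int]_q) :
  homology_coord (\sum_i b i *~ c i 0) =
  (\matrix_(i, j) homology_coord (b j) i 0) *m c.
Proof.
rewrite raddf_sum /=; under eq_bigr do rewrite raddfMz /=.
apply/colP => i; rewrite summxE mxE; apply: eq_bigr => j _.
by rewrite -scaler_int !mxE intz mulrC.
Qed.

Lemma homology_iso : zmod_iso (homology D B) 'cV[int]_q.
Proof.
exists homology_coord; exact: Bijective homology_coordK homology_classK.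
Qed.

Variables (Up : 'M[int]_p) (Un : 'M[int]_n) (Um : 'M[int]_m).

(** The case distinction follows that of [homology_map]. *)
Definition homology_matrix : 'M[int]_q :=
  if `[< is_endo D B Up Un Um >] then E *m Un *m G else 0.

Lemma homology_coord_map (x : homology D B) :
  homology_coord (homology_map Up Un Um x) = homology_matrix *m homology_coord x.
Proof.
rewrite -[x]reprK /homology_matrix; have [endo|nendo] := asboolP _; last first.
  by rewrite /homology_map asboolF // raddf0 mul0mx.
rewrite homology_map_pi // !homology_coord_pi; case: endo => _ DU UB.
rewrite val_cycle; last by rewrite mulmxA DU -mulmxA cycleP mulmx0.
case: sp => _ EB _ /(_ _ (cycleP (repr x)))[z {1}->].
by rewrite !mulmxDr (mulmxA Un B) UB -(mulmxA B) (mulmxA E B) EB mul0mx addr0 !mulmxA.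
Qed.

Lemma homology_matrixP (b : 'I_q -> homology D B) :
  (forall j, homology_coord (b j) = delta_mx j 0) ->
  is_matrix_of b (homology_map Up Un Um) homology_matrix.
Proof.
move=> bE j; apply: (can_inj homology_coordK).
rewrite homology_coord_map bE raddf_sum /= -colE.
under eq_bigr do rewrite raddfMz /= bE.
apply/colP => i; rewrite summxE mxE (bigD1 i) //= big1 ?addr0.
  by rewrite -scaler_int !mxE !eqxx mulr1 intz.
by move=> k ki; rewrite -scaler_int !mxE eq_sym (negPf ki) mulr0.
Qed.

Lemma homology_dirlim :
  zmod_iso (dirlim (homology_map (A := D) (B := B) Up Un Um))
           (matrix_limit homology_matrix).
Proof.
apply: (@dirlim_iso _ _ _ _ homology_coord); last exact: homology_coord_map.
exact: Bijective homology_coordK homology_classK.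
Qed.

End SplitHomology.

(** This makes the conventions chosen in the definition of [homology_map]
    agree for a complex and its transpose. *)
Lemma is_endo_tr (p n m : nat) (D : 'M[int]_(p, n)) (B : 'M[int]_(n, m))
    (Up : 'M[int]_p) (Un : 'M[int]_n) (Um : 'M[int]_m) :
  is_endo D B Up Un Um -> is_endo B^T D^T Um^T Un^T Up^T.
Proof. by case=> DB DU UB; split; rewrite -!trmx_mul ?DB ?DU ?UB ?trmx0. Qed.

Lemma homology_matrix_tr (p n m q : nat) (D : 'M[int]_(p, n))
    (B : 'M[int]_(n, m)) (G : 'M[int]_(n, q)) (E : 'M[int]_(q, n))
    (Up : 'M[int]_p) (Un : 'M[int]_n) (Um : 'M[int]_m) :
  homology_matrix B^T D^T E^T G^T Um^T Un^T Up^T =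
  (homology_matrix D B G E Up Un Um)^T.
Proof.
rewrite /homology_matrix.
have -> : is_endo B^T D^T Um^T Un^T Up^T = is_endo D B Up Un Um.
  apply/propext; split; last exact: is_endo_tr.
  by move=> /is_endo_tr; rewrite !trmxK.
case: asboolP => _; last by rewrite trmx0.
by rewrite !trmx_mul !mulmxA.
Qed.

(** A basis of ker D / im B can be absorbed into the splitting, so that the map
    induced by [Un] has matrix E Un G in it. The transposed splitting gives the
    transposed matrix on the homology of the transposed complex. *)
Theorem split_homology_limits (p n m : nat) (D : 'M[int]_(p, n))
    (B : 'M[int]_(n, m)) (Up : 'M[int]_p) (Un : 'M[int]_n) (Um : 'M[int]_m) :
  D *m B = 0 -> saturated D -> saturated B ->
  exists q, zmod_iso (homology D B) 'cV[int]_q /\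
    forall b : 'I_q -> homology D B, is_basis b ->
    exists A : 'M[int]_q,
      [/\ is_matrix_of b (homology_map Up Un Um) A,
          zmod_iso (dirlim (homology_map (A := B^T) (B := D^T) Um^T Un^T Up^T))
                   (matrix_limit A^T) &
          zmod_iso (dirlim (homology_map (A := D) (B := B) Up Un Um))
                   (matrix_limit A)].
Proof.
move=> DB satD satB.
have [q [G [E sp]]] := split_homology_exists DB satD satB.
exists q; split; first exact: homology_iso sp.
move=> b [b' bK b'K].
pose P := \matrix_(i, j) homology_coord E (b j) i 0 : 'M[int]_q.
pose P' := \matrix_(i, j) b' (homology_class D B G (delta_mx j 0)) i 0 : 'M[int]_q.
have PP' : P *m P' = 1%:M.
  apply/matrixP => i j.
  have := homology_coord_comb sp b (b' (homology_class D B G (delta_mx j 0))).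
  rewrite b'K (homology_classK sp) -/P => /colP/(_ i) e.
  transitivity ((P *m b' (homology_class D B G (delta_mx j 0))) i 0).
    by rewrite !mxE; apply: eq_bigr => k _; rewrite [P' _ _]mxE.
  by rewrite -e !mxE andbT.
have P'P := mulmx1C PP'.
have sp' := split_homology_change P'P PP' sp.
exists (homology_matrix D B (G *m P) (P' *m E) Up Un Um); split.
- apply: homology_matrixP => // j.
  rewrite /homology_coord -mulmxA -[LHS]mul1mx.
  have -> : E *m val (repr (b j)) = col j P.
    by apply/colP => i; rewrite !mxE.
  by rewrite mul1mx colE mulmxA P'P mul1mx.
- by rewrite -homology_matrix_tr; apply: homology_dirlim; exact: split_homology_tr.
- exact: homology_dirlim.
Qed.

(** * Angles along paths *)

Lemma comp_continuous_within (U V W : topologicalType) (A : set U) (B : set V)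
    (g : U -> V) (f : V -> W) :
  (forall x, A x -> B (g x)) -> {within A, continuous g} ->
  {within B, continuous f} -> {within A, continuous (f \o g)}.
Proof.
move=> AB /subspace_continuousP cg /subspace_continuousP cf.
apply/subspace_continuousP => x Ax N fN /=.
have /= fB := cf _ (AB _ Ax) _ fN; have /= gA := cg _ Ax _ fB.
rewrite /nbhs /= /within /= in gA *; apply: filterS gA => y + Ay.
by move=> /(_ Ay); apply; exact: AB.
Qed.

Lemma itv_ccP (R : realType) (a b x : R) : `[a, b]%classic x <-> a <= x <= b.
Proof. by rewrite /= in_itv. Qed.

Lemma IVT_segment (R : realType) (f : R -> R) (a b v : R) :
  a <= b -> {within `[a, b], continuous f} ->
  f a <= v <= f b \/ f b <= v <= f a -> exists2 c, a <= c <= b & f c = v.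
Proof.
move=> ab cf vE; have [|c + cE] := @IVT R f a b v ab cf.
  rewrite ge_min le_max; by case: vE => /andP[-> ->]; rewrite ?orbT.
by rewrite in_itv /= => cab; exists c.
Qed.

Lemma itv_cc_sub (R : realType) (a b c e : R) : c <= a -> b <= e ->
  `[a, b]%classic `<=` `[c, e]%classic.
Proof. by move=> ca be t /itv_ccP t01; apply/itv_ccP; apply/andP; split; lra. Qed.

Lemma continuous_rev (R : realType) (U : topologicalType) (f : R -> U) :
  {within `[0, 1]%classic, continuous f} ->
  {within `[0, 1]%classic, continuous (fun t => f (1 - t))}.
Proof.
move=> cf; apply: (@comp_continuous_within R R U _ _ (fun t => 1 - t) f _ _ cf).
  by move=> t /itv_ccP t01; apply/itv_ccP; apply/andP; split; lra.
apply: continuous_subspaceT => t.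
by apply: (@cvgB _ R^o); [exact: cvg_cst|exact: cvg_id].
Qed.

Section Angles.
Variable R : realType.
Implicit Types (a b t u : R) (k : R -> R).

(** By the half-angle formula, sin (a / 2) = 0. *)
Lemma cos_eq1 a : cos a = 1 -> `|a| < 2 * pi -> a = 0.
Proof.
move=> ca; rewrite ltr_norml => /andP[a1 a2].
have s0 : sin (a / 2) = 0.
  have := cos2Dsin2 (a / 2); have := cosD (a / 2) (a / 2).
  rewrite -splitr ca -!expr2 => e1 e2; apply/eqP; rewrite -sqrf_eq0; apply/eqP; lra.
have [a0|a0|//] := ltgtP a 0.
  have : 0 < sin (- (a / 2)) by apply: sin_gt0_pi; apply/andP; split; lra.
  by rewrite sinN s0 oppr0 ltxx.
have : 0 < sin (a / 2) by apply: sin_gt0_pi; apply/andP; split; lra.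
by rewrite s0 ltxx.
Qed.

Lemma polar_angle_uniq (r r' a b : R) : 0 < r -> 0 < r' ->
  r * cos a = r' * cos b -> r * sin a = r' * sin b -> cos (a - b) = 1.
Proof.
move=> r0 r'0 ec es.
have rr : r = r'.
  have : r ^+ 2 = r' ^+ 2.
    rewrite -[LHS]mulr1 -[RHS]mulr1 -{1}(cos2Dsin2 a) -(cos2Dsin2 b) !mulrDr.
    by rewrite -!exprMn ec es.
  by move=> /eqP; rewrite eqrXn2 ?ltW // => /eqP.
have {}ec : cos a = cos b by apply: (mulfI (lt0r_neq0 r0)); rewrite ec rr.
have {}es : sin a = sin b by apply: (mulfI (lt0r_neq0 r0)); rewrite es rr.
by rewrite cosB ec es -!expr2 cos2Dsin2.
Qed.

Lemma polar_angle_near (r r' a b : R) : 0 < r -> 0 < r' ->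
  0 < r * cos a * (r' * cos b) + r * sin a * (r' * sin b) -> 0 < cos (a - b).
Proof.
move=> r0 r'0; rewrite cosB.
have -> : r * cos a * (r' * cos b) + r * sin a * (r' * sin b) =
  (r * r') * (cos a * cos b + sin a * sin b) by ring.
by rewrite pmulr_rgt0 // mulr_gt0.
Qed.

(** To change by pi, the angle would have to pass through the opposite
    direction. *)
Lemma angle_change_lt_pi a b k : a <= b -> {within `[a, b], continuous k} ->
  (forall t, a <= t <= b -> 0 < cos (k t)) -> `|k b - k a| < pi.
Proof.
move=> ab ck kpos; rewrite ltNge; apply/negP; rewrite ler_normr => kab.
have pi0 := pi_gt0 R.
have [ka|ka] : k a <= k a + pi <= k b \/ k b <= k a - pi <= k a.
  by case/orP: kab => h; [left|right]; apply/andP; split; lra.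
- have [//|c cab cE] := IVT_segment ab ck (v := k a + pi); first by left.
  have := kpos c cab; have := kpos a; rewrite cE cosDpi lexx ab => /(_ isT); lra.
- have [//|c cab cE] := IVT_segment ab ck (v := k a - pi); first by right.
  have := kpos c cab; have := kpos a; rewrite lexx ab => /(_ isT).
  have -> : cos (k a) = - cos (k c) by rewrite -cosDpi cE subrK.
  by move=> h1 h2; lra.
Qed.

Lemma angle_const a b k : a <= b -> {within `[a, b], continuous k} ->
  (forall t, a <= t <= b -> cos (k t) = 1) -> k b = k a.
Proof.
move=> ab ck k1.
have := angle_change_lt_pi ab ck; rewrite ltr_norml => kab.
apply/subr0_eq/cos_eq1.
  have h t : cos (k t) = 1 -> sin (k t) = 0.
    move=> e; have := cos2Dsin2 (k t); rewrite e expr1n => e2.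
    by apply/eqP; rewrite -sqrf_eq0; apply/eqP; lra.
  have e1 := k1 a; have e2 := k1 b; rewrite !lexx ab /= in e1 e2.
  by rewrite cosB e1 // e2 // (h a) ?e1 // (h b) ?e2 // mul1r mul0r addr0.
rewrite ltr_norml; have := pi_gt0 R.
have /andP[] : - pi < k b - k a < pi by apply: kab => t /k1->; exact: ltr01.
move=> *; apply/andP; split; lra.
Qed.

End Angles.

Section PathAngles.
Variables (R : realType) (d : nat).
Implicit Types (gamma : R -> 'rV[R]_d) (p : 'rV[R]_d) (theta : R -> R) (t u a b : R).

(** [theta] is a continuous choice of the argument of [gamma] seen from [p];
    unlike [has_winding], it keeps the function, so that the changes of angle
    along parts of the path can be compared. *)
Definition angle_lift gamma p theta : Prop :=
  {within `[0, 1]%classic, continuous theta} /\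
  forall t, 0 <= t <= 1 -> exists r : R,
    [/\ 0 < r, crd (gamma t) 0 - crd p 0 = r * cos (theta t) &
        crd (gamma t) 1 - crd p 1 = r * sin (theta t)].

Lemma has_winding_lift gamma p w : has_winding gamma p w ->
  exists2 theta, angle_lift gamma p theta & theta 1 - theta 0 = 2 * pi * w.
Proof.
move=> [theta [rho [ct h e]]]; exists theta; last by rewrite e; ring.
split=> // t /h[r0 -> ->]; exists (rho t); split=> //; ring.
Qed.

(** Two lifts of the same direction differ by a continuous multiple of 2 pi,
    which is constant. *)
Lemma angle_lift_reparam gamma gamma' p theta theta' (g : R -> R) a b :
  0 <= a -> a <= b -> b <= 1 -> {within `[a, b], continuous g} ->
  (forall t, a <= t <= b -> 0 <= g t <= 1 /\ gamma' t = gamma (g t)) ->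
  angle_lift gamma p theta -> angle_lift gamma' p theta' ->
  theta' b - theta' a = theta (g b) - theta (g a).
Proof.
move=> a0 ab b1 cg gE [ct th] [ct' th'].
suff : theta' b - theta (g b) = theta' a - theta (g a) by lra.
apply: (angle_const (k := fun t => theta' t - theta (g t)) ab).
  apply: (@within_continuousB _ _ R^o).
    apply: continuous_subspaceW ct' => t /itv_ccP tab; apply/itv_ccP.
    by apply/andP; split; lra.
  apply: comp_continuous_within cg ct => t /itv_ccP/gE[g01 _]; exact/itv_ccP.
move=> t tab; have [g01 e] := gE t tab.
have [|r' [r'0 c' s']] := th' t; first by apply/andP; split; lra.
have [r [r0 c s]] := th _ g01; rewrite e in c' s'.
by apply: (polar_angle_uniq r'0 r0); rewrite -?c' -?s'.
Qed.

(** The hypothesis says that [p] and [q] are always seen from the path at an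
    acute angle, so the two arguments stay within pi / 2 modulo 2 pi. *)
Lemma angle_change_close gamma p q theta theta' a b :
  0 <= a -> a <= b -> b <= 1 ->
  (forall t, a <= t <= b ->
     0 < (crd (gamma t) 0 - crd p 0) * (crd (gamma t) 0 - crd q 0) +
         (crd (gamma t) 1 - crd p 1) * (crd (gamma t) 1 - crd q 1)) ->
  angle_lift gamma p theta -> angle_lift gamma q theta' ->
  `|(theta b - theta a) - (theta' b - theta' a)| < pi.
Proof.
move=> a0 ab b1 pos [ct th] [ct' th'].
have -> : (theta b - theta a) - (theta' b - theta' a) =
  (theta b - theta' b) - (theta a - theta' a) by ring.
apply: (angle_change_lt_pi (k := fun t => theta t - theta' t) ab).
  have ab01 : `[a, b]%classic `<=` `[0, 1]%classic.
    by move=> t /itv_ccP tab; apply/itv_ccP; apply/andP; split; lra.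
  by apply: (@within_continuousB _ _ R^o); exact: continuous_subspaceW ab01 _.
move=> t tab; have t01 : 0 <= t <= 1 by apply/andP; split; lra.
have [[r [r0 c s]] [r' [r'0 c' s']]] := (th t t01, th' t t01).
by have := pos t tab; rewrite c c' s s'; apply: polar_angle_near.
Qed.

End PathAngles.

(** * Simple closed curves *)

Section SimpleClosedCurves.
Variables (R : realType) (U : topologicalType).
Hypothesis hU : hausdorff_space U.
Implicit Types (gamma : R -> U) (B : set U) (a b c s t u : R).

(** [gamma] is a closed map on the segment, by compactness; the injectivity is
    required only at the values of [g], so that [g] may avoid the base point of
    a closed curve. *)
Lemma path_inverse_continuous (V : topologicalType) (A : set V) gamma
    (g : V -> R) a b :
  {within `[a, b]%classic, continuous gamma} ->
  (forall x, A x -> a <= g x <= b) ->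
  (forall x s, A x -> a <= s <= b -> gamma s = gamma (g x) -> s = g x) ->
  {within A, continuous (gamma \o g)} -> {within A, continuous g}.
Proof.
move=> cgamma gab inj cgg; apply/continuous_closedP => C Ccl.
set D := gamma @` (`[a, b]%classic `&` C).
have Dcl : closed D.
  apply: compact_closed => //; apply: continuous_compact.
    by apply: continuous_subspaceW cgamma; exact: subIsetl.
  by apply: compact_closedI => //; exact: segment_compact.
have := proj1 (continuous_closedP _) cgg D Dcl.
move=> /closed_subspaceP[W Wcl WE].
apply/closed_subspaceP; exists W => //; rewrite WE.
apply/seteqP; split=> x [h Ax]; split=> //=.
- by case: h => [s [/itv_ccP sab Cs] sE]; exact: (eq_ind _ C Cs _ (inj _ _ Ax sab sE)).
- by exists (g x) => //; split=> //; apply/itv_ccP/gab.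
Qed.

Definition jordan gamma B : Prop :=
  [/\ {within `[0, 1]%classic, continuous gamma}, gamma 0 = gamma 1,
      (forall u v, 0 <= u < 1 -> 0 <= v < 1 -> gamma u = gamma v -> u = v) &
      gamma @` `[0, 1]%classic = B].

Lemma jordan_inj gamma B : jordan gamma B -> forall u v,
  0 <= u <= 1 -> 0 < v < 1 -> gamma u = gamma v -> u = v.
Proof.
move=> [_ g01 inj _] u v /andP[u0]; rewrite le_eqVlt => /orP[/eqP->|u1] /andP[v0 v1].
  rewrite -g01 => /inj e; have := v0; rewrite -e ?ltxx //; last by rewrite ltW.
  by rewrite lexx ltr01.
by move=> /inj -> //; rewrite ?u0 // ltW.
Qed.

Lemma jordan_mem gamma B t : jordan gamma B -> 0 <= t <= 1 -> B (gamma t).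
Proof. by move=> [_ _ _ <-] t01; exists t => //; exact/itv_ccP. Qed.

Lemma jordan_memP gamma B x : jordan gamma B -> B x ->
  exists2 t, 0 <= t < 1 & gamma t = x.
Proof.
move=> [_ g01 _ <-] [t /itv_ccP/andP[t0]]; rewrite le_eqVlt => /orP[/eqP-> <-|t1 <-].
  by exists 0 => //; rewrite lexx ltr01.
by exists t => //; rewrite t0.
Qed.

Lemma jordan_rev gamma B : jordan gamma B -> jordan (fun t => gamma (1 - t)) B.
Proof.
move=> [cg g01 inj <-]; split.
- exact: continuous_rev.
- by rewrite subr0 subrr.
- have inj' u v : 0 <= u < 1 -> 0 <= v < 1 -> gamma (1 - u) = gamma (1 - v) ->
      u <= v.
    move=> u01 v01; have [->|v0] := eqVneq v 0.
      rewrite subr0 -g01; have [->//|u0] := eqVneq u 0.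
      move=> /inj; rewrite lexx ltr01 => e.
      have : 1 - u = 0 by apply: e => //; apply/andP; split; lra.
      by lra.
    have [->|u0] := eqVneq u 0; first by lra.
    move=> /inj e; have : 1 - u = 1 - v by apply: e; apply/andP; split; lra.
    by lra.
  by move=> u v u01 v01 e; apply/le_anti/andP; split; exact: inj'.
- apply/seteqP; split=> x [t /itv_ccP t01 <-].
    by exists (1 - t) => //; apply/itv_ccP; apply/andP; split; lra.
  exists (1 - t); last by congr gamma; ring.
  by apply/itv_ccP; apply/andP; split; lra.
Qed.

Definition rotate gamma c t : U :=
  if t + c <= 1 then gamma (t + c) else gamma (t + c - 1).

End SimpleClosedCurves.

(** The second function [f'] allows for lifts of the angle, which jump when the
    curve passes through its starting point. *)
Lemma rotate_continuous (R : realType) (U : topologicalType) (f f' : R -> U) (c : R) :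
  0 < c < 1 -> {within `[0, 1]%classic, continuous f} ->
  {within `[0, 1]%classic, continuous f'} -> f 1 = f' 0 ->
  {within `[0, 1]%classic,
     continuous (fun t => if t + c <= 1 then f (t + c) else f' (t + c - 1))}.
Proof.
move=> c01 cf cf' ff'.
have -> : `[0, 1]%classic = `[0, 1 - c]%classic `|` `[1 - c, 1]%classic :> set R.
  apply/seteqP; split=> t /=; rewrite !in_itv /= => h.
    by have [/=|] := leP t (1 - c); [left|right]; rewrite ?in_itv /=; apply/andP; split; lra.
  by case: h => /andP[]; rewrite ?in_itv /= => *; apply/andP; split; lra.
apply: withinU_continuous; try exact: interval_closed.
- apply: subspace_eq_continuous (_ : {within _, continuous (f \o (fun t => t + c))}).
    move=> t; rewrite inE /from_subspace /= in_itv /= => /andP[t0 t1].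
     by rewrite ifT //; lra.
  apply: (@comp_continuous_within R R U _ _ (fun t => t + c) _ _ _ cf)
    => [t /itv_ccP/andP[t0 t1]|].
    by apply/itv_ccP; apply/andP; split; lra.
  apply: continuous_subspaceT => t.
  by apply: (@cvgD _ R^o); [exact: cvg_id|exact: cvg_cst].
- apply: subspace_eq_continuous (_ : {within _, continuous (f' \o (fun t => t + (c - 1)))}).
    move=> t; rewrite inE /from_subspace /= in_itv /= => /andP[t0 t1].
    case: ifP => tc; rewrite addrA //.
    by rewrite (_ : t + c = 1) ?subrr ?ff' //; lra.
  apply: (@comp_continuous_within R R U _ _ (fun t => t + (c - 1)) _ _ _ cf')
    => [t /itv_ccP/andP[t0 t1]|].
    by apply/itv_ccP; apply/andP; split; lra.
  apply: continuous_subspaceT => t.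
  by apply: (@cvgD _ R^o); [exact: cvg_id|exact: cvg_cst].
Qed.

Section Reparametrization.
Variables (R : realType) (U : topologicalType).
Hypothesis hU : hausdorff_space U.
Implicit Types (gamma : R -> U) (B : set U) (a b c s t u : R).

Lemma jordan_inj_oc gamma B : jordan gamma B -> forall u v,
  0 < u <= 1 -> 0 < v <= 1 -> gamma u = gamma v -> u = v.
Proof.
move=> J u v /andP[u0 u1] /andP[v0 v1] e; have [v1'|v1'] := ltP v 1.
  by apply: (jordan_inj J) e => //; rewrite ?u1 ?v0 ?ltW.
have {v1 v1'} v1 : v = 1 by lra.
have [u1'|] := ltP u 1; last by lra.
by apply/esym; apply: (jordan_inj J) (esym e); rewrite ?v1 ?u0 ?ler01 ?lexx.
Qed.

Lemma jordan_rotate gamma B c : 0 < c < 1 -> jordan gamma B ->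
  jordan (rotate gamma c) B.
Proof.
move=> c01 J; have [cg g01 inj gB] := J; split.
- exact: rotate_continuous.
- by rewrite /rotate add0r ifT ?ifF; [congr gamma; lra| apply/negbTE; lra|lra].
- move=> u v u01 v01; rewrite /rotate.
  case: leP => u1; case: leP => v1 /(jordan_inj_oc J) e;
    by move: (e ltac:(apply/andP; split; lra) ltac:(apply/andP; split; lra)); lra.
- apply/seteqP; split=> x.
    move=> [t /itv_ccP t01 <-]; rewrite /rotate; case: leP => t1;
    by apply: (jordan_mem J); apply/andP; split; lra.
  move=> /(jordan_memP J)[s s01 <-]; have [sc|sc] := leP c s.
    exists (s - c); first by apply/itv_ccP; apply/andP; split; lra.
    by rewrite /rotate ifT ?subrK //; lra.
  exists (s + 1 - c); first by apply/itv_ccP; apply/andP; split; lra.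
  rewrite /rotate subrK; case: leP => s1; last by congr gamma; lra.
  by rewrite (_ : s = 0) ?add0r // ; lra.
Qed.

Definition increasing_reparam (g : R -> R) : Prop :=
  [/\ {within `[0, 1]%classic, continuous g}, g 0 = 0, g 1 = 1 &
      forall s t, 0 <= s <= 1 -> 0 <= t <= 1 -> s < t -> g s < g t].

(** The missing values at 0 and 1 are forced, and an increasing surjection of a
    segment is continuous. *)
Lemma increasing_reparamP gamma gamma' B (g : R -> R) :
  jordan gamma B -> jordan gamma' B -> gamma 0 = gamma' 0 ->
  (forall t, 0 < t < 1 -> 0 < g t < 1 /\ gamma (g t) = gamma' t) ->
  (forall s t, 0 < s < 1 -> 0 < t < 1 -> s < t -> g s < g t) ->
  exists g', increasing_reparam g' /\
    forall t, 0 <= t <= 1 -> gamma' t = gamma (g' t).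
Proof.
move=> J J' e0 gE gmono.
pose g' t := if t <= 0 then 0 else if 1 <= t then 1 else g t.
have g'0 : g' 0 = 0 by rewrite /g' lexx.
have g'1 : g' 1 = 1 by rewrite /g' lexx ifF // ler10.
have g'i t : 0 < t < 1 -> g' t = g t.
  by move=> t01; rewrite /g' !ifF //; apply/negbTE; lra.
have g'E t : 0 <= t <= 1 -> gamma' t = gamma (g' t).
  move=> t01; have [t0|t0] := leP t 0.
    by rewrite (_ : t = 0) ?g'0 //; lra.
  have [t1|t1] := leP 1 t.
    have -> : t = 1 by lra.
    by have [_ e _ _] := J; have [_ e' _ _] := J'; rewrite g'1 -e -e'.
  by rewrite g'i ?(proj2 (gE _ _)) // t0 t1.
have g'01 t : 0 <= t <= 1 -> 0 <= g' t <= 1.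
  move=> t01; have [->|t0] := eqVneq t 0; first by rewrite g'0 lexx ler01.
  have [->|t1] := eqVneq t 1; first by rewrite g'1 lexx ler01.
  have t01' : 0 < t < 1 by apply/andP; split; lra.
  by rewrite g'i //; have [/andP[/ltW-> /ltW->]] := gE _ t01'.
have g'mono s t : 0 <= s <= 1 -> 0 <= t <= 1 -> s < t -> g' s < g' t.
  move=> s01 t01 st; have [s0|s0] := eqVneq s 0; have [t1|t1] := eqVneq t 1.
  - by rewrite s0 t1 g'0 g'1.
  - rewrite s0 g'0 g'i; last by apply/andP; split; lra.
    by have [|/andP[]] := gE t; first by apply/andP; split; lra.
  - rewrite t1 g'1 g'i; last by apply/andP; split; lra.
    by have [|/andP[]] := gE s; first by apply/andP; split; lra.
  - by rewrite !g'i; [apply: gmono => //|..]; apply/andP; split; lra.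
exists g'; split=> //; split=> //.
apply: segment_inc_surj_continuous.
  apply: le_mono_in => s t; rewrite !in_itv /= => s01 t01; exact: g'mono.
move=> y; rewrite g'0 g'1 /= in_itv /= => y01.
have [y0|y0] := eqVneq y 0.
  by exists 0; rewrite ?g'0 //= in_itv /= lexx ler01.
have [y1|y1] := eqVneq y 1.
  by exists 1; rewrite ?g'1 //= in_itv /= lexx ler01.
have [t t01 tE] := jordan_memP J' (jordan_mem J y01).
exists t; first by rewrite /= in_itv /=; apply/andP; split; lra.
have t01' : 0 <= t <= 1 by apply/andP; split; lra.
apply: (jordan_inj J); rewrite -?g'E // ?g'01 //.
by apply/andP; split; lra.
Qed.

(** Away from the base point, the transition function between the two
    parametrizations is continuous and injective on an open interval, hence
    monotone. In the decreasing case one of the curves is reversed. *)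
Lemma jordan_reparam gamma gamma' B :
  jordan gamma B -> jordan gamma' B -> gamma 0 = gamma' 0 ->
  exists g, increasing_reparam g /\
    ((forall t, 0 <= t <= 1 -> gamma' t = gamma (g t)) \/
     (forall t, 0 <= t <= 1 -> gamma' (1 - t) = gamma (g t))).
Proof.
move=> J J' e0.
have ex t : 0 < t < 1 -> exists s, 0 < s < 1 /\ gamma s = gamma' t.
  move=> t01; have t01' : 0 <= t <= 1 by apply/andP; split; lra.
  have [s s01 sE] := jordan_memP J (jordan_mem J' t01').
  exists s; split=> //; apply/andP; split; last by lra.
  rewrite lt_neqAle; apply/andP; split; last by lra.
  apply/eqP => s0; move: sE; rewrite -s0 e0 => /(jordan_inj J').
  by rewrite lexx ler01 => /(_ isT t01) t0; move: t01; rewrite -t0 ltxx.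
have [g gE] : exists g, forall t, 0 < t < 1 -> 0 < g t < 1 /\ gamma (g t) = gamma' t.
  pose P t := [set s | 0 < s < 1 /\ gamma s = gamma' t].
  exists (fun t => xget 0 (P t)) => t /ex ext; exact: (@xgetPex _ 0 (P t) ext).
have ginj : {in `]0, 1[ &, injective g}.
  move=> s t; rewrite !in_itv /= => s01 t01 e.
  have [[_ es] [_ et]] := (gE s s01, gE t t01).
  apply: (jordan_inj J'); rewrite -?es -?et ?e //; apply/andP; split; lra.
have gcont : {within `]0, 1[%classic, continuous g}.
  have [cg _ _ _] := J; have [cg' _ _ _] := J'.
  apply: (path_inverse_continuous hU cg).
  - by move=> t; rewrite /= in_itv /= => /gE[g01 _]; apply/andP; split; lra.
  - move=> t s; rewrite /= in_itv /= => /gE[g01 _] s01; exact: (jordan_inj J).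
  - apply: (@subspace_eq_continuous _ _ _ gamma').
      by move=> t; rewrite inE /from_subspace /= in_itv /= => /gE[_ ->].
    apply: continuous_subspaceW cg'; exact: subset_itv_oo_cc.
have [gm|gm] := itv_continuous_inj_mono gcont ginj.
  have [|g' [g'inc g'E]] := increasing_reparamP J J' e0 gE.
    by move=> s t s01 t01 st; rewrite gm ?in_itv.
  by exists g'; split=> //; left.
have [|||g' [g'inc g'E]] := @increasing_reparamP gamma (fun t => gamma' (1 - t)) B
   (fun t => g (1 - t)) J (jordan_rev J').
- by rewrite subr0 e0; have [_ -> _ _] := J'.
- by move=> t t01; apply: gE; apply/andP; split; lra.
- by move=> s t s01 t01 st; apply: gm; rewrite ?in_itv /=; try (apply/andP; split); lra.
by exists g'; split=> //; right.
Qed.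

Lemma rotate_start gamma c : 0 < c < 1 -> rotate gamma c 0 = gamma c.
Proof. by move=> c01; rewrite /rotate add0r ifT //; lra. Qed.

Lemma jordan_start gamma B x : jordan gamma B -> B x ->
  exists2 gamma' : R -> U, jordan gamma' B & gamma' 0 = x.
Proof.
move=> J /(jordan_memP J)[c c01 <-]; have [->|c0] := eqVneq c 0; first by exists gamma.
have {}c01 : 0 < c < 1 by apply/andP; split; lra.
by exists (rotate gamma c); [exact: jordan_rotate|exact: rotate_start].
Qed.

(** If a point of [B] is missed, take it as base point: the smaller curve then
    yields a continuous function on a segment that is injective up to the
    identification of the ends, against the intermediate value theorem. *)
Lemma jordan_subset gamma gamma' B B' :
  jordan gamma B -> jordan gamma' B' -> B' `<=` B -> B' = B.
Proof.
move=> J J' B'B; apply/seteqP; split=> // x Bx; apply: contrapT => B'x.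
have [{J}gamma J x0] := jordan_start J Bx.
pose P t := [set s | 0 < s < 1 /\ gamma s = gamma' t].
pose g t := xget 0 (P t).
have gE t : 0 <= t <= 1 -> 0 < g t < 1 /\ gamma (g t) = gamma' t.
  move=> t01; have B't := jordan_mem J' t01.
  have [s s01 sE] := jordan_memP J (B'B _ B't).
  apply: (@xgetPex _ 0 (P t)); exists s; split=> //; apply/andP; split; last by lra.
  rewrite lt_neqAle; apply/andP; split; last by lra.
  by apply/negP => /eqP s0; apply: B'x; rewrite -x0 s0 sE.
have cg : {within `[0, 1]%classic, continuous g}.
  have [cgamma _ _ _] := J; have [cg' _ _ _] := J'.
  apply: (path_inverse_continuous hU cgamma).
  - by move=> t /itv_ccP/gE[g01 _]; apply/andP; split; lra.
  - by move=> t s /itv_ccP/gE[g01 _] s01; exact: (jordan_inj J).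
  - apply: (@subspace_eq_continuous _ _ _ gamma') cg'.
    by move=> t; rewrite inE /from_subspace => /itv_ccP/gE[_ /= ->].
have g01 : g 1 = g 0.
  have [/gE[g1 e1] /gE[g0 e0]] : 0 <= (1 : R) <= 1 /\ 0 <= (0 : R) <= 1.
    by rewrite !lexx ler01.
  apply: (jordan_inj J) => //; first by apply/andP; split; lra.
  by rewrite e1 e0; have [_ -> _ _] := J'.
have ginj s t : 0 <= s <= 1 -> 0 < t < 1 -> g s = g t -> s = t.
  move=> s01 t01 e; apply: (jordan_inj J') => //.
  have [_ <-] := gE s s01; rewrite e; have [|_ <-//] := gE t.
  by apply/andP; split; lra.
have h01 : 0 < (2^-1 : R) < 1 by apply/andP; split; lra.
have g0h : g 0 <> g 2^-1 by move=> /ginj; rewrite lexx ler01 => /(_ isT h01); lra.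
have := g0h; set v := (g 0 + g 2^-1) / 2 => _.
have [c1 c1E gc1] : exists2 c, 0 <= c <= 2^-1 & g c = v.
  apply: IVT_segment; first by lra.
    by apply: continuous_subspaceW cg; apply: itv_cc_sub; lra.
  by rewrite /v; have [?|?] := leP (g 0) (g 2^-1); [left|right]; apply/andP; split; lra.
have [c2 c2E gc2] : exists2 c, 2^-1 <= c <= 1 & g c = v.
  apply: IVT_segment; first by lra.
    by apply: continuous_subspaceW cg; apply: itv_cc_sub; lra.
  rewrite g01 /v; have [?|?] := leP (g 0) (g 2^-1); [right|left]; apply/andP; split; lra.
have c1h : c1 != 2^-1 by apply/negP => /eqP e; move: gc1; rewrite e /v; lra.
have c10 : c1 != 0 by apply/negP => /eqP e; move: gc1; rewrite e /v; lra.
have : c2 = c1.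
  by apply: ginj; rewrite ?gc1 ?gc2 //; apply/andP; split; lra.
lra.
Qed.

End Reparametrization.

(** * Cells of a CW-structure *)

Lemma rV_hausdorff (R : realType) (n : nat) : hausdorff_space 'rV[R]_n.
Proof. exact: norm_hausdorff. Qed.

Section Cells.
Variables (R : realType) (d : nat).
Implicit Types (K : nat -> set (set 'rV[R]_d)) (s t e f X : set 'rV[R]_d).
Implicit Types (x y v p : 'rV[R]_d).

(** Shrinking moves a point of the disk off the sphere. *)
Lemma unit_disk_scale k (w : 'rV[R]_k) (r : R) : unit_disk w -> 0 <= r < 1 ->
  unit_disk (r *: w) /\ ~ unit_sphere (r *: w).
Proof.
rewrite /unit_disk /unit_sphere /= => w1 r01.
have -> : \sum_i (r *: w) 0 i ^+ 2 = r ^+ 2 * \sum_i w 0 i ^+ 2.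
  by rewrite mulr_sumr; apply: eq_bigr => i _; rewrite mxE exprMn.
have s0 : 0 <= \sum_i w 0 i ^+ 2 by apply: sumr_ge0 => i _; exact: sqr_ge0.
have r2 : r ^+ 2 < 1 by rewrite expr_lt1 //; lra.
have : r ^+ 2 * \sum_i w 0 i ^+ 2 <= r ^+ 2 by rewrite ler_piMr // sqr_ge0.
by split; lra.
Qed.

Lemma vertex_singleton K X s : is_CW K X -> K 0 s -> exists v, s = [set v].
Proof.
move=> [_ hK _ _ _] /hK[phi [[g [_ _ phiP gP]] _]].
exists (phi 0); apply/seteqP; split=> [y /gP[_ <-]|_ ->].
  by congr phi; apply/rowP => -[].
by have [|//] := phiP 0; rewrite /unit_disk /= big_ord0 ler01.
Qed.

Lemma skeleton1P K X x : is_CW K X -> skeleton K 1 x <-> K 0 [set x].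
Proof.
move=> CW; split=> [[j /= + [s Ks sx]]|Kx].
  rewrite ltnS leqn0 => /eqP j0; rewrite j0 in Ks.
  by have [v sE] := vertex_singleton CW Ks; move: sx Ks; rewrite sE => ->.
by exists 0%N => //; exists [set x].
Qed.

Lemma vertex_skeleton K k x : (0 < k)%N -> K 0 [set x] -> skeleton K k x.
Proof. by move=> k0 Kx; exists 0%N => //; exists [set x]. Qed.

Lemma cell_interior_eq K X k s t x : is_CW K X -> K k s -> K k t ->
  s x -> t x -> ~ skeleton K k x -> s = t.
Proof. by move=> [_ _ hK _ _] Ks Kt sx tx Kx; have [|//] := hK _ _ _ _ Ks Kt; exists x. Qed.

(** Radial shrinking in the disk approaches every point of the cell by points
    that are not on the sphere. *)
Lemma cell_interior_dense K X k s x : is_CW K X -> K k s -> s x ->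
  closure (cell_interior K k s) x.
Proof.
move=> [_ hK _ _ _] /hK[phi [[g [cphi _ phiP gP]] phiS]] sx N Nx.
have [gx phigx] := gP x sx.
have /subspace_continuousP/(_ 1) :
    {within `[0, 1]%classic, continuous (phi \o (fun r : R => r *: g x))}.
  apply: comp_continuous_within cphi.
    move=> r /itv_ccP r01; have [->|r1] := eqVneq r 1; first by rewrite scale1r.
    by apply: (proj1 (unit_disk_scale gx _)); apply/andP; split; lra.
  apply: continuous_subspaceT => r; apply: cvgZr_tmp; exact: cvg_id.
rewrite /from_subspace /= in_itv /= lexx ler01 scale1r phigx => /(_ isT N Nx).
rewrite /nbhs /= /within /= => /nbhs_ballP[e /= e0 eN].
pose r := Num.max 0 (1 - e / 2).
have r01 : 0 <= r < 1 by rewrite /r le_max lexx /= gt_max; apply/andP; split; lra.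
exists (phi (r *: g x)); split; last first.
  apply: eN; last by rewrite /= in_itv /=; apply/andP; split; lra.
  have re : 1 - e / 2 <= r by rewrite /r le_max lexx orbT.
  by rewrite /= ger0_norm; lra.
have [Dr Sr] := unit_disk_scale gx r01.
have [sr phir] := phiP _ Dr.
split=> // Kr; have : cell_boundary K k s (phi (r *: g x)) by [].
rewrite -phiS => -[w Sw]; have [|_ phiw] := phiP w.
  by move: Sw; rewrite /unit_sphere /unit_disk /= => ->.
by move=> /(congr1 g); rewrite phiw phir => wE; apply: Sr; rewrite -wE.
Qed.

Lemma cell_interior_neq0 K X k s : is_CW K X -> K k s ->
  exists x, s x /\ ~ skeleton K k x.
Proof.
move=> CW Ks; have [_ hK _ _ _] := CW.
have [phi [[g [_ _ phiP _]] _]] := hK _ _ Ks.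
have [|s0 _] := phiP 0.
  by rewrite /unit_disk /= big1 ?ler01 // => i _; rewrite mxE expr0n.
have [x [[sx Kx] _]] := cell_interior_dense CW Ks s0 (filterT (F := nbhs (phi 0))).
by exists x.
Qed.

(** Otherwise choose points in the interiors of infinitely many cells through
    [v], converging to [v]. By closure-finiteness each cell contains finitely
    many of them, so they form a closed set in the weak topology, and [v] would
    be one of them; but a vertex is not interior to a cell of positive
    dimension. *)
Lemma locally_finite K k v : is_CW K setT -> (0 < k)%N -> K 0 [set v] ->
  finite_set [set s | K k s /\ s v].
Proof.
move=> CW k0 Kv; apply: contrapT => /infiniteP/pcard_leP[f].
have fE n : K k (f n) /\ f n v by have := @funS _ _ _ _ f n I.
have ex n : exists x, cell_interior K k (f n) x /\ `|v - x| < harmonic n.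
  have [Kf fv] := fE n.
  have hn : 0 < harmonic n :> R by exact: harmonic_gt0.
  have [x [sx vx]] := cell_interior_dense CW Kf fv (nbhsx_ballx v _ hn).
  by exists x; split=> //; move: vx; rewrite -ball_normE.
have [x xE] := choice ex.
have Acl : closed (range x).
  have [_ _ _ fin weak] := CW; apply: weak => // j c Kc.
  apply: (proj1 accessible_finite_set_closed (hausdorff_accessible (@rV_hausdorff R d))).
  apply: (@sub_finite_set _ _ (x @` (f @^-1`
     [set t | exists2 j, K j t & cell_interior K j t `&` c !=set0]))).
    move=> _ [[n _ <-] cn]; exists n => //=; exists k; first by case: (fE n).
    by exists (x n); split=> //; case: (xE n).
  apply: finite_image; apply: finite_preimage; last exact: fin Kc.
  by move=> a b _ _; apply: inj; rewrite inE.
have : range x v.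
  apply: (@closed_cvg _ _ \oo _ x (range x) Acl); first by apply: nearW => n; exists n.
  apply/cvgrPdist_lt => e e0.
  have hcvg := proj1 (cvgrPdist_lt _ _) (@cvg_harmonic R) e e0.
  apply: filterS (hcvg _) => n; rewrite sub0r normrN => h; have [_ /lt_trans->//] := xE n.
  by apply: le_lt_trans h; rewrite ler_norm.
move=> [n _ xn]; have [[_ +] _] := xE n; apply; rewrite xn; exact: vertex_skeleton.
Qed.

End Cells.

Section Edges.
Variables (R : realType) (d : nat).
Implicit Types (K : nat -> set (set 'rV[R]_d)) (s e f X : set 'rV[R]_d).
Implicit Types (x y v p a b : 'rV[R]_d) (psi : R -> 'rV[R]_d).

Definition arc psi e a b : Prop :=
  [/\ {within `[0, 1]%classic, continuous psi},
      (forall u v : R, 0 <= u <= 1 -> 0 <= v <= 1 -> psi u = psi v -> u = v),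
      psi @` `[0, 1]%classic = e & psi 0 = a /\ psi 1 = b].

Lemma arc_rev psi e a b : arc psi e a b -> arc (fun t => psi (1 - t)) e b a.
Proof.
move=> [cpsi inj psie [p0 p1]]; split; last by rewrite subrr subr0.
- exact: continuous_rev.
- move=> u v u01 v01 /inj h; suff : 1 - u = 1 - v by lra.
  by apply: h; apply/andP; split; lra.
- rewrite -psie; apply/seteqP; split=> x [t /itv_ccP t01 <-].
    by exists (1 - t) => //; apply/itv_ccP; apply/andP; split; lra.
  exists (1 - t); last by congr psi; lra.
  by apply/itv_ccP; apply/andP; split; lra.
Qed.

Lemma edge_param K X e : is_CW K X -> K 1 e -> exists psi a b,
  arc psi e a b /\ cell_boundary K 1 e = [set a; b].
Proof.
move=> [_ hK _ _ _] /hK[phi [[g [cphi _ phiP gP]] phiS]].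
pose w (t : R) : 'rV[R]_1 := (2 * t - 1) *: const_mx 1.
have sqE (x : 'rV[R]_1) : \sum_i x 0 i ^+ 2 = x 0 0 ^+ 2.
  by rewrite big_ord_recl big_ord0 addr0.
have wE t : w t 0 0 = 2 * t - 1 by rewrite !mxE mulr1.
have wdisk t : 0 <= t <= 1 -> unit_disk (w t).
  by move=> t01; rewrite /unit_disk /= sqE wE; nra.
have wK (x : 'rV[R]_1) : w ((x 0 0 + 1) / 2) = x.
  by apply/rowP => i; rewrite !mxE !ord1; field.
exists (phi \o w), (phi (w 0)), (phi (w 1)); split; [split => //|].
- apply: comp_continuous_within cphi; first by move=> t /itv_ccP/wdisk.
  apply: continuous_subspaceT => t; apply: cvgZr_tmp; apply: (@cvgB _ R^o).
    by apply: (@cvgM R); [exact: cvg_cst|exact: cvg_id].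
  exact: cvg_cst.
- move=> u v /wdisk/phiP[_ uE] /wdisk/phiP[_ vE] /= uv.
  have : w u 0 0 = w v 0 0 by rewrite -uE -vE uv.
  by rewrite !wE => ?; lra.
- apply/seteqP; split=> [_ [t /itv_ccP/wdisk/phiP[? _] <-] //|x ex].
  have [Dx <-] := gP x ex; exists ((g x 0 0 + 1) / 2); last by rewrite /= wK.
  by apply/itv_ccP; move: Dx; rewrite /unit_disk /= sqE => ?; apply/andP; split; nra.
- rewrite -phiS; apply/seteqP; split=> [_ [x Sx <-]|_ [] ->].
  + move: Sx; rewrite /unit_sphere /= sqE => /eqP; rewrite sqrf_eq1.
    have x1 : x = const_mx (x 0 0) by apply/rowP => i; rewrite !mxE !ord1.
    case/orP => /eqP x0; [right|left]; congr phi; apply/rowP => i;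
      by rewrite !mxE !ord1 x0; ring.
  + by exists (w 0) => //; rewrite /unit_sphere /= sqE wE; ring.
  + by exists (w 1) => //; rewrite /unit_sphere /= sqE wE; ring.
Qed.

(** An edge meets the vertices exactly in its two ends. *)
Lemma edge_arc K X e a b : is_CW K X -> K 1 e -> K 0 [set a] -> K 0 [set b] ->
  e a -> e b -> a <> b ->
  (exists psi, arc psi e a b) /\
  forall x, e x -> skeleton K 1 x -> x = a \/ x = b.
Proof.
move=> CW Ke Ka Kb ea eb ab; have [psi [a' [b' [psiE be]]]] := edge_param CW Ke.
have bd x : e x -> skeleton K 1 x -> x = a' \/ x = b'.
  by move=> ex Kx; have : cell_boundary K 1 e x by []; rewrite be.
have Ka1 := vertex_skeleton (k := 1) isT Ka; have Kb1 := vertex_skeleton (k := 1) isT Kb.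
case: (bd _ ea Ka1) => aE; case: (bd _ eb Kb1) => bE; rewrite aE bE //.
- by rewrite aE bE in ab.
- by split=> //; exists psi.
- split; first by exists (fun t => psi (1 - t)); exact: arc_rev.
  by move=> x ex /(bd _ ex)[]; [right|left].
- by rewrite aE bE in ab.
Qed.

End Edges.

(** * Boundaries of disks *)

Section Circle.
Variables (R : realType).

Definition circle_path (t : R) : 'rV[R]_2 :=
  cos (2 * pi * t) *: delta_mx 0 0 + sin (2 * pi * t) *: delta_mx 0 1.

Lemma sumsq2E (x : 'rV[R]_2) : \sum_i x 0 i ^+ 2 = x 0 0 ^+ 2 + x 0 1 ^+ 2.
Proof. by rewrite !big_ord_recl big_ord0 addr0; congr (_ + x 0 _ ^+ 2); apply/val_inj. Qed.

Lemma circle_path0 t : circle_path t 0 0 = cos (2 * pi * t).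
Proof. by rewrite !mxE /= mulr1 mulr0 addr0. Qed.

Lemma circle_path1 t : circle_path t 0 1 = sin (2 * pi * t).
Proof. by rewrite !mxE /= mulr1 mulr0 add0r. Qed.

Lemma continuous_circle_path : continuous circle_path.
Proof.
have c2 : continuous (fun t : R => 2 * pi * t : R).
  by move=> t; apply: (@cvgM R); [exact: cvg_cst|exact: cvg_id].
move=> t; apply: cvgD; apply: cvgZr_tmp.
  apply: (@continuous_comp _ _ _ (fun t : R => 2 * pi * t) cos); first exact: c2.
  exact: continuous_cos.
apply: (@continuous_comp _ _ _ (fun t : R => 2 * pi * t) sin); first exact: c2.
exact: continuous_sin.
Qed.

Lemma polar_coordinates (a b : R) : a ^+ 2 + b ^+ 2 = 1 ->
  exists2 t, 0 <= t <= 1 & a = cos (2 * pi * t) /\ b = sin (2 * pi * t).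
Proof.
move=> ab; have pi0 := pi_gt0 R.
have a1 : -1 <= a <= 1 by apply/andP; split; nra.
have ca : cos (acos a) = a by rewrite acosK // in_itv.
have sa : sin (acos a) = `|b|.
  by rewrite sin_acos // (_ : 1 - a ^+ 2 = b ^+ 2) ?sqrtr_sqr //; lra.
have := acos_ge0 a1; have := acos_lepi a1 => h1 h2.
have K (x : R) : 2 * pi * (x / (2 * pi)) = x.
  by rewrite mulrC divfK //; apply: lt0r_neq0; lra.
have [b0|b0] := leP 0 b.
  exists (acos a / (2 * pi)); last by rewrite K ca sa ger0_norm.
  apply/andP; split; first by apply: divr_ge0; lra.
  by rewrite ler_pdivrMr; lra.
exists ((2 * pi - acos a) / (2 * pi)).
  apply/andP; split; first by apply: divr_ge0; lra.
  by rewrite ler_pdivrMr; lra.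
rewrite K mulr_natl cosB sinB cos2pi sin2pi ca sa ltr0_norm //; split; ring.
Qed.

Lemma jordan_circle_path : jordan circle_path (@unit_sphere R 2).
Proof.
split.
- apply: continuous_subspaceT; exact: continuous_circle_path.
- by rewrite /circle_path mulr0 mulr1 cos0 sin0 mulr_natl cos2pi sin2pi.
- move=> u v u01 v01 uv; have pi0 := pi_gt0 R.
  have cE : cos (2 * pi * u) = cos (2 * pi * v) by rewrite -!circle_path0 uv.
  have sE : sin (2 * pi * u) = sin (2 * pi * v) by rewrite -!circle_path1 uv.
  have : 2 * pi * u - 2 * pi * v = 0.
    apply: cos_eq1; first by rewrite cosB cE sE -!expr2 cos2Dsin2.
    by rewrite -mulrBr normrM gtr0_norm ?mulr_gt0 // gtr_pMr ?mulr_gt0 // ltr_norml;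
      apply/andP; split; lra.
  rewrite -mulrBr => /eqP; rewrite mulf_eq0 => /orP[|/eqP]; last by lra.
  by move=> /eqP; nra.
- apply/seteqP; split=> [_ [t _ <-]|x].
    by rewrite /unit_sphere /= sumsq2E circle_path0 circle_path1 cos2Dsin2.
  rewrite /unit_sphere /= sumsq2E => /polar_coordinates[t t01 [x0 x1]].
  exists t; first exact/itv_ccP.
  apply/rowP => i; have [->|] := eqVneq i 0; first by rewrite circle_path0.
  move=> i0; have -> : i = 1 by apply/val_inj; case: i i0 => [[|[|]]].
  by rewrite circle_path1.
Qed.

(** This parametrizes the boundary circle of any 2-cell, without a choice of
    direction. *)
Lemma jordan_disk_boundary (d : nat) (s : set 'rV[R]_d) phi :
  homeo (@unit_disk R 2) s phi ->
  jordan (phi \o circle_path) (phi @` (@unit_sphere R 2)).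
Proof.
move=> [g [cphi _ phiP _]]; have [cc c01 inj cE] := jordan_circle_path.
have disk t : 0 <= t <= 1 -> unit_disk (circle_path t).
  move=> t01; have : unit_sphere (circle_path t) by rewrite -cE; exists t => //; apply/itv_ccP.
  by rewrite /unit_sphere /unit_disk /= => ->.
split.
- by apply: comp_continuous_within cphi => // t /itv_ccP/disk.
- by rewrite /= c01.
- move=> u v u01 v01 /= e; apply: inj => //.
  have [|_ <-] := phiP (circle_path u); first by apply: disk; apply/andP; split; lra.
  have [|_ <-] := phiP (circle_path v); first by apply: disk; apply/andP; split; lra.
  by rewrite e.
- by rewrite -cE image_comp.
Qed.

End Circle.

(** * Counterclockwise boundaries *)

Section Counterclockwise.
Variables (R : realType) (d : nat).
Implicit Types (K : nat -> set (set 'rV[R]_d)) (s e f X : set 'rV[R]_d).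
Implicit Types (x y v p a b : 'rV[R]_d) (gamma : R -> 'rV[R]_d).

Let hV := @rV_hausdorff R d.

Lemma ccw_jordan K f gamma : counterclockwise K f gamma ->
  jordan gamma (cell_boundary K 2 f).
Proof. by case. Qed.

(** The lift of the angle starts again with the jump 2 pi w, which is invisible
    to cos and sin since the curve is closed. *)
Lemma has_winding_rotate gamma p w (c : R) : 0 < c < 1 -> gamma 0 = gamma 1 ->
  has_winding gamma p w -> has_winding (rotate gamma c) p w.
Proof.
move=> c01 g01 [theta [rho [ct h e]]].
exists (fun t => if t + c <= 1 then theta (t + c) else theta (t + c - 1) + 2 * pi * w).
exists (fun t => if t + c <= 1 then rho (t + c) else rho (t + c - 1)).
split.
- apply: (@rotate_continuous R R theta (fun t => theta t + 2 * pi * w)) => //.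
  apply: (@within_continuousD _ _ R^o) => //.
  by apply: continuous_subspaceT => t; exact: cvg_cst.
- have w1 : cos (2 * pi * w) = 1.
    rewrite (_ : 2 * pi * w = theta 1 - theta 0); last by rewrite e; ring.
    have [|r0 c0 s0] := h 0; first by rewrite lexx ler01.
    have [|r1 c1 s1] := h 1; first by rewrite lexx ler01.
    rewrite g01 in c0 s0.
    apply: (polar_angle_uniq r1 r0).
      by apply: (addrI (crd p 0)); rewrite -c1 -c0.
    by apply: (addrI (crd p 1)); rewrite -s1 -s0.
  have w0 : sin (2 * pi * w) = 0.
    by have := cos2Dsin2 (2 * pi * w); rewrite w1 => e1; apply/eqP;
      rewrite -sqrf_eq0; apply/eqP; lra.
  move=> u u01; rewrite /rotate; case: (leP (u + c) 1) => uc.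
    by apply: h; apply/andP; split; lra.
  have [|r0 -> ->] := h (u + c - 1); first by apply/andP; split; lra.
  by rewrite cosD sinD w1 w0; split=> //; ring.
- rewrite add0r ifF ?ifT; [|lra|apply/negbTE; lra].
  by rewrite (_ : 1 + c - 1 = c) //; ring.
Qed.

Lemma ccw_rotate K f gamma (c : R) : 0 < c < 1 -> counterclockwise K f gamma ->
  counterclockwise K f (rotate gamma c).
Proof.
move=> c01 ccw; have [cg g01 _ _ [w1 w0]] := ccw.
have [cg' g01' inj' im'] := jordan_rotate c01 (ccw_jordan ccw).
by split=> //; split=> p pf; apply: has_winding_rotate => //; auto.
Qed.

(** A decreasing reparametrization would turn the winding number 1 about an
    interior point into -1. *)
Lemma ccw_reparam K f gamma gamma' p : cell_interior K 2 f p ->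
  counterclockwise K f gamma -> counterclockwise K f gamma' ->
  gamma 0 = gamma' 0 ->
  exists g, increasing_reparam g /\ forall t : R, 0 <= t <= 1 -> gamma' t = gamma (g t).
Proof.
move=> fp ccw ccw' e0.
have [g [ginc [gE|gE]]] := jordan_reparam hV (ccw_jordan ccw) (ccw_jordan ccw') e0.
  by exists g.
have [_ _ _ _ [/(_ p fp)/has_winding_lift[theta lift thetaE] _]] := ccw.
have [_ _ _ _ [/(_ p fp)/has_winding_lift[theta' lift' thetaE'] _]] := ccw'.
have [cg g0 g1 gmono] := ginc.
have lift'' : angle_lift (fun t => gamma' (1 - t)) p (fun t => theta' (1 - t)).
  case: lift' => ct h; split; first exact: continuous_rev.
  by move=> t t01; apply: h; apply/andP; split; lra.
have := angle_lift_reparam (lexx 0) ler01 (lexx 1) cg _ lift lift''.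
rewrite g0 g1 subr0 subrr; have := pi_gt0 R => pi0 h.
have : theta' 0 - theta' 1 = theta 1 - theta 0.
  apply: h => t t01; split; last exact: gE.
  have [->|t0] := eqVneq t 0; first by rewrite g0 lexx ler01.
  have [->|t1] := eqVneq t 1; first by rewrite g1 lexx ler01.
  have h0 : g 0 < g t by apply: gmono; rewrite ?lexx ?ler01 //; lra.
  have h1 : g t < g 1 by apply: gmono; rewrite ?lexx ?ler01 //; lra.
  by apply/andP; split; lra.
lra.
Qed.

(** Rotating the base point from the beginning of the edge to its end. *)
Lemma traverses_end K f e x v : traverses K f e x v ->
  exists gamma w, [/\ counterclockwise K f gamma, 0 < w < 1, gamma 0 = v,
    gamma w = x & gamma @` `[w, 1]%classic = e].
Proof.
move=> [gamma [u [ccw u01 g0 gu ge]]].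
exists (rotate gamma u), (1 - u); split.
- exact: ccw_rotate.
- by apply/andP; split; lra.
- by rewrite rotate_start.
- by rewrite /rotate subrK lexx; case: ccw => _ <- _ _ _.
- rewrite -ge; apply/seteqP; split=> [_ [t /itv_ccP t01 <-]|_ [t /itv_ccP t01 <-]].
  + rewrite /rotate; case: leP => tu.
      exists 0; first by apply/itv_ccP; apply/andP; split; lra.
      rewrite (_ : t + u = 1); last by lra.
      by case: ccw => _ <- _ _ _.
    by exists (t + u - 1) => //; apply/itv_ccP; apply/andP; split; lra.
  + exists (t + 1 - u); first by apply/itv_ccP; apply/andP; split; lra.
    rewrite /rotate subrK; case: leP => t1; last by congr gamma; lra.
    rewrite (_ : t = 0) ?add0r; last by lra.
    by case: ccw => _ <- _ _ _.
Qed.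

(** Both arcs contain the points shortly after the base point, and these are not
    vertices; but an edge is determined by an interior point. *)
Lemma initial_edges_eq K X gamma gamma' B g (u u' : R) e e' :
  is_CW K X -> K 1 e -> K 1 e' ->
  jordan gamma B -> increasing_reparam g ->
  (forall t : R, 0 <= t <= 1 -> gamma' t = gamma (g t)) ->
  0 < u < 1 -> 0 < u' < 1 ->
  gamma @` `[0, u]%classic = e -> gamma' @` `[0, u']%classic = e' ->
  K 0 [set gamma 0] -> K 0 [set gamma u] -> e = e'.
Proof.
move=> CW Ke Ke' J [cg g0 g1 gmono] gE u01 u'01 ge ge' K0 Ku.
have gu'0 : g 0 < g u' by apply: gmono; rewrite ?lexx ?ler01 //; lra.
pose m := Num.min u (g u') / 2.
have [mu mg] : m <= u / 2 /\ m <= g u' / 2.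
  by rewrite /m !ler_pM2r ?invr_gt0 ?ltr0n // !ge_min !lexx orbT.
have m0 : 0 < m by rewrite divr_gt0 // lt_min -g0 gu'0 g0; lra.
have em : e (gamma m) by rewrite -ge; exists m => //; apply/itv_ccP; apply/andP; split; lra.
have e'm : e' (gamma m).
  have [|||t t01 gt] := @IVT_segment R g 0 u' m; first by lra.
    by apply: continuous_subspaceW cg; apply: itv_cc_sub; lra.
    by left; rewrite g0; apply/andP; split; lra.
  rewrite -gt -gE; last by apply/andP; split; lra.
  by rewrite -ge'; exists t => //; exact/itv_ccP.
apply: (cell_interior_eq CW Ke Ke' em e'm) => Km.
have m01 : 0 < m < 1 by apply/andP; split; lra.
have e0 : e (gamma 0) by rewrite -ge; exists 0 => //; apply/itv_ccP; apply/andP; split; lra.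
have eu : e (gamma u) by rewrite -ge; exists u => //; apply/itv_ccP; apply/andP; split; lra.
have ne : gamma 0 <> gamma u.
  by move=> /(jordan_inj J); rewrite lexx ler01 u01 => /(_ isT isT); lra.
have [_ bd] := edge_arc CW Ke K0 Ku e0 eu ne.
have [/esym/(jordan_inj J)|/esym/(jordan_inj J)] := bd _ em Km.
- by rewrite lexx ler01 m01 => /(_ isT isT); lra.
- move=> h; suff : u = m by lra.
  by apply: h => //; apply/andP; split; lra.
Qed.

Lemma outgoing_edge_uniq K X f e e' v y y' : is_CW K X -> K 2 f ->
  K 1 e -> K 1 e' -> K 0 [set v] -> K 0 [set y] ->
  traverses K f e v y -> traverses K f e' v y' -> e = e'.
Proof.
move=> CW Kf Ke Ke' Kv Ky [gamma [u [ccw u01 g0 gu ge]]] [gamma' [u' [ccw' u'01 g0' gu' ge']]].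
have [p fp] := cell_interior_neq0 CW Kf.
have [|g [ginc gE]] := ccw_reparam fp ccw ccw'; first by rewrite g0 g0'.
apply: (initial_edges_eq CW Ke Ke' (ccw_jordan ccw) ginc gE u01 u'01 ge ge').
  by rewrite g0.
by rewrite gu.
Qed.

Lemma increasing_reparam_rev (g : R -> R) : increasing_reparam g ->
  increasing_reparam (fun t => 1 - g (1 - t)).
Proof.
move=> [cg g0 g1 gmono]; split; rewrite ?subrr ?subr0 ?g0 ?g1 ?subrr ?subr0 //.
  apply: (@within_continuousB _ _ R^o).
    by apply: continuous_subspaceT => t; exact: cvg_cst.
  exact: continuous_rev.
move=> s t s01 t01 st; suff : g (1 - t) < g (1 - s) by lra.
by apply: gmono; [apply/andP; split; lra|apply/andP; split; lra|lra].
Qed.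

Lemma rev_image gamma (w : R) : 
  (fun t => gamma (1 - t)) @` `[0, 1 - w]%classic = gamma @` `[w, 1]%classic.
Proof.
apply/seteqP; split=> [_ [t /itv_ccP t01 <-]|_ [t /itv_ccP t01 <-]].
  by exists (1 - t) => //; apply/itv_ccP; apply/andP; split; lra.
exists (1 - t); last by congr gamma; lra.
by apply/itv_ccP; apply/andP; split; lra.
Qed.

(** The case of outgoing edges, for the reversed curves. *)
Lemma incoming_edge_uniq K X f e e' v x x' : is_CW K X -> K 2 f ->
  K 1 e -> K 1 e' -> K 0 [set v] -> K 0 [set x] ->
  traverses K f e x v -> traverses K f e' x' v -> e = e'.
Proof.
move=> CW Kf Ke Ke' Kv Kx /traverses_end[gamma [w [ccw w01 g0 gw ge]]].
move=> /traverses_end[gamma' [w' [ccw' w'01 g0' gw' ge']]].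
have [p fp] := cell_interior_neq0 CW Kf.
have [|g [ginc gE]] := ccw_reparam fp ccw ccw'; first by rewrite g0 g0'.
have w1 : 0 < 1 - w < 1 by apply/andP; split; lra.
have w1' : 0 < 1 - w' < 1 by apply/andP; split; lra.
rewrite -(rev_image gamma) in ge; rewrite -(rev_image gamma') in ge'.
apply: (initial_edges_eq CW Ke Ke' (jordan_rev (ccw_jordan ccw))
  (increasing_reparam_rev ginc) _ w1 w1' ge ge') => /=.
- move=> t t01; rewrite gE; last by apply/andP; split; lra.
  by congr gamma; ring.
- by rewrite subr0; case: (ccw) => _ <- _ _ _; rewrite g0.
- by rewrite opprB addrC subrK gw.
Qed.

(** The points shortly after [v] would belong both to an initial and to a final
    arc of the boundary. *)
Lemma traverses_antisym K X f e v y : is_CW K X -> K 2 f ->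
  traverses K f e v y -> ~ traverses K f e y v.
Proof.
move=> CW Kf [gamma [u [ccw u01 g0 gu ge]]].
move=> /traverses_end[gamma' [w' [ccw' w'01 g0' gw' ge']]].
have [p fp] := cell_interior_neq0 CW Kf.
have [|g [[cg gg0 gg1 gmono] gE]] := ccw_reparam fp ccw ccw'; first by rewrite g0 g0'.
have gw0 : g 0 < g w' by apply: gmono; rewrite ?lexx ?ler01 //; lra.
pose m := Num.min u (g w') / 2.
have [mu mg] : m <= u / 2 /\ m <= g w' / 2.
  by rewrite /m !ler_pM2r ?invr_gt0 ?ltr0n // !ge_min !lexx orbT.
have m0 : 0 < m by rewrite divr_gt0 // lt_min -gg0 gw0 gg0; lra.
have : e (gamma m) by rewrite -ge; exists m => //; apply/itv_ccP; apply/andP; split; lra.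
rewrite -ge' => -[s /itv_ccP s01]; rewrite gE; last by apply/andP; split; lra.
have gs : g w' <= g s.
  have [->//|sw] := eqVneq s w'; apply/ltW/gmono; lra.
have gs1 : g s <= 1.
  have [->|s1] := eqVneq s 1; first by rewrite gg1.
  by rewrite -gg1; apply/ltW/gmono; rewrite ?lexx ?ler01 //; lra.
move=> /(jordan_inj (ccw_jordan ccw)) h; suff : g s = m by lra.
by apply: h; apply/andP; split; lra.
Qed.

End Counterclockwise.

(** * The two sides of an edge *)

Section TwoFaces.
Variable R : realType.

Lemma far_product (a x y e : R) : e <= `|a| -> `|x| < e / 4 -> `|y| < e / 4 ->
  e ^+ 2 / 2 < (a - x) * (a - y).
Proof.
rewrite !ltr_norml ler_normr => ea /andP[x1 x2] /andP[y1 y2].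
have e0 : 0 < e by lra.
by case/orP: ea => ?; nra.
Qed.

Lemma near_product (b x y e : R) : `|x| < e / 4 -> `|y| < e / 4 ->
  - (e ^+ 2 / 4) <= (b - x) * (b - y).
Proof.
rewrite !ltr_norml => /andP[x1 x2] /andP[y1 y2].
have -> : (b - x) * (b - y) = (b - (x + y) / 2) ^+ 2 - ((x - y) / 2) ^+ 2 by field.
have := sqr_ge0 (b - (x + y) / 2); nra.
Qed.

Lemma crdE (x : 'rV[R]_2) : crd x 0 = x 0 0 /\ crd x 1 = x 0 1.
Proof. by split; rewrite /crd insubT /=; congr (x 0 _); apply/val_inj. Qed.

Lemma ball_crd (z p : 'rV[R]_2) e : ball z e p ->
  `|crd p 0 - crd z 0| < e /\ `|crd p 1 - crd z 1| < e.
Proof.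
have [-> ->] := crdE z; have [-> ->] := crdE p => -[_ h].
by split; rewrite distrC; exact: h.
Qed.

Lemma not_ball_crd (z p : 'rV[R]_2) e : 0 < e -> ~ ball z e p ->
  e <= `|crd p 0 - crd z 0| \/ e <= `|crd p 1 - crd z 1|.
Proof.
have [-> ->] := crdE z; have [-> ->] := crdE p => e0 h.
have [|h0] := leP e `|p 0 0 - z 0 0|; first by left.
have [|h1] := leP e `|p 0 1 - z 0 1|; first by right.
exfalso; apply: h; split=> // i j; rewrite ord1.
have [->|j0] := eqVneq j 0; first by rewrite /ball /= distrC.
have -> : j = 1 by apply/val_inj; case: j j0 => [[|[|]]].
by rewrite /ball /= distrC.
Qed.

(** [p] and [q] are close together compared with their distance from [w], so
    they are seen from [w] at an acute angle. *)
Lemma seen_close (z p q w : 'rV[R]_2) e : 0 < e -> ~ ball z e w ->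
  ball z (e / 4) p -> ball z (e / 4) q ->
  0 < (crd w 0 - crd p 0) * (crd w 0 - crd q 0) +
      (crd w 1 - crd p 1) * (crd w 1 - crd q 1).
Proof.
move=> e0 /(not_ball_crd e0) zw /ball_crd[p0 p1] /ball_crd[q0 q1].
have shift_prod i : (crd w i - crd p i) * (crd w i - crd q i) =
    (crd w i - crd z i - (crd p i - crd z i)) *
    (crd w i - crd z i - (crd q i - crd z i)) by ring.
rewrite !shift_prod; case: zw => far.
  have := far_product far p0 q0; have := near_product (crd w 1 - crd z 1) p1 q1; nra.
have := far_product far p1 q1; have := near_product (crd w 0 - crd z 0) p0 q0; nra.
Qed.

(** Let alpha and beta be the rest of the boundaries of [f] and [f'], after [e],
    and choose p inside [f] and q inside [f'], both close to an inner point z of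
    [e]. The change of angle along alpha minus that along beta is 2 pi about p,
    since the boundary of [f] turns once around p, that of [f'] does not, and
    the parts along [e] cancel; it is - 2 pi about q. But alpha and beta stay
    away from z, so that the two differences are less than 2 pi apart. *)
Lemma same_side_eq K X (f f' e : set 'rV[R]_2) x y : is_CW K X ->
  K 2 f -> K 2 f' -> f `&` f' `<=` skeleton K 2 ->
  traverses K f e x y -> ~ traverses K f' e x y.
Proof.
move=> CW Kf Kf' ff' [gamma [u [ccw u01 g0 gu ge]]] [gamma' [u' [ccw' u'01 g0' gu' ge']]].
have J := ccw_jordan ccw; have J' := ccw_jordan ccw'.
have [cg _ ginj _] := J; have [cg' _ _ _] := J'.
have hV := @rV_hausdorff R 2.
set z := gamma (u / 2).
have h01 : 0 < u / 2 < 1 by apply/andP; split; lra.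
have h01' : 0 <= u / 2 <= 1 by apply/andP; split; lra.
have zg t : 0 <= t <= 1 -> gamma t = z -> t = u / 2 by move=> t01; exact: (jordan_inj J).
have [s s01 sz] : exists2 s, 0 <= s <= u' & gamma' s = z.
  have : e z by rewrite -ge; exists (u / 2) => //; apply/itv_ccP; apply/andP; split; lra.
  by rewrite -ge' => -[s /itv_ccP s01 sz]; exists s.
have s0 : s != 0.
  apply/negP => /eqP s0; move: sz; rewrite s0 g0' -g0 => /zg; rewrite lexx ler01.
  by move=> /(_ isT); lra.
have su' : s != u'.
  apply/negP => /eqP s1; move: sz; rewrite s1 gu' -gu => /zg h.
  suff : u = u / 2 by lra.
  by apply: h; apply/andP; split; lra.
pose C := gamma @` `[u, 1]%classic `|` gamma' @` `[u', 1]%classic.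
have Ccl : closed C.
  apply: closedU; apply: compact_closed => //; apply: continuous_compact;
    try exact: segment_compact.
  - by apply: continuous_subspaceW cg; apply: itv_cc_sub; lra.
  - by apply: continuous_subspaceW cg'; apply: itv_cc_sub; lra.
have nCz : ~ C z.
  move=> [[t /itv_ccP t01]|[t /itv_ccP t01]].
    move=> /zg h; suff : t = u / 2 by lra.
    by apply: h; apply/andP; split; lra.
  rewrite -sz => /(jordan_inj J') h; suff : t = s by lra.
  by apply: h; apply/andP; split; lra.
have /nbhs_ballP[eps /= eps0 epsC] : nbhs z (~` C).
  by apply: open_nbhs_nbhs; split=> //; exact: closed_openC.
have eps4 : 0 < eps / 4 by lra.
have fz : f z by have [] := jordan_mem J h01'.
have f'z : f' z.
  by have [|] := @jordan_mem _ _ _ _ s J'; [apply/andP; split; lra|rewrite sz].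
have [p [fp zp]] := cell_interior_dense CW Kf fz (nbhsx_ballx z _ eps4).
have [q [f'q zq]] := cell_interior_dense CW Kf' f'z (nbhsx_ballx z _ eps4).
have f'p : ~ f' p by case: (fp) => fp' np f'p; apply: np; apply: ff'.
have fq : ~ f q by case: (f'q) => fq' nq fq; apply: nq; apply: ff'.
have [_ _ _ _ [win wout]] := ccw; have [_ _ _ _ [win' wout']] := ccw'.
have [a lifta aE] := has_winding_lift (win _ fp).
have [b liftb bE] := has_winding_lift (wout' _ f'p).
have [a' lifta' aE'] := has_winding_lift (wout _ fq).
have [b' liftb' bE'] := has_winding_lift (win' _ f'q).
(* The two parametrizations of e, and hence the changes of angle along it. *)
pose P t := [set r | 0 <= r <= u /\ gamma r = gamma' t].
pose g t := xget 0 (P t).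
have gE t : 0 <= t <= u' -> 0 <= g t <= u /\ gamma (g t) = gamma' t.
  move=> t01; apply: (@xgetPex _ 0 (P t)).
  have : e (gamma' t) by rewrite -ge'; exists t => //; exact/itv_ccP.
  by rewrite -ge => -[r /itv_ccP r01 rt]; exists r.
have ginj' r t : 0 <= r <= u -> 0 <= t <= u -> gamma r = gamma t -> r = t.
  by move=> r01 t01; apply: ginj; apply/andP; split; lra.
have cont_g : {within `[0, u']%classic, continuous g}.
  apply: (@path_inverse_continuous _ _ hV _ _ gamma g 0 u).
  - by apply: continuous_subspaceW cg; apply: itv_cc_sub; lra.
  - by move=> t /itv_ccP/gE[].
  - by move=> t r /itv_ccP/gE[gt _] r01; exact: ginj'.
  - apply: (@subspace_eq_continuous _ _ _ gamma').
      by move=> t; rewrite inE /from_subspace => /itv_ccP/gE[_ /= ->].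
    by apply: continuous_subspaceW cg'; apply: itv_cc_sub; lra.
have gg0 : g 0 = 0.
  have [|? e0] := gE 0; first by apply/andP; split; lra.
  by apply: ginj' => //; [apply/andP; split; lra|rewrite e0 g0 g0'].
have ggu : g u' = u.
  have [|? e1] := gE u'; first by apply/andP; split; lra.
  by apply: ginj' => //; [apply/andP; split; lra|rewrite e1 gu gu'].
have same theta theta' r : angle_lift gamma r theta -> angle_lift gamma' r theta' ->
    theta' u' - theta' 0 = theta u - theta 0.
  move=> lift lift'; rewrite -ggu -[in RHS]gg0 ggu.
  have := @angle_lift_reparam R 2 gamma gamma' r theta theta' g 0 u'.
  rewrite ggu gg0; apply=> //; try lra.
  by move=> t /gE[gt ->]; split=> //; apply/andP; split; lra.
have ep := same _ _ _ lifta liftb; have eq := same _ _ _ lifta' liftb'.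
have h1 : `|(a 1 - a u) - (a' 1 - a' u)| < pi.
  apply: (angle_change_close _ _ _ _ lifta lifta'); try lra.
  move=> t t01; apply: seen_close eps0 _ zp zq => /epsC; apply; left.
  by exists t => //; exact/itv_ccP.
have h2 : `|(b 1 - b u') - (b' 1 - b' u')| < pi.
  apply: (angle_change_close _ _ _ _ liftb liftb'); try lra.
  move=> t t01; apply: seen_close eps0 _ zp zq => /epsC; apply; right.
  by exists t => //; exact/itv_ccP.
have := pi_gt0 R; move: h1 h2; rewrite !ltr_norml => /andP[? ?] /andP[? ?]; lra.
Qed.

End TwoFaces.

(** * The edges of a face at a vertex *)

Section EdgesAtVertex.
Variables (R : realType) (d : nat).
Implicit Types (K : nat -> set (set 'rV[R]_d)) (s e f c X B : set 'rV[R]_d).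
Implicit Types (x y v p a b : 'rV[R]_d) (gamma : R -> 'rV[R]_d).

Let hV := @rV_hausdorff R d.

Lemma finite_uniform_bound (T : choiceType) (N : set T) (Q : T -> R -> Prop) :
  finite_set N -> (forall (c : T) (e e' : R), e' <= e -> Q c e -> Q c e') ->
  (forall c : T, N c -> exists2 e : R, 0 < e & Q c e) ->
  exists2 e : R, 0 < e & forall c : T, N c -> Q c e.
Proof.
move=> /finite_seqP[l ->] Qle; elim: l => [|c l IH] h; first by exists 1.
have [|e e0 eQ] := IH; first by move=> c' lc'; apply: h; rewrite /= inE lc' orbT.
have [|e' e'0 e'Q] := h c; first by rewrite /= inE eqxx.
exists (Num.min e e'); first by rewrite lt_min e0.
move=> c'; rewrite /= inE => /orP[/eqP->|lc'].
  by apply: Qle e'Q; rewrite ge_min lexx orbT.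
by apply: Qle (eQ _ lc'); rewrite ge_min lexx.
Qed.

Definition meets_at_start gamma c : Prop :=
  forall eps : R, 0 < eps -> exists s : R, [/\ 0 < s < eps, s < 1 & c (gamma s)].

(** Finitely many cells cover the curve. *)
Lemma cell_met_at_start (N : set (set 'rV[R]_d)) B gamma :
  finite_set N -> (forall x, B x -> exists2 c, N c & c x) -> jordan gamma B ->
  exists2 c, N c & meets_at_start gamma c.
Proof.
move=> Nfin cover J; apply: contrapT => nacc.
have [||eps eps0 epsN] := @finite_uniform_bound _ N
    (fun c eps => forall s : R, 0 < s < eps -> s < 1 -> ~ c (gamma s)) Nfin.
- by move=> c e e' ee' h s s0 s1; apply: h => //; apply/andP; split; lra.
- move=> c Nc; apply: contrapT => nc; apply: nacc; exists c => // eps eps0.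
  apply: contrapT => ns; apply: nc; exists eps => // s s0 s1 cs.
  by apply: ns; exists s.
pose s := Num.min eps 1 / 2.
have [s1 s2] : s <= eps / 2 /\ s <= 1 / 2.
  by rewrite /s !ler_pM2r ?invr_gt0 ?ltr0n // !ge_min !lexx orbT.
have s0 : 0 < s by rewrite divr_gt0 // lt_min eps0 ltr01.
have [|c Nc cs] := cover (gamma s).
  by apply: (jordan_mem J); apply/andP; split; lra.
by apply: (epsN c Nc s) => //; [apply/andP; split|]; lra.
Qed.

Lemma closed_met_at_start c gamma : closed c ->
  {within `[0, 1]%classic, continuous gamma} -> meets_at_start gamma c -> c (gamma 0).
Proof.
move=> ccl /subspace_continuousP/(_ 0) cg acc; apply: contrapT => ncg.
have nb : nbhs (gamma 0) (~` c).
  by apply: open_nbhs_nbhs; split=> //; exact: closed_openC.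
have := cg; rewrite /= in_itv /= lexx ler01 => /(_ isT _ nb).
rewrite /nbhs /= /within /= => /nbhs_ballP[e /= e0 eN].
have [s [s0 s1 cs]] := acc e e0.
suff : ~ c (gamma s) by [].
apply: (eN s); last by rewrite /= in_itv /=; apply/andP; split; lra.
by rewrite /= sub0r normrN gtr0_norm; lra.
Qed.

(** In the parameter of the closed curve, the arc [e] without [v] becomes the
    image of a monotone function. It takes arbitrarily small values, so it
    increases, and its image is an interval starting at 0. *)
Lemma initial_arc gamma psi B e v b :
  jordan gamma B -> gamma 0 = v -> arc psi e v b -> e `<=` B ->
  meets_at_start gamma e ->
  exists u : R, [/\ 0 < u < 1, gamma @` `[0, u]%classic = e & gamma u = b].
Proof.
move=> J g0 [cpsi inj psie [psi0 psi1]] eB acc.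
have [cg _ _ _] := J.
have psi_e t : 0 <= t <= 1 -> e (psi t).
  by move=> t01; rewrite -psie; exists t => //; apply/itv_ccP.
pose P t := [set s | 0 < s < 1 /\ gamma s = psi t].
pose g t := xget 0 (P t).
have gE t : 0 < t <= 1 -> 0 < g t < 1 /\ gamma (g t) = psi t.
  move=> t01; apply: (@xgetPex _ 0 (P t)).
  have [|s s01 sE] := jordan_memP J (eB _ (psi_e t _)); first by apply/andP; split; lra.
  exists s; split=> //; apply/andP; split; last by lra.
  rewrite lt_neqAle; apply/andP; split; last by lra.
  apply/negP => /eqP s0; move: sE; rewrite -s0 g0 -psi0 => /inj h.
  suff : 0 = t by lra.
  by apply: h; apply/andP; split; lra.
have ginj : {in `]0, 1] &, injective g}.
  move=> s t; rewrite !in_itv /= => s01 t01 e0.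
  have [[_ es] [_ et]] := (gE s s01, gE t t01).
  by apply: inj; rewrite -?es -?et ?e0 //; apply/andP; split; lra.
have gcont : {within `]0, 1]%classic, continuous g}.
  apply: (@path_inverse_continuous _ _ hV _ _ gamma g 0 1 cg).
  - by move=> t; rewrite /= in_itv /= => /gE[g01 _]; apply/andP; split; lra.
  - by move=> t s; rewrite /= in_itv /= => /gE[g01 _] s01; exact: (jordan_inj J).
  - apply: (@subspace_eq_continuous _ _ _ psi).
      by move=> t; rewrite inE /from_subspace /= in_itv /= => /gE[_ ->].
    by apply: continuous_subspaceW cpsi => t; rewrite /= !in_itv /= => ?; apply/andP; split; lra.
(* g takes arbitrarily small values, so it cannot be decreasing. *)
have acc_g (r : R) : 0 < r -> exists t, [/\ 0 < t <= 1, 0 < g t < r & g t < 1].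
  move=> r0; have [s [s0 s1 es]] := acc r r0; move: es; rewrite -psie => -[t /itv_ccP t01 te].
  have t0 : t != 0.
    apply/negP => /eqP t0; move: te; rewrite t0 psi0 -g0 => /(jordan_inj J) h.
    suff : 0 = s by lra.
    by apply: h; apply/andP; split; lra.
  have t01' : 0 < t <= 1 by apply/andP; split; [rewrite lt_neqAle eq_sym t0|]; lra.
  exists t; have [gt ge] := gE t t01'.
  suff -> : g t = s by [].
  by apply: (jordan_inj J); rewrite ?ge ?te //; apply/andP; split; lra.
have [g1 ge1] : 0 < g 1 < 1 /\ gamma (g 1) = psi 1 by apply: gE; apply/andP; split; lra.
have [gm|gm] := itv_continuous_inj_mono gcont ginj; last first.
  have [|t [t01 gt _]] := acc_g (g 1); first by lra.
  have [t1|t1] := eqVneq t 1; first by move: gt; rewrite t1 ltxx andbF.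
  have g1t : g 1 < g t by apply: (gm (1 : R) t); rewrite ?in_itv /=; lra.
  by move: gt => /andP[_ /(lt_trans g1t)]; rewrite ltxx.
exists (g 1); split=> //; last by rewrite ge1.
apply/seteqP; split=> [_ [r /itv_ccP r01 <-]|x].
  have [->|r0] := eqVneq r 0; first by rewrite g0 -psi0; apply: psi_e; rewrite lexx ler01.
  have [|t [t01 gt gt1]] := acc_g r; first by rewrite lt_neqAle eq_sym r0; lra.
  have [|||c c01 <-] := @IVT_segment R g t 1 r; first by lra.
  - by apply: continuous_subspaceW gcont => y; rewrite /= !in_itv /= => ?; apply/andP; split; lra.
  - by left; apply/andP; split; lra.
  have [|_ ->] := gE c; first by apply/andP; split; lra.
  by apply: psi_e; apply/andP; split; lra.
rewrite -psie => -[t /itv_ccP t01 <-].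
have [->|t0] := eqVneq t 0.
  by exists 0; [apply/itv_ccP; apply/andP; split; lra|rewrite g0 psi0].
have t01' : 0 < t <= 1 by apply/andP; split; [rewrite lt_neqAle eq_sym t0|]; lra.
have [gt gte] := gE t t01'; exists (g t) => //; apply/itv_ccP.
have [->|t1] := eqVneq t 1; first by apply/andP; split; lra.
have : g t < g 1 by apply: (gm t (1 : R)); rewrite ?in_itv /=; lra.
by move=> ?; apply/andP; split; lra.
Qed.

(** Some cell of the boundary is met at arbitrarily small times. It is not a
    vertex because the curve is injective, and it contains the base point
    because it is closed. *)
Lemma edge_at_start K X (N : set (set 'rV[R]_d)) B gamma v : is_CW K X ->
  finite_set N -> (forall c, N c -> K 0 c \/ (K 1 c /\ c `<=` B)) ->
  (forall x, B x -> exists2 c, N c & c x) -> jordan gamma B ->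
  gamma 0 = v -> K 0 [set v] ->
  exists e (u : R), [/\ N e, K 1 e, 0 < u < 1, gamma @` `[0, u]%classic = e &
    K 0 [set gamma u]].
Proof.
move=> CW Nfin NK cover J g0 Kv.
have [e Ne acc] := cell_met_at_start Nfin cover J.
have [cg _ _ _] := J.
have [K0e|[Ke eB]] := NK _ Ne.
  have [w wE] := vertex_singleton CW K0e; rewrite {}wE in acc.
  have [s [s0 s1 sw]] := acc 1 ltr01; have [|t [t0 t1 tw]] := acc s; first by lra.
  suff : s = t by lra.
  by apply: (jordan_inj J); rewrite ?sw ?tw //; apply/andP; split; lra.
have [psi [a [b [psiE bd]]]] := edge_param CW Ke.
have ecl : closed e.
  have [cpsi _ <- _] := psiE; apply: compact_closed => //.
  by apply: continuous_compact => //; exact: segment_compact.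
have ev : e v by rewrite -g0; exact: (closed_met_at_start ecl cg acc).
have bdP x : [set a; b] x -> K 0 [set x].
  by rewrite -bd => -[_ /(skeleton1P _ CW)].
have [va|vb] : v = a \/ v = b.
  by have : cell_boundary K 1 e v; [split=> //; exact: vertex_skeleton|rewrite bd].
- rewrite -va in psiE; have [u [u01 ue ub]] := initial_arc J g0 psiE eB acc.
  by exists e, u; split=> //; rewrite ub; apply: bdP; right.
- have psiE' := arc_rev psiE; rewrite -vb in psiE'.
  have [u [u01 ue ub]] := initial_arc J g0 psiE' eB acc.
  by exists e, u; split=> //; rewrite ub; apply: bdP; left.
Qed.

End EdgesAtVertex.

(** * Columns of the coboundary matrices *)

Lemma fsum_single (T : choiceType) (n : nat) (C : 'I_n -> set T) (P : set T)
    (c : T -> int) (z : int) :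
  (forall j j' s, C j s -> C j' s -> j = j') ->
  (forall s s', P s -> P s' -> s = s') -> (forall s, P s -> c s = z) ->
  exists a : option 'I_n, forall j,
    \sum_(s \in P `&` C j) c s = z * opt_delta a j 0.
Proof.
move=> Cinj Pinj cz.
have [[s [Ps [j Cjs]]]|none] := pselect (exists s, P s /\ exists j, C j s).
  exists (Some j) => j'; rewrite mxE; case: eqP => [[->]|jj'].
    rewrite (_ : P `&` C j = [set s]) ?fsbig_set1 ?cz ?mulr1 //.
    by apply/seteqP; split=> [s' [/Pinj/(_ Ps)->]|_ ->].
  rewrite fsbig1 ?mulr0 // => s' [Ps' Cs']; exfalso; apply: jj'; congr Some.
  by apply: (Cinj _ _ s') => //; rewrite (Pinj _ _ Ps' Ps).
exists None => j; rewrite mxE mulr0 fsbig1 // => s [Ps Cs].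
by exfalso; apply: none; exists s; split=> //; exists j.
Qed.

(** Each stable cell collects the contributions of the cells of its class. With
    at most one contribution +1 and at most one -1 in all, the column is a
    difference of two basis vectors, one or both of which may be absent or
    cancel. *)
Lemma fsum_column (T : choiceType) (n : nat) (C : 'I_n -> set T) (A : set T)
    (c c' : T -> int) (sg : 'I_n -> int) :
  (forall j j' s, C j s -> C j' s -> j = j') ->
  (forall j s, A s -> C j s -> sg j * c s = c' s) ->
  (forall s, A s -> [\/ c' s = 1, c' s = -1 | c' s = 0]) ->
  (forall s s', A s -> A s' -> c' s = 1 -> c' s' = 1 -> s = s') ->
  (forall s s', A s -> A s' -> c' s = -1 -> c' s' = -1 -> s = s') ->
  exists a b : option 'I_n, forall j,
    sg j * (\sum_(s \in A `&` C j) c s) = opt_delta a j 0 - opt_delta b j 0.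
Proof.
move=> Cinj cc' cval pos neg.
pose P := A `&` [set s | c' s = 1]; pose N := A `&` [set s | c' s = -1].
have [||a aE] := @fsum_single T n C P c' 1 Cinj.
- by move=> s s' [As cs] [As' cs']; exact: pos.
- by move=> s [].
have [||b bE] := @fsum_single T n C N c' (-1) Cinj.
- by move=> s s' [As cs] [As' cs']; exact: neg.
- by move=> s [].
exists a, b => j.
have fin B : (forall s s', B s -> B s' -> s = s') -> finite_set (B `&` C j).
  move=> Binj; have [->//|/set0P[s Bs]] := eqVneq B set0; first by rewrite set0I.
  by apply: (@sub_finite_set _ _ [set s]) => // s' [Bs' _]; exact: Binj.
rewrite mulr_fsumr (eq_fsbigr c') => [|s /set_mem[As Cs]]; last exact: cc'.
rewrite -(@fsbig_widen _ _ _ _ ((P `&` C j) `|` (N `&` C j))).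
- rewrite fsbigU0.
  + by rewrite aE bE mul1r mulN1r.
  + by apply: fin => s s' [As cs] [As' cs']; exact: pos.
  + by apply: fin => s s' [As cs] [As' cs']; exact: neg.
  + by move=> s [[[_ /= e1] _] [[_ /= e2] _]]; rewrite e1 in e2.
- by move=> s [[[As _] Cs]|[[As _] Cs]].
- move=> s [[As Cs] nPN] /=; case: (cval s As) => // cs.
    by exfalso; apply: nPN; left.
  by exfalso; apply: nPN; right.
Qed.

Lemma fset_set_infinite (T : choiceType) (A : set T) :
  infinite_set A -> fset_set A = fset0.
Proof. by rewrite /fset_set; case: pselect. Qed.

(** * Stable cells *)

Section StableCells.
Variables (R : realType) (d : nat) (S : substitution R d).
Implicit Types (T P : set (tile S)) (s e f : set 'rV[R]_d) (x y : 'rV[R]_d).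

Lemma translateP x s y : translate x s y <-> s (y - x).
Proof.
split=> [[z sz <-]|syx]; first by rewrite addrK.
by exists (y - x) => //; rewrite subrK.
Qed.

Lemma translateD x y s : translate x (translate y s) = translate (y + x) s.
Proof.
by apply/seteqP; split=> z; rewrite !translateP opprD addrA [in X in _ -> X]addrAC
  addrAC.
Qed.

Lemma translate0 s : translate 0 s = s.
Proof. by apply/seteqP; split=> z; rewrite translateP subr0. Qed.

Lemma translateK x s : translate (- x) (translate x s) = s.
Proof. by rewrite translateD subrr translate0. Qed.

Lemma shiftD x y P : shift x (shift y P) = shift (y + x) P.
Proof.
apply/seteqP; split=> [_ [_ [[i z] Pz <-] <-]|_ [[i z] Pz <-]] /=.
  by exists (i, z) => //=; rewrite addrA.
by exists (i, z + y); [exists (i, z)|rewrite /= addrA].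
Qed.

Lemma shift0 P : shift 0 P = P.
Proof.
apply/seteqP; split=> [_ [[i z] Pz <-]|[i z] Pz] /=; first by rewrite addr0.
by exists (i, z) => //=; rewrite addr0.
Qed.

Lemma cell_equiv_refl k T s : cell_equiv k T s T s.
Proof. by exists 0; rewrite /equiv_by translate0 shift0. Qed.

Lemma cell_equiv_sym k T s s' : cell_equiv k T s T s' -> cell_equiv k T s' T s.
Proof.
move=> [x [-> e]]; exists (- x); split; first by rewrite translateK.
by rewrite e shiftD subrr shift0.
Qed.

Lemma cell_equiv_trans k T s s' s'' :
  cell_equiv k T s T s' -> cell_equiv k T s' T s'' -> cell_equiv k T s T s''.
Proof.
move=> [x [-> e]] [y [-> e']]; exists (x + y); split; first by rewrite translateD.
by rewrite e' e shiftD.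
Qed.

Let stable_class T k s := [set s' | cells T k s' /\ cell_equiv k T s T s'].

Lemma stable_repP T k (l : 'I_(stable_num T k)) :
  cells T k (stable_rep l) /\
  nth set0 (fset_set (stable_cells T k)) l = stable_class T k (stable_rep l).
Proof.
have fin : finite_set (stable_cells T k).
  apply: contrapT => inf; move: l.
  by rewrite /stable_num fset_set_infinite // cardfs0 => -[].
have : nth set0 (fset_set (stable_cells T k)) l \in fset_set (stable_cells T k).
  by apply: mem_nth; exact: ltn_ord l.
rewrite in_fset_set // => /set_mem[s Ks sE].
have [Kr sr] : stable_class T k s (stable_rep l).
  rewrite /stable_rep -sE; apply: (@xgetI _ set0 _ s); split=> //.
  exact: cell_equiv_refl.
split=> //; rewrite -sE; apply/seteqP; split=> s' [Ks' ss']; split=> //.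
  exact: cell_equiv_trans (cell_equiv_sym sr) ss'.
exact: cell_equiv_trans sr ss'.
Qed.

Lemma stable_rep_inj T k (l l' : 'I_(stable_num T k)) s :
  cell_equiv k T (stable_rep l) T s -> cell_equiv k T (stable_rep l') T s -> l = l'.
Proof.
move=> ls l's; have [_ e] := stable_repP l; have [_ e'] := stable_repP l'.
apply/val_inj/eqP; rewrite -(nth_uniq set0 (ltn_ord l) (ltn_ord l') (fset_uniq _)).
rewrite e e'; apply/eqP/seteqP; split=> r [Kr lr]; split=> //.
  exact: cell_equiv_trans (cell_equiv_trans l's (cell_equiv_sym ls)) lr.
exact: cell_equiv_trans (cell_equiv_trans ls (cell_equiv_sym l's)) lr.
Qed.

(** The number of stable cells is 0 by convention when they are infinitely
    many, whence the hypothesis. *)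
Lemma stable_rep_exists T k s : (0 < stable_num T k)%N -> cells T k s ->
  exists l : 'I_(stable_num T k), cell_equiv k T (stable_rep l) T s.
Proof.
move=> num0 Ks; have fin : finite_set (stable_cells T k).
  apply: contrapT => inf; move: num0; rewrite /stable_num.
  by rewrite fset_set_infinite // cardfs0.
have : stable_class T k s \in fset_set (stable_cells T k).
  by rewrite in_fset_set //; apply/mem_set; exists s.
move=> sin; have := sin; rewrite -index_mem => il.
exists (Ordinal il); have [_ e] := stable_repP (Ordinal il).
have : stable_class T k (stable_rep (Ordinal il)) s; last by case.
by rewrite -e nth_index //; split=> //; exact: cell_equiv_refl.
Qed.

End StableCells.

(** * Cells of a tiling *)

Section TileCells.
Variables (R : realType) (d : nat) (S : substitution R d).
Hypothesis hS : is_substitution S.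
Implicit Types (T P : set (tile S)) (t : tile S) (s e f : set 'rV[R]_d).
Implicit Types (x y : 'rV[R]_d).

Lemma tiling_CW T : Omega T -> is_CW (cells T) setT.
Proof. by case=> -[]. Qed.

Lemma cells_meeting T k X s : cells (meeting T X) k s -> cells T k s.
Proof. by move=> [t [Tt _] ts]; exists t. Qed.

Lemma tile_top t : tile_cells t d (tile_set t).
Proof.
case: hS => _ /(_ t.1)[_ pd _] _; exists (proto t.1) => //.
by rewrite pd.
Qed.

Lemma tile_top_uniq t f : tile_cells t d f -> f = tile_set t.
Proof.
by case: hS => _ /(_ t.1)[_ pd _] _ [s + <-]; rewrite pd => ->.
Qed.

Lemma cells_topP T f : cells T d f <-> exists2 t, T t & f = tile_set t.
Proof.
split=> [[t Tt /tile_top_uniq]|[t Tt ->]]; first by exists t.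
by exists t => //; exact: tile_top.
Qed.

Lemma tile_cell_sub t k s : tile_cells t k s -> s `<=` tile_set t.
Proof.
case: hS => _ /(_ t.1)[[pE _ _ _ _] _ _] _ [s0 Ks0 <-] _ [y sy <-].
by exists y => //; rewrite -pE; exists k => //; exists s0.
Qed.

Lemma stable_num_above T k : (d < k)%N -> stable_num T k = 0%N.
Proof.
move=> dk; rewrite /stable_num (_ : stable_cells T k = set0).
  by rewrite fset_set0 cardfs0.
rewrite -subset0 => C [s [t Tt [s0 Ks0 _]] _].
by case: hS => _ /(_ t.1)[_ _ /(_ k dk) K0] _; rewrite K0 in Ks0.
Qed.

Lemma cells_translate P k x s : cells P k s -> cells (shift x P) k (translate x s).
Proof.
move=> [t Pt [s0 Ks0 <-]]; exists (t.1, t.2 + x); first by exists t.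
by exists s0 => //=; rewrite translateD.
Qed.

(** Distinct tiles meet in lower cells only. *)
Lemma star_top T t : Omega T -> T t -> star T d (tile_set t) = [set t].
Proof.
move=> OT Tt; have CW := tiling_CW OT; have [[_ disj] _] := OT.
have [|x [tx nx]] := cell_interior_neq0 (k := d) (s := tile_set t) CW.
  by apply/cells_topP; exists t.
apply/seteqP; split=> [t' [Tt' [y [t'y [ty ny]]]]|_ ->]; last first.
  by split=> //; exists x; split=> //; split.
apply: contrapT => tt'; apply: ny; apply: (disj t' t) => //.
Qed.

Lemma star_cell T k s t : Omega T -> cells T k s -> T t -> s `<=` tile_set t ->
  star T k s t.
Proof.
move=> OT Ks Tt st; have [x [sx nx]] := cell_interior_neq0 (tiling_CW OT) Ks.
by split=> //; exists x; split; [exact: st|split].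
Qed.

Lemma cell_equiv_translate T t x : Omega T -> T t -> T (t.1, t.2 + x) ->
  cell_equiv d T (tile_set t) T (translate x (tile_set t)).
Proof.
move=> OT Tt Tt'; exists x; split=> //.
have -> : translate x (tile_set t) = tile_set (t.1, t.2 + x).
  by rewrite /tile_set translateD.
rewrite !star_top //; apply/seteqP; split=> [_ ->|_ [_ -> <-] //].
by exists t.
Qed.

Lemma finite_tile_cells T t : Omega T -> T t ->
  finite_set [set c | exists k, tile_cells t k c].
Proof.
move=> OT Tt; have CW := tiling_CW OT; have [_ _ _ fin _] := CW.
have Kt : cells T d (tile_set t) by apply/cells_topP; exists t.
apply: sub_finite_set (fin _ _ Kt) => c [k tc].
have Kc : cells T k c by exists t.
exists k => //; have [x [cx nx]] := cell_interior_neq0 CW Kc.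
by exists x; split; [split|exact: tile_cell_sub tc _ cx].
Qed.

Lemma skeleton_tile t k : skeleton (tile_cells t) k =
  translate t.2 (skeleton (@proto_cells _ _ S t.1) k).
Proof.
apply/seteqP; split=> [x [j jk [_ [s Ks <-]]]|_ [y [j jk [s Ks sy]] <-]].
  by move=> [y sy <-]; exists y => //; exists j => //; exists s.
by exists j => //; exists (translate t.2 s); [exists s|exists y].
Qed.

End TileCells.

(** * Translates of curves *)

Section TranslateCurves.
Variables (R : realType) (d : nat).
Implicit Types (K : nat -> set (set 'rV[R]_d)) (e f B : set 'rV[R]_d).
Implicit Types (x y p a b : 'rV[R]_d) (gamma : R -> 'rV[R]_d).

Lemma translate_continuous (U : topologicalType) (A : set U) (g : U -> 'rV[R]_d) x :
  {within A, continuous g} -> {within A, continuous (fun u => g u + x)}.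
Proof.
move=> cg; apply: (@within_continuousD _ _ 'rV[R]_d) => //.
by apply: continuous_subspaceT => u; exact: cvg_cst.
Qed.

Lemma translate_image (T : Type) (A : set T) (g : T -> 'rV[R]_d) x :
  (fun u => g u + x) @` A = translate x (g @` A).
Proof. by rewrite /translate image_comp. Qed.

Lemma jordan_translate gamma B x : jordan gamma B ->
  jordan (fun t => gamma t + x) (translate x B).
Proof.
move=> [cg g01 inj <-]; split; last exact: translate_image.
- exact: translate_continuous.
- by rewrite g01.
- by move=> u v u01 v01 /addIr; exact: inj.
Qed.

Lemma crdD x y k : crd (x + y) k = crd x k + crd y k.
Proof. by rewrite /crd; case: insub => [i|] /=; rewrite ?mxE ?addr0. Qed.

Lemma has_winding_translate gamma p (w : R) x : has_winding gamma p w ->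
  has_winding (fun t => gamma t + x) (p + x) w.
Proof.
move=> [theta [rho [ct h e]]]; exists theta, rho; split=> // u /h[r0 e0 e1].
by split=> //; rewrite !crdD ?e0 ?e1; ring.
Qed.

(** The hypothesis is needed because the boundary of [f] is cut out by all the
    cells of [K], which need not be invariant under the translation. *)
Lemma traverses_translate K f e a b x :
  cell_boundary K 2 (translate x f) = translate x (cell_boundary K 2 f) ->
  traverses K f e a b ->
  traverses K (translate x f) (translate x e) (a + x) (b + x).
Proof.
move=> bdE [gamma [u [ccw u01 g0 gu ge]]].
exists (fun t => gamma t + x), u; split=> //; last 1 first.
- by rewrite translate_image ge.
- have [cg g01 inj im [win wout]] := ccw.
  have [cg' g01' inj' im'] := jordan_translate x (ccw_jordan ccw).
  split=> //; first by rewrite bdE.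
  split=> p; [move=> [/translateP fp np]|move=> np];
      rewrite -[p](subrK x); apply: has_winding_translate.
    apply: win; split=> // Kp; apply: np.
    have : translate x (cell_boundary K 2 f) p by apply/translateP; split.
    by rewrite -bdE => -[].
  by apply: wout => fp; apply: np; apply/translateP.
- by rewrite g0.
- by rewrite gu.
Qed.

End TranslateCurves.

(** * Boundaries of tiles *)

Section Faces.
Variables (R : realType) (S : substitution R 2).
Hypothesis hS : is_substitution S.
Implicit Types (T P : set (tile S)) (t : tile S) (s e f : set 'rV[R]_2).
Implicit Types (x y v : 'rV[R]_2).

(** The lower cells of the tiling might a priori subdivide or enter the tile
    further than its own cells do. But both boundaries are simple closed curves
    and one contains the other. *)
Lemma tile_boundary T t : Omega T -> T t ->
  cell_boundary (cells T) 2 (tile_set t) = cell_boundary (tile_cells t) 2 (tile_set t).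
Proof.
move=> OT Tt; have [_ hK _ _ _] := tiling_CW OT.
have [|phi [homeo_phi phiS]] := hK 2%N (tile_set t).
  by apply/(cells_topP hS); exists t.
have J := jordan_disk_boundary homeo_phi; rewrite phiS in J.
case: (hS) => _ /(_ t.1)[[_ hKt _ _ _] pd _] _.
have [|psi [homeo_psi psiS]] := hKt 2%N (proto t.1); first by rewrite pd.
have J' := jordan_translate t.2 (jordan_disk_boundary homeo_psi); rewrite psiS in J'.
have bdE : translate t.2 (cell_boundary (@proto_cells _ _ S t.1) 2 (proto t.1)) =
    cell_boundary (tile_cells t) 2 (tile_set t).
  rewrite /cell_boundary skeleton_tile //.
  by apply/seteqP; split=> y; rewrite translateP /= => -[? ?]; split; apply/translateP.
rewrite bdE in J'.
apply/esym/(jordan_subset (@rV_hausdorff R 2) J J') => y [ty [j j2 [s Ks sy]]].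
by split=> //; exists j => //; exists s => //; exists t.
Qed.

Lemma tile_boundary_translate T t x : Omega T -> T t -> T (t.1, t.2 + x) ->
  cell_boundary (cells T) 2 (translate x (tile_set t)) =
  translate x (cell_boundary (cells T) 2 (tile_set t)).
Proof.
move=> OT Tt Tt'.
have tE : translate x (tile_set t) = tile_set (t.1, t.2 + x).
  by rewrite /tile_set translateD.
rewrite tE !tile_boundary // /cell_boundary !skeleton_tile -tE.
apply/seteqP; split=> y.
  move=> [/translateP ty /translateP sy]; apply/translateP; split=> //.
  by apply/translateP; move: sy; rewrite opprD addrA addrAC.
move=> /translateP[ty /translateP sy]; split; first exact/translateP.
by apply/translateP; move: sy; rewrite opprD addrA addrAC.
Qed.


End Faces.

(** * Incidences in planar tilings *)

Section Incidence.
Variables (R : realType) (S : substitution R 2).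
Hypothesis hS : is_substitution S.
Variable o : set (tile S) -> set 'rV[R]_2 -> 'rV[R]_2 * 'rV[R]_2.
Hypothesis ho : is_orientation o.
Variable T : set (tile S).
Hypothesis OT : Omega T.
Implicit Types (s e f : set 'rV[R]_2) (x y v : 'rV[R]_2).

Let K := cells T.
Let CW : is_CW K setT := tiling_CW OT.

Lemma traverses_ends f e x y : traverses K f e x y ->
  [/\ e x, e y, x <> y & e `<=` cell_boundary K 2 f].
Proof.
move=> [gamma [u [ccw u01 g0 gu ge]]]; have J := ccw_jordan ccw; split.
- by rewrite -ge -g0; exists 0 => //; apply/itv_ccP; apply/andP; split; lra.
- by rewrite -ge -gu; exists u => //; apply/itv_ccP; apply/andP; split; lra.
- rewrite -g0 -gu => /(jordan_inj J); rewrite lexx ler01 => /(_ isT u01).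
  lra.
- rewrite -ge => _ [t /itv_ccP t01 <-]; apply: (jordan_mem J).
  by apply/andP; split; lra.
Qed.

Lemma incidence_evE e v : incidence_ev T o e [set v] =
  if `[< v = (o T e).1 >] then -1 else if `[< v = (o T e).2 >] then 1 else 0.
Proof.
have sE w : ([set v] = [set w]) = (v = w).
  apply/propext; split=> [vw|->//]; have : [set w] v by rewrite -vw.
  by [].
by rewrite /incidence_ev !sE.
Qed.

Lemma incidence_ev_mem e v : K 1 e -> incidence_ev T o e [set v] != 0 -> e v.
Proof.
move=> Ke; have [/(_ T e OT Ke)[_ _ e1 e2 _] _] := ho; rewrite incidence_evE.
by case: asboolP => [->//|_]; case: asboolP => [->//|_]; rewrite eqxx.
Qed.

Lemma incidence_fe_traverses f e : incidence_fe T o f e != 0 ->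
  traverses K f e (o T e).1 (o T e).2 \/ traverses K f e (o T e).2 (o T e).1.
Proof.
by rewrite /incidence_fe; case: asboolP => [|_]; [left|case: asboolP; [right|rewrite eqxx]].
Qed.

Lemma incidence_fe_sub f e : incidence_fe T o f e != 0 -> e `<=` f.
Proof.
by case/incidence_fe_traverses => /traverses_ends[_ _ _ sub] y /sub[].
Qed.

Lemma incidence_fe_val f e :
  [\/ incidence_fe T o f e = 1, incidence_fe T o f e = -1 | incidence_fe T o f e = 0].
Proof.
rewrite /incidence_fe; case: asboolP => _; first by apply: Or31.
by case: asboolP => _; [apply: Or32|apply: Or33].
Qed.

Lemma orientation_ends e v y : K 1 e -> K 0 [set v] -> K 0 [set y] -> e v -> e y ->
  v <> y -> o T e = (v, y) \/ o T e = (y, v).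
Proof.
move=> Ke Kv Ky ev ey vy; have [_ bd] := edge_arc CW Ke Kv Ky ev ey vy.
have [/(_ T e OT Ke)[K1 K2 e1 e2 ne] _] := ho.
case E : (o T e) K1 K2 e1 e2 ne => [a b] /= K1 K2 e1 e2 ne.
have [aE|aE] := bd _ e1 (vertex_skeleton (k := 1) isT K1);
  have [bE|bE] := bd _ e2 (vertex_skeleton (k := 1) isT K2); rewrite aE bE;
  [by case: ne; rewrite aE bE|by left|by right|by case: ne; rewrite aE bE].
Qed.

Lemma incidence_outgoing f e v y : K 2 f -> K 1 e -> K 0 [set v] -> K 0 [set y] ->
  traverses K f e v y -> incidence_ev T o e [set v] * incidence_fe T o f e = -1.
Proof.
move=> Kf Ke Kv Ky tr; have [ev ey vy _] := traverses_ends tr.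
have ntr := traverses_antisym CW Kf tr.
have [oE|oE] := orientation_ends Ke Kv Ky ev ey vy;
    rewrite incidence_evE /incidence_fe oE /=.
  by rewrite asboolT // asboolT // mulr1.
by rewrite asboolF // asboolT // asboolF // asboolT // mul1r.
Qed.

Lemma incidence_incoming f e v y : K 2 f -> K 1 e -> K 0 [set v] -> K 0 [set y] ->
  traverses K f e y v -> incidence_ev T o e [set v] * incidence_fe T o f e = 1.
Proof.
move=> Kf Ke Kv Ky tr; have [ey ev yv _] := traverses_ends tr.
have ntr := traverses_antisym CW Kf tr.
have vy : v <> y by move=> vy; apply: yv.
have [oE|oE] := orientation_ends Ke Kv Ky ev ey vy;
    rewrite incidence_evE /incidence_fe oE /=.
  by rewrite asboolT // asboolF // asboolT // mulN1r opprK.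
by rewrite asboolF // asboolT // asboolT // mul1r.
Qed.

Lemma traverses_final f gamma (w : R) : counterclockwise K f gamma -> 0 < w < 1 ->
  traverses K f (gamma @` `[w, 1]%classic) (gamma w) (gamma 0).
Proof.
move=> ccw w01; exists (rotate gamma w), (1 - w); split.
- exact: ccw_rotate.
- by apply/andP; split; lra.
- by rewrite rotate_start.
- by rewrite /rotate subrK lexx; case: ccw => _ <- _ _ _.
- apply/seteqP; split=> [_ [t /itv_ccP t01 <-]|_ [t /itv_ccP t01 <-]].
    exists (t + w); first by apply/itv_ccP; apply/andP; split; lra.
    by rewrite /rotate ifT //; lra.
  exists (t - w); first by apply/itv_ccP; apply/andP; split; lra.
  by rewrite /rotate subrK ifT //; lra.
Qed.

(** The boundary of the face is covered by its vertices and edges. The incoming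
    edge is the outgoing one of the reversed curve. *)
Lemma edges_of_face_at_vertex t gamma v : T t -> K 0 [set v] ->
  counterclockwise K (tile_set t) gamma -> gamma 0 = v ->
  exists e e' y y',
    [/\ tile_cells t 1 e /\ tile_cells t 1 e', K 0 [set y] /\ K 0 [set y'],
        traverses K (tile_set t) e v y & traverses K (tile_set t) e' y' v].
Proof.
move=> Tt Kv ccw g0; have J := ccw_jordan ccw.
pose N := [set c | tile_cells t 0 c \/ tile_cells t 1 c].
have Nfin : finite_set N.
  apply: sub_finite_set (finite_tile_cells hS OT Tt) => c [tc|tc].
    by exists 0%N.
  by exists 1%N.
have NK c : N c -> K 0 c \/ (K 1 c /\ c `<=` cell_boundary K 2 (tile_set t)).
  case=> tc; [left; by exists t|right]; split; first by exists t.
  move=> y cy; split; first exact: (tile_cell_sub hS tc).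
  by exists 1%N => //; exists c => //; exists t.
have cover y : cell_boundary K 2 (tile_set t) y -> exists2 c, N c & c y.
  rewrite /K tile_boundary // => -[_ [j /= j2 [c tc cy]]]; exists c => //.
  by case: j j2 tc => [|[|//]] _ tc; [left|right].
have cell1 e : N e -> K 1 e -> tile_cells t 1 e.
  case=> // t0 Ke; exfalso.
  have K0e : K 0 e by exists t.
  have [w wE] := vertex_singleton CW K0e.
  have [x [ex nx]] := cell_interior_neq0 CW Ke; apply: nx.
  by exists 0%N => //; exists e.
have [e [u [Ne Ke u01 ue Ku]]] := edge_at_start CW Nfin NK cover J g0 Kv.
have J' := jordan_rev J.
have g0' : gamma (1 - 0) = v by rewrite subr0; case: J => _ <- _ _.
have [e' [u' [Ne' Ke' u'01 ue' Ku']]] := edge_at_start CW Nfin NK cover J' g0' Kv.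
have w01 : 0 < 1 - u' < 1 by apply/andP; split; lra.
exists e, e', (gamma u), (gamma (1 - u')); split => //.
- by split; apply: cell1.
- by exists gamma, u.
- have := traverses_final ccw w01; rewrite -rev_image.
  by rewrite (_ : 1 - (1 - u') = u') ?ue' ?g0 //; ring.
Qed.

(** Walking around the face, one enters [v] by one edge and leaves it by
    another, with opposite signs. If the face had no counterclockwise
    parametrization, all its incidence numbers would be 0. *)
Lemma face_vertex_sum (E : set (set 'rV[R]_2)) t v : T t -> K 0 [set v] ->
  E `<=` K 1 -> (forall e, tile_cells t 1 e -> e v -> E e) -> tile_set t v ->
  \sum_(e \in E) incidence_ev T o e [set v] * incidence_fe T o (tile_set t) e = 0.
Proof.
move=> Tt Kv EK Ev tv; set f := tile_set t.
have Kf : K 2 f by apply/(cells_topP hS); exists t.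
have [[gamma0 ccw0]|nccw] := pselect (exists gamma, counterclockwise K f gamma); last first.
  apply: fsbig1 => e _; rewrite [X in _ * X](_ : _ = 0) ?mulr0 //.
  apply/eqP/negP => /negP/incidence_fe_traverses[] [gamma [u [ccw _ _ _ _]]];
  by apply: nccw; exists gamma.
have [gamma ccw g0] : exists2 gamma, counterclockwise K f gamma & gamma 0 = v.
  have [|c c01 cv] := jordan_memP (ccw_jordan ccw0) (x := v).
    by split=> //; exact: vertex_skeleton.
  have [c0|c0] := eqVneq c 0; first by exists gamma0 => //; rewrite -cv c0.
  have c01' : 0 < c < 1 by apply/andP; split; lra.
  by exists (rotate gamma0 c); [exact: ccw_rotate|rewrite rotate_start].
have [e [e' [y [y' [[te te'] [Ky Ky'] tr tr']]]]] :=
  edges_of_face_at_vertex Tt Kv ccw g0.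
have Ke : K 1 e by exists t.
have Ke' : K 1 e' by exists t.
have [ev ey vy _] := traverses_ends tr; have [e'y' e'v y'v _] := traverses_ends tr'.
have ee' : e <> e'.
  move=> ee'; rewrite -ee' in tr' e'y'.
  have [_ bd] := edge_arc CW Ke Kv Ky ev ey vy.
  have [y'E|y'E] := bd _ e'y' (vertex_skeleton (k := 1) isT Ky'); first by apply: y'v.
  by apply: (traverses_antisym CW Kf tr); rewrite -y'E.
rewrite -(@fsbig_widen _ _ _ _ ([set e] `|` [set e'])).
- rewrite fsbigU0 ?fsbig_set1 //; last by move=> _ [/= ->].
  rewrite (incidence_outgoing Kf Ke Kv Ky tr) (incidence_incoming Kf Ke' Kv Ky' tr').
  by rewrite /= addNr.
- by move=> _ [->|->]; apply: Ev.
- move=> c [Ec nc] /=; apply: contrapT => /eqP; rewrite mulf_eq0 negb_or => /andP[c1 c2].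
  have Kc := EK _ Ec; apply: nc.
  have [/(_ T c OT Kc)[K1 K2 _ _ _] _] := ho.
  have vE : v = (o T c).1 \/ v = (o T c).2.
    move: c1; rewrite incidence_evE; case: asboolP => [->|_]; first by left.
    by case: asboolP => [->|_]; [right|rewrite eqxx].
  have [tc|tc] := incidence_fe_traverses c2; case: vE => vE; rewrite -vE in tc.
  + by left; rewrite /= (outgoing_edge_uniq CW Kf Ke Kc Kv Ky tr tc).
  + by right; rewrite /= (incoming_edge_uniq CW Kf Ke' Kc Kv Ky' tr' tc).
  + by right; rewrite /= (incoming_edge_uniq CW Kf Ke' Kc Kv Ky' tr' tc).
  + by left; rewrite /= (outgoing_edge_uniq CW Kf Ke Kc Kv Ky tr tc).
Qed.

End Incidence.

(** * The complex of a planar tiling *)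

Section DimensionTwo.
Variables (R : realType) (S : substitution R 2).
Hypothesis hS : is_substitution S.
Variable o : set (tile S) -> set 'rV[R]_2 -> 'rV[R]_2 * 'rV[R]_2.
Hypothesis ho : is_orientation o.
Variable T : set (tile S).
Hypothesis OT : Omega T.
Implicit Types (s e f : set 'rV[R]_2) (x y v : 'rV[R]_2).

Let K := cells T.
Let CW : is_CW K setT := tiling_CW OT.

Lemma incidence_fe_translate t e x : T t -> T (t.1, t.2 + x) -> K 1 e ->
  equiv_by x 1 T e T (translate x e) -> K 1 (translate x e) ->
  incidence_fe T o (translate x (tile_set t)) (translate x e) =
  incidence_fe T o (tile_set t) e.
Proof.
move=> Tt Tt' Ke eqe Kxe; have [_ /(_ T e T (translate x e) x OT OT Ke Kxe eqe) oE] := ho.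
have bdE := tile_boundary_translate hS OT Tt Tt'.
have bdE' : cell_boundary K 2 (translate (- x) (translate x (tile_set t))) =
    translate (- x) (cell_boundary K 2 (translate x (tile_set t))).
  by rewrite translateK bdE translateK.
have trE a b : `[< traverses K (translate x (tile_set t)) (translate x e) (a + x) (b + x) >]
    = `[< traverses K (tile_set t) e a b >].
  congr asbool; apply/propext; split; last exact: traverses_translate bdE.
  by move=> /(traverses_translate bdE'); rewrite !translateK !addrK.
by rewrite /incidence_fe oE /= !trE.
Qed.

(** The coefficient of a stable face in the coboundary of an edge can be computed
    at any translate of the edge with the same star. The faces may be taken to
    be those through a given point [v] of the edge, which makes the index set
    the same for all the edges at [v]. *)
Lemma stable_incidence_sum (C : set (set 'rV[R]_2)) e x v :
  (forall t, T t -> T (t.1, t.2 + x) -> C (tile_set t) <-> C (translate x (tile_set t))) ->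
  K 1 e -> K 1 (translate x e) -> equiv_by x 1 T e T (translate x e) ->
  translate x e v ->
  \sum_(f \in cells (star T 1 e) 2 `&` C) incidence_fe T o f e =
  \sum_(f \in [set f | K 2 f /\ f v] `&` C) incidence_fe T o f (translate x e).
Proof.
move=> CE Ke Ke' eqe e'v; have [_ starE] := eqe.
have tE t : translate x (tile_set t) = tile_set (t.1, t.2 + x).
  by rewrite /tile_set translateD.
transitivity (\sum_(f \in cells (star T 1 (translate x e)) 2 `&` C)
    incidence_fe T o f (translate x e)).
  have topE (t' : tile S) f : tile_cells t' 2 f -> f = tile_set t' by exact: (tile_top_uniq hS).
  rewrite [RHS](@reindex_fsbig _ _ _ _ _ (translate x) (cells (star T 1 e) 2 `&` C)).
    apply: eq_fsbigr => f /set_mem[[t st tf] Cf].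
    have Tt : T t by case: st.
    have [Tt' _] : star T 1 (translate x e) (t.1, t.2 + x) by rewrite starE; exists t.
    by rewrite (topE _ _ tf) incidence_fe_translate.
  split.
  - move=> f [[t st tf] Cf]; have Tt : T t by case: st.
    have [Tt' _] : star T 1 (translate x e) (t.1, t.2 + x) by rewrite starE; exists t.
    rewrite (topE _ _ tf) in Cf *; split; last exact/CE.
    rewrite starE; apply: cells_translate; exists t => //; exact: (tile_top hS).
  - by move=> f f' _ _ /(congr1 (translate (- x))); rewrite !translateK.
  - move=> f [[t' st' tf'] Cf]; rewrite starE in st'.
    have [t st tE'] := st'; have Tt : T t by case: st.
    have [Tt' _] : star T 1 (translate x e) (t.1, t.2 + x) by rewrite starE; exists t.
    exists (tile_set t); last by rewrite (topE _ _ tf') tE tE'.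
    split; first by exists t => //; exact: (tile_top hS).
    by apply/CE => //; rewrite tE tE' -(topE _ _ tf').
rewrite fsbig_supp [RHS]fsbig_supp; apply: eq_fsbigl.
apply/seteqP; split=> f [[h Cf] /= /eqP fe]; split=> //=; try exact/eqP; split=> //.
  split; first exact: cells_meeting h.
  exact: (incidence_fe_sub fe).
have [Kf fv] := h; have [t Tt fE] := proj1 (cells_topP hS _ _) Kf.
exists t; last by rewrite fE; exact: (tile_top hS).
by apply: star_cell => //; rewrite -fE; exact: incidence_fe_sub fe.
Qed.

(** Exchanging the sums over the edges at [v] and over the faces at [v], the
    coefficient of a stable face is a sum of the vanishing sums of
    [face_vertex_sum]. *)
Theorem delta_delta : delta T o 1 *m delta T o 0 = 0.
Proof.
apply/matrixP => j i; rewrite mxE [RHS]mxE.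
have [num0|num0] := posnP (stable_num T 1).
  by apply: big1 => l _; have := ltn_ord l; rewrite [X in (_ < X)%N]num0.
have [Kv _] := stable_repP i.
have [v vE] := vertex_singleton CW Kv.
have Kv0 : K 0 [set v] by rewrite -vE.
pose E := [set e | K 1 e /\ e v] `&` cells (star T 0 [set v]) 1.
have Efin : finite_set E by apply: finite_setIl; exact: (locally_finite (k := 1) CW).
pose F := [set f | K 2 f /\ f v].
have Ffin : finite_set F by exact: (locally_finite (k := 2) CW).
pose C2 := [set f | cell_equiv 2 T (stable_rep j) T f].
pose C1 (l : 'I_(stable_num T 1)) := [set e | cell_equiv 1 T (stable_rep l) T e].
pose D e := \sum_(f \in F `&` C2) incidence_fe T o f e.
have C2E t x : T t -> T (t.1, t.2 + x) -> C2 (tile_set t) <-> C2 (translate x (tile_set t)).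
  move=> Tt Tt'; have teq := cell_equiv_translate hS OT Tt Tt'.
  split=> [jt|jt]; first exact: cell_equiv_trans jt teq.
  exact: cell_equiv_trans jt (cell_equiv_sym teq).
have d1 l e : E e -> C1 l e -> delta T o 1 j l = D e.
  move=> [[Ke ev] _] [x eqx]; rewrite mxE; have [eE _] := eqx.
  have [Kl _] := stable_repP l.
  rewrite eE in eqx ev Ke; rewrite /D eE.
  exact: (stable_incidence_sum (fun t => C2E t x) Kl Ke eqx ev).
have d0 l : delta T o 0 l i =
    \sum_(e \in E) (if e \in C1 l then incidence_ev T o e [set v] else 0).
  rewrite mxE -fsbig_mkcondr vE.
  rewrite [LHS]fsbig_supp [RHS]fsbig_supp; apply: eq_fsbigl.
  apply/seteqP; split=> e [[h Ce] /= /eqP ne]; split=> //=; try exact/eqP; split=> //.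
    split=> //; have Ke := cells_meeting h; split=> //.
    exact: (incidence_ev_mem ho OT Ke ne).
  by case: h.
transitivity (\sum_(e \in E) incidence_ev T o e [set v] * D e).
  under eq_bigr do rewrite d0 mulr_fsumr fsbig_finite //.
  rewrite exchange_big fsbig_finite //=; rewrite !big_seq; apply: eq_bigr => e.
  rewrite in_fset_set // => /set_mem Ee.
  have [[Ke _] _] := Ee.
  have [l le] := stable_rep_exists num0 Ke.
  rewrite (bigD1 l) //= big1 => [|l' l'l].
    by rewrite addr0 mem_set // (d1 l e) // mulrC.
  case: ifPn => [/set_mem Ce|]; last by rewrite mulr0.
  by move: l'l; rewrite (stable_rep_inj Ce le) eqxx.
under eq_fsbigr do rewrite mulr_fsumr.
rewrite exchange_fsbig //; last exact: finite_setIl.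
apply: fsbig1 => f [[Kf fv] _].
have [t Tt fE] := proj1 (cells_topP hS _ _) Kf; rewrite fE in fv *.
apply: face_vertex_sum => //; first by move=> e [[]].
move=> e te ev; split; first by split=> //; exists t.
exists t => //; apply: star_cell => // _ ->.
exact: (tile_cell_sub hS te).
Qed.

End DimensionTwo.

(** A nonzero multiple of x can be a boundary only if x is a cycle, since Z^p has no
    torsion. *)
Lemma torsion_free_saturated (p n m : nat) (D : 'M[int]_(p, n)) (B : 'M[int]_(n, m)) :
  D *m B = 0 -> torsion_free (homology D B) -> saturated B.
Proof.
move=> DB tf x k k0 [y xy].
have Dx : D *m x = 0.
  apply: (colZ_mulrn_eq0 k0).
  by rewrite -raddfMn /= xy mulmxA DB mul0mx.
pose z := insubd (0 : cycles D) x.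
have zx : val z = x by rewrite /z insubdK // inE Dx.
have piB (u w : cycles D) : \pi_(homology D B)%qT (u - w) =
    \pi_(homology D B)%qT u - \pi_(homology D B)%qT w.
  exact: pi_is_zmod_morphism.
have pi0 : \pi_(homology D B)%qT (0 : cycles D) = 0 by rewrite -(subrr 0) piB subrr.
have piMn j : (\pi_(homology D B)%qT z) *+ j = \pi_(homology D B)%qT (z *+ j).
  elim: j => [|j IH]; first by rewrite !mulr0n pi0.
  rewrite !mulrS IH -[in RHS](opprK (z *+ j)) piB; congr (_ + _).
  by rewrite -[in RHS]sub0r piB pi0 sub0r opprK.
have val0 : val (0 : cycles D) = 0 by [].
have valMn : val (z *+ k) = x *+ k by rewrite -zx; exact: raddfMn.
have : \pi_(homology D B)%qT z = 0.
  apply: (tf _ k k0); rewrite piMn -pi0; apply/eqP/homology_eqP; exists y.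
  by rewrite val0 subr0 valMn.
rewrite -pi0 => /eqP/homology_eqP[w]; rewrite val0 subr0 zx => ->.
by exists w.
Qed.

Section SaturatedTwo.
Variables (R : realType) (S : substitution R 2).
Hypothesis hS : is_substitution S.
Variable o : set (tile S) -> set 'rV[R]_2 -> 'rV[R]_2 * 'rV[R]_2.
Variable T : set (tile S).
Hypothesis OT : Omega T.

Lemma faces_meet (f f' : set 'rV[R]_2) : cells T 2 f -> cells T 2 f' -> f <> f' ->
  f `&` f' `<=` skeleton (cells T) 2.
Proof.
move=> /(cells_topP hS)[t Tt ->] /(cells_topP hS)[t' Tt' ->] tt'.
by have [_ disj] := OT.1; apply: disj => // e; apply: tt'; rewrite e.
Qed.

(** In the graph, the stable faces are the vertices, and each stable edge joins
    the face on its left to the face on its right. *)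
Lemma saturated_delta1 : saturated (delta T o 1).
Proof.
apply: (@saturated_graph _ _ _ (fun=> 1)) => [//|i].
have CW := tiling_CW OT.
have uniq e a b f f' : cells T 2 f -> cells T 2 f' ->
    traverses (cells T) f e a b -> traverses (cells T) f' e a b -> f = f'.
  move=> Kf Kf' tr tr'; apply: contrapT => ff'.
  exact: (same_side_eq CW Kf Kf' (faces_meet Kf Kf' ff') tr tr').
have [||a [b ab]] := @fsum_column _ _
    (fun j : 'I_(stable_num T 2) => [set f | cell_equiv 2 T (stable_rep j) T f])
    (cells (star T 1 (stable_rep i)) 2)
    (fun f => incidence_fe T o f (stable_rep i))
    (fun f => incidence_fe T o f (stable_rep i)) (fun=> 1)
    (fun j j' f => @stable_rep_inj _ _ _ T 2 j j' f)
    (fun j f _ _ => mul1r _) (fun f _ => incidence_fe_val o T f (stable_rep i)) _ _.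
- move=> f f' /cells_meeting Kf /cells_meeting Kf'; rewrite /incidence_fe.
  case: asboolP => [tr _|_]; last by case: asboolP.
  case: asboolP => [tr' _|_]; last by case: asboolP.
  exact: uniq tr tr'.
- move=> f f' /cells_meeting Kf /cells_meeting Kf'; rewrite /incidence_fe.
  case: asboolP => // _; case: asboolP => // tr _.
  case: asboolP => // _; case: asboolP => // tr' _.
  exact: uniq tr tr'.
by exists a, b => j; rewrite mxE; exact: ab.
Qed.

End SaturatedTwo.

(** * Tilings of the line *)

Section DimensionOne.
Variables (R : realType) (S : substitution R 1).
Variable o : set (tile S) -> set 'rV[R]_1 -> 'rV[R]_1 * 'rV[R]_1.
Hypothesis ho : is_orientation o.
Variable T : set (tile S).
Hypothesis OT : Omega T.
Implicit Types (e : set 'rV[R]_1) (v w x : 'rV[R]_1).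

Let K := cells T.
Let CW : is_CW K setT := tiling_CW OT.

Lemma rV1_eq v w : v 0 0 = w 0 0 -> v = w.
Proof. by move=> e; apply/rowP => i; rewrite ord1. Qed.

(** An edge is connected, and its only vertices are its two ends. *)
Lemma edge_interval e v w : K 1 e -> K 0 [set v] -> K 0 [set w] -> e v -> e w ->
  v 0 0 < w 0 0 -> forall x, v 0 0 < x 0 0 < w 0 0 -> e x /\ ~ skeleton K 1 x.
Proof.
move=> Ke Kv Kw ev ew vw x xvw.
have nvw : v <> w by move=> E; move: vw; rewrite E ltxx.
have [[psi [cpsi _ psie [psi0 psi1]]] bd] := edge_arc CW Ke Kv Kw ev ew nvw.
have ccoord : {within `[0, 1]%classic, continuous (fun t => psi t 0 0)}.
  apply: (@comp_continuous_within R _ R _ setT psi (fun y => y 0 0) _ cpsi) => //.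
  by apply: continuous_subspaceT => y; exact: coord_continuous.
have [|t t01 tx] := IVT_segment (v := x 0 0) ler01 ccoord.
  by left; rewrite psi0 psi1; apply/andP; split; lra.
have ex : e x by rewrite -(rV1_eq tx) -psie; exists t => //; exact/itv_ccP.
by split=> // /(bd _ ex)[] xE; move: xvw; rewrite xE ltxx ?andbF.
Qed.

(** Multiplying by it replaces the chosen orientation by the increasing one. *)
Definition edge_sign e : int := if (o T e).1 0 0 < (o T e).2 0 0 then 1 else -1.

Lemma edge_signE e v : K 1 e ->
  [\/ edge_sign e * incidence_ev T o e [set v] = 1 /\
        [/\ K 0 [set v], e v & exists w, [/\ K 0 [set w], e w & w 0 0 < v 0 0]],
     edge_sign e * incidence_ev T o e [set v] = -1 /\
        [/\ K 0 [set v], e v & exists w, [/\ K 0 [set w], e w & v 0 0 < w 0 0]] |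
     edge_sign e * incidence_ev T o e [set v] = 0].
Proof.
move=> Ke; have [/(_ T e OT Ke)[K1 K2 e1 e2 ne] _] := ho.
have ne0 : (o T e).1 0 0 != (o T e).2 0 0.
  by apply/negP => /eqP/rV1_eq.
have sE w : ([set v] = [set w]) = (v = w).
  apply/propext; split=> [vw|->//]; have : [set w] v by rewrite -vw.
  by [].
rewrite /incidence_ev !sE /edge_sign.
case: asboolP => [->|_]; last case: asboolP => [->|_]; last by rewrite mulr0; apply: Or33.
- case: ltgtP ne0 => // lt12 _.
    by apply: Or32; rewrite mul1r; split=> //; split=> //; exists (o T e).2.
  by apply: Or31; rewrite mulN1r opprK; split=> //; split=> //; exists (o T e).2.
- case: ltgtP ne0 => // lt12 _.
    by apply: Or31; rewrite mul1r; split=> //; split=> //; exists (o T e).1.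
  by apply: Or32; rewrite mulN1r; split=> //; split=> //; exists (o T e).1.
Qed.

(** Two edges with upper end [v] share the points just below [v]. *)
Lemma lower_edge_uniq e e' v w w' : K 1 e -> K 1 e' -> K 0 [set v] ->
  K 0 [set w] -> K 0 [set w'] -> e v -> e' v -> e w -> e' w' ->
  w 0 0 < v 0 0 -> w' 0 0 < v 0 0 -> e = e'.
Proof.
move=> Ke Ke' Kv Kw Kw' ev e'v ew e'w' wv w'v.
pose x : 'rV[R]_1 := const_mx ((Num.max (w 0 0) (w' 0 0) + v 0 0) / 2).
have [wx w'x] : w 0 0 < x 0 0 /\ w' 0 0 < x 0 0.
  rewrite mxE; have [h|h] := leP (w 0 0) (w' 0 0); split; lra.
have xv : x 0 0 < v 0 0.
  by rewrite mxE; have [h|h] := leP (w 0 0) (w' 0 0); lra.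
have [|ex nx] := edge_interval Ke Kw Kv ew ev wv (x := x); first by rewrite wx xv.
have [|e'x _] := edge_interval Ke' Kw' Kv e'w' e'v w'v (x := x); first by rewrite w'x xv.
exact: cell_interior_eq CW Ke Ke' ex e'x nx.
Qed.

Lemma upper_edge_uniq e e' v w w' : K 1 e -> K 1 e' -> K 0 [set v] ->
  K 0 [set w] -> K 0 [set w'] -> e v -> e' v -> e w -> e' w' ->
  v 0 0 < w 0 0 -> v 0 0 < w' 0 0 -> e = e'.
Proof.
move=> Ke Ke' Kv Kw Kw' ev e'v ew e'w' vw vw'.
pose x : 'rV[R]_1 := const_mx ((Num.min (w 0 0) (w' 0 0) + v 0 0) / 2).
have [xw xw'] : x 0 0 < w 0 0 /\ x 0 0 < w' 0 0.
  by rewrite mxE; have [h|h] := leP (w 0 0) (w' 0 0); split; lra.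
have vx : v 0 0 < x 0 0.
  by rewrite mxE; have [h|h] := leP (w 0 0) (w' 0 0); lra.
have [|ex nx] := edge_interval Ke Kv Kw ev ew vw (x := x); first by rewrite xw vx.
have [|e'x _] := edge_interval Ke' Kv Kw' e'v e'w' vw' (x := x); first by rewrite xw' vx.
exact: cell_interior_eq CW Ke Ke' ex e'x nx.
Qed.

Lemma edge_sign_equiv e e' : K 1 e -> K 1 e' -> cell_equiv 1 T e T e' ->
  edge_sign e' = edge_sign e.
Proof.
move=> Ke Ke' [x eqx]; have [_ /(_ T e T e' x OT OT Ke Ke' eqx) oE] := ho.
by rewrite /edge_sign oE /= !mxE ltrD2r.
Qed.

(** After the change of signs, each stable vertex is an edge of the graph that
    joins the stable edge below it to the one above it. *)
Lemma saturated_delta0_dim1 : saturated (delta T o 0).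
Proof.
apply: (@saturated_graph _ _ _ (fun j => edge_sign (stable_rep j))) => [j|i].
  by rewrite /edge_sign; case: ifP.
have [Kv _] := stable_repP i.
have [v vE] := vertex_singleton CW Kv.
have [||||a [b ab]] := @fsum_column _ _
    (fun j : 'I_(stable_num T 1) => [set e | cell_equiv 1 T (stable_rep j) T e])
    (cells (star T 0 (stable_rep i)) 1)
    (fun e => incidence_ev T o e (stable_rep i))
    (fun e => edge_sign e * incidence_ev T o e (stable_rep i))
    (fun j => edge_sign (stable_rep j))
    (fun j j' e => @stable_rep_inj _ _ _ T 1 j j' e).
- move=> j e /cells_meeting Ke je; have [Kj _] := stable_repP j.
  by rewrite (edge_sign_equiv Kj Ke je).
- move=> e /cells_meeting Ke; rewrite vE.
  by case: (edge_signE v Ke) => [[? _]|[? _]|?]; [apply: Or31|apply: Or32|apply: Or33].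
- move=> e e' /cells_meeting Ke /cells_meeting Ke'; rewrite vE.
  case: (edge_signE v Ke) => [[_ [K0 ev [w [Kw ew wv]]]]|[-> _]|->] // _.
  case: (edge_signE v Ke') => [[_ [_ e'v [w' [Kw' e'w' w'v]]]]|[-> _]|->] // _.
  exact: (lower_edge_uniq Ke Ke' K0 Kw Kw').
- move=> e e' /cells_meeting Ke /cells_meeting Ke'; rewrite vE.
  case: (edge_signE v Ke) => [[-> _]|[_ [K0 ev [w [Kw ew wv]]]]|->] // _.
  case: (edge_signE v Ke') => [[-> _]|[_ [_ e'v [w' [Kw' e'w' w'v]]]]|->] // _.
  exact: (upper_edge_uniq Ke Ke' K0 Kw Kw').
by exists a, b => j; rewrite mxE; exact: ab.
Qed.

End DimensionOne.

(** * The theorem *)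

Lemma D_pred_saturated (s : nat -> nat) (D : forall k, 'M[int]_(s k.+1, s k)) k :
  (forall j, (j < k)%N -> saturated (D j)) -> saturated (D_pred D k).
Proof.
case: k => [_|k h]; first exact: saturated_no_col.
exact: (h k (ltnSn k)).
Qed.

Theorem corollary5p27 (R : realType) (d : nat) (S : substitution R d)
    (T : set (tile S))
    (o : set (tile S) -> set 'rV[R]_d -> 'rV[R]_d * 'rV[R]_d)
    (h : R -> 'rV[R]_d -> 'rV[R]_d) :
  is_substitution S -> standing_assumptions S ->
  Omega T -> is_orientation o -> is_homotopy h T ->
  d = 1%N \/ (d = 2%N /\ torsion_free (stable_cohomology T o 1)) ->
  forall k : nat, (k <= 2)%N ->
  exists n : nat,
    zmod_iso (stable_cohomology T o k) 'cV[int]_n /\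
    forall b : 'I_n -> stable_cohomology T o k, is_basis b ->
    exists A : 'M[int]_n,
      [/\ is_matrix_of b (stable_cohomology_map T o h k) A,
          zmod_iso (H_ST T o h k) (matrix_limit A^T) &
          zmod_iso (H_S T o h k) (matrix_limit A)].
Proof.
move=> hS _ OT ho _ dim k k2.
have above j : (d <= j)%N -> stable_num T j.+1 = 0%N.
  by move=> dj; apply: stable_num_above.
have no_rows j : (d <= j)%N -> saturated (delta T o j).
  move=> /above; move: (delta T o j) => M e.
  by move: M; rewrite e => M; exact: saturated_no_row.
have zero_rows j (M : 'M[int]_(stable_num T j.+1, stable_num T j.-1)) :
    (d <= j)%N -> M = 0.
  by move=> /above e; apply/matrixP => i; have := ltn_ord i; rewrite [X in (_ < X)%N]e.
have [DD sat] : (forall j, delta T o j.+1 *m delta T o j = 0) /\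
    (forall j, saturated (delta T o j)).
  case: dim => [d1|[d2 tf]]; subst d.
    split=> [j|[|j]]; [exact: (zero_rows j.+1)|exact: saturated_delta0_dim1|].
    exact: no_rows.
  have DD0 := delta_delta hS ho OT.
  split=> [[|j]|[|[|j]]]; [exact: DD0|exact: (zero_rows j.+2)| | |].
  - exact: torsion_free_saturated DD0 tf.
  - exact: saturated_delta1.
  - exact: no_rows.
have DDk : delta T o k *m D_pred (delta T o) k = 0.
  by case: (k) => [|j]; [exact: mulmx0|exact: DD].
have satk : saturated (D_pred (delta T o) k).
  by apply: D_pred_saturated => j _.
exact: (split_homology_limits (connecting T o h k.+1) (connecting T o h k)
  (W_pred (connecting T o h) k) DDk (sat k) satk).
Qed.
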